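(* Let $(\mu_0,u_0)$ be admissible initial data (in particular the support of $\mu_0$ is $\mathbb{R}$), and let $\phi$, $u$, $X$, $\gamma=\tau(X_0)$ and $Z^1,Z^2,Z^3,Z^4$ be as defined in the context. Let $Z$ stand for any one of $Z^1,Z^2,Z^3,Z^4$, and let $\mathcal{F}^Z$ be the natural non-increasing filtration of $Z$. The process $Z$ is Markovian, and: 1. $t\mapsto u(Z_t,t)\mathbf{1}_{\gamma>t}$ is a process of bounded variation adapted to $\mathcal{F}^Z$. 2. $t\mapsto u(Z_t,t)\mathbf{1}_{\gamma\le t}$ is a backward càdlàg semi-martingale with respect to $\mathcal{F}^Z$. Moreover, $t\mapsto u(Z_t,t)\mathbf{1}_{\gamma\le t}+\mathrm{E}[u_0(X_0)|Z_0]\mathbf{1}_{t<\gamma}$ is a backward martingale. 3. $t\mapsto u(Z_t,t)$ is a backward càdlàg semi-martingale with respect to $\mathcal{F}^Z$. Moreover, $t\mapsto u(Z_t,t)-\big(u_0(Z_0)-\mathrm{E}[u_0(X_0)|Z_0]\big)\mathbf{1}_{t<\gamma}$ is a backward martingale.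
   Context: Admissible initial data: $\mu_0$ is a nonnegative Radon measure on $\mathbb{R}$ with support equal to $\mathbb{R}$; $u_0:\mathbb{R}\to\mathbb{R}$ is locally $\mu_0$-integrable, $x^{-1}u_0(x)\to0$ as $|x|\to\infty$, and the Negative Jump Condition holds: $u_0^-(x)\ge u_0(x)\ge u_0^+(x)$ for all $x$, where $$u_0^-(x)=\limsup_{\varepsilon\to0}\frac{\int_{[x-\varepsilon,x)}u_0\,d\mu_0}{\mu_0[x-\varepsilon,x)},\qquad u_0^+(x)=\liminf_{\varepsilon\to0}\frac{\int_{(x,x+\varepsilon]}u_0\,d\mu_0}{\mu_0(x,x+\varepsilon]}.$$ Sticky particle flow: such data determine a flow $(x,s,t)\mapsto\phi_{s,t}(x)$ on $\mathbb{R}\times\mathbb{R}_+\times\mathbb{R}_+$ ($\phi_{s,t}(x)$ is the position, after a supplementary time $t$, of the particle located at $x$ at time $s$; particles move freely until they collide, and collisions are perfectly inelastic, conserving mass and momentum), with the following properties. (i) $\phi_{s,0}(x)=x$; each $\phi_{s,t}(\cdot)$ is nondecreasing and continuous; $\phi_{s,t}(\phi_{0,s}(y))=\phi_{0,s+t}(y)$. (ii) Write $\phi_{0,t}^{-1}(\{x\})=[\alpha(x,0,t),\beta(x,0,t)]$ (the cluster at position $x$ at time $t$), with $\alpha=\alpha(x,0,t)$, $\beta=\beta(x,0,t)$. If $\alpha<\beta$ then $x=\mu_0([\alpha,\beta])^{-1}\int_{[\alpha,\beta]}(a+tu_0(a))\,d\mu_0(a)$; in any case $x=\alpha+tu_0(\alpha)=\beta+tu_0(\beta)$.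 (iii) If $\mu_0([\alpha,y])>0$ and $\mu_0((y,\beta])>0$, then $\mu_0((y,\beta])^{-1}\int_{(y,\beta]}(a+tu_0(a))\,d\mu_0(a)\le x\le\mu_0([\alpha,y])^{-1}\int_{[\alpha,y]}(a+tu_0(a))\,d\mu_0(a)$. (iv) For $s\le t$: $\phi_{0,s}(\alpha)=\alpha+su_0(\alpha)$ and $\phi_{0,s}(\beta)=\beta+su_0(\beta)$. Velocity field: $u(x,t)=u_t(x)$ is the function such that the right-hand derivative satisfies $\frac{\partial}{\partial t}\phi_{0,t}(y)=u_t(\phi_{0,t}(y))$ for all $y,t$; explicitly $u_t(x)=\mu_0([\alpha,\beta])^{-1}\int_{[\alpha,\beta]}u_0\,d\mu_0$ if $\alpha<\beta$, and $u_t(x)=u_0(\alpha)$ if $\alpha=\beta$, where $[\alpha,\beta]=\phi_{0,t}^{-1}(\{x\})$. Let $u^-(\cdot,t),u^+(\cdot,t)$ be the left-hand and right-hand limit functions of $u(\cdot,t)$ (for $t>0$ they equal $u_0(\alpha(\cdot,0,t))$ and $u_0(\beta(\cdot,0,t))$; for $t=0$ use $u_0^-,u_0^+$). First shock time: $\tau(a)=\inf\{t:\,u^-(\phi_{0,t}(a),t)\ne u^+(\phi_{0,t}(a),t)\}$ (with $\inf\emptyset=\infty$). Turbulent interval containing $a$: the greatest interval $[A,B]\ni a$ such that for all $a'\in[A,B]$, $\tau(a')=\tau(a)=:t$ and $\phi_{0,t}(a')=\phi_{0,t}(a)$ (it is closed). If $\tau(a)=\infty$, it is taken to be $\{a\}$.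 The turbulent intervals partition $\mathbb{R}$. Processes: on a measure space $(\Omega,\mathcal{F},P)$ let $X_0:\Omega\to\mathbb{R}$ be measurable with image measure $P\circ X_0^{-1}=\mu_0$; $X_t=\phi_{0,t}(X_0)$; $\gamma=\tau(X_0)$. If $X_0$ lies in the turbulent interval $[A,B]$ and $x=A+\tau(A)u_0(A)$, then for all $t\ge0$ $$Z^1_t=\phi_{0,t}(A),\quad Z^2_t=\phi_{0,t}(B),\quad Z^3_t=\phi_{0,t}(\alpha(x,0,\tau(A))),\quad Z^4_t=\phi_{0,t}(\beta(x,0,\tau(A))),$$ and all four are equal to $X_t$ if $\gamma=\infty$. Backward notions: $\mathcal{F}^Z_t=\sigma(Z_r,\,r\ge t)$, a non-increasing filtration. Backward martingales and backward semi-martingales with respect to a non-increasing filtration $\mathcal{G}$ are the notions obtained from the usual ones by inversion of time: a backward martingale $M$ is adapted and satisfies $\mathrm{E}[M_s|\mathcal{G}_t]=M_t$ for $s\le t$, and a backward semi-martingale is the sum of a backward (local) martingale and an adapted process of bounded variation. Expectations and conditional expectations are taken with respect to $P$ (which need not be finite). *)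

(* Defs.v *)
From HB Require Import structures.
From mathcomp Require Import all_boot all_order all_algebra.
From mathcomp Require Import all_classical all_reals all_analysis.

Set Implicit Arguments.
Unset Strict Implicit.
Unset Printing Implicit Defensive.

Import Order.TTheory GRing.Theory Num.Theory.
Import numFieldNormedType.Exports.

Local Open Scope classical_set_scope.
Local Open Scope ring_scope.

Section admissible_data.
Context {R : realType}.
Variables (mu0 : {measure set (measurableTypeR R) -> \bar R}) (u0 : R -> R).

(* On the real line, the Radon measures are exactly the Borel measures that
   are finite on compact sets. *)
Definition radon : Prop := forall K : set R, compact K -> (mu0 K < +oo)%E.

Definition msupport : set R :=
  [set x | forall U : set R, open U -> U x -> (0 < mu0 U)%E].

Definition locally_mu_integrable : Prop :=
  measurable_fun [set: measurableTypeR R] u0 /\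
  forall K : set R, compact K -> mu0.-integrable K (EFin \o u0).

Definition mean (D : set R) (f : R -> R) : R :=
  (fine (mu0 D))^-1 * \int[mu0]_(a in D) f a.

(* The one-sided traces at time 0 may be infinite. *)
Definition u0_minus (x : R) : \bar R :=
  limf_esup (fun e : R => (mean `[x - e, x[ u0)%:E) 0^'+.

Definition u0_plus (x : R) : \bar R :=
  limf_einf (fun e : R => (mean `]x, x + e] u0)%:E) 0^'+.

Record admissible : Prop := {
  adm_radon : radon ;
  adm_support : msupport = setT ;
  adm_integrable : locally_mu_integrable ;
  adm_sublinear_pinfty : x^-1 * u0 x @[x --> +oo] --> 0 ;
  adm_sublinear_ninfty : x^-1 * u0 x @[x --> -oo] --> 0 ;
  adm_negative_jump :
    forall x, (u0_plus x <= (u0 x)%:E)%E /\ ((u0 x)%:E <= u0_minus x)%E }.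

End admissible_data.

(* [phi s t x] is the position at time [s + t] of the particle located at [x]
   at time [s]; only nonnegative [s] and [t] are meaningful. *)
Section flow.
Context {R : realType}.
Variables (mu0 : {measure set (measurableTypeR R) -> \bar R}) (u0 : R -> R).
Variable phi : R -> R -> R -> R.

(* End points of the cluster located at [x] at time [t]. *)
Definition alpha (x t : R) : R := inf (phi 0 t @^-1` [set x]).

Definition beta (x t : R) : R := sup (phi 0 t @^-1` [set x]).

(* These properties determine [phi 0 t] for every [t >= 0] (it is the slope,
   with respect to [mu0], of the convex hull of the primitive of
   [a + t * u0 a]), hence also every [phi s t]. *)
Record sticky_flow : Prop := {
  flow0 : forall s x : R, 0 <= s -> phi s 0 x = x ;
  flow_nondecreasing : forall s t : R, 0 <= s -> 0 <= t ->
    {homo phi s t : x y / x <= y} ;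
  flow_continuous : forall s t : R, 0 <= s -> 0 <= t -> continuous (phi s t) ;
  flow_semigroup : forall s t y : R, 0 <= s -> 0 <= t ->
    phi s t (phi 0 s y) = phi 0 (s + t) y ;
  flow_cluster : forall t x : R, 0 <= t ->
    alpha x t <= beta x t /\
    phi 0 t @^-1` [set x] = `[alpha x t, beta x t]%classic ;
  flow_barycenter : forall t x : R, 0 <= t -> alpha x t < beta x t ->
    x = mean mu0 `[alpha x t, beta x t] (fun a => a + t * u0 a) ;
  flow_ends : forall t x : R, 0 <= t ->
    x = alpha x t + t * u0 (alpha x t) /\ x = beta x t + t * u0 (beta x t) ;
  flow_hull : forall t x y : R, 0 <= t ->
    (0 < mu0 `[alpha x t, y]%classic)%E -> (0 < mu0 `]y, beta x t]%classic)%E ->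
    mean mu0 `]y, beta x t] (fun a => a + t * u0 a) <= x /\
    x <= mean mu0 `[alpha x t, y] (fun a => a + t * u0 a) ;
  flow_free_ends : forall s t x : R, 0 <= s -> s <= t ->
    phi 0 s (alpha x t) = alpha x t + s * u0 (alpha x t) /\
    phi 0 s (beta x t) = beta x t + s * u0 (beta x t) }.

Definition velocity (x t : R) : R :=
  if alpha x t < beta x t then mean mu0 `[alpha x t, beta x t] u0
  else u0 (alpha x t).

Definition velocity_minus (x t : R) : \bar R :=
  if t == 0 then u0_minus mu0 u0 x
  else (lim (velocity y t @[y --> x^'-]))%:E.

Definition velocity_plus (x t : R) : \bar R :=
  if t == 0 then u0_plus mu0 u0 x
  else (lim (velocity y t @[y --> x^'+]))%:E.

Definition shock_time (a : R) : \bar R :=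
  ereal_inf [set t%:E | t in [set t : R | 0 <= t /\
    velocity_minus (phi 0 t a) t <> velocity_plus (phi 0 t a) t]].

(* The greatest interval with the required property is the union of all of
   them, since they all contain [a]. *)
Definition turbulent (a : R) : set R :=
  if shock_time a == +oo%E then [set a]
  else \bigcup_(I in [set I : set R | [/\ is_interval I, I a &
      forall a', I a' -> shock_time a' = shock_time a /\
        phi 0 (fine (shock_time a)) a' = phi 0 (fine (shock_time a)) a]]) I.

Definition turb_left (a : R) : R := inf (turbulent a).

Definition turb_right (a : R) : R := sup (turbulent a).

(* Position at which the turbulent interval of [a] enters its first shock;
   meaningful when [shock_time a] is finite. *)
Definition shock_position (a : R) : R :=
  let A := turb_left a in A + fine (shock_time A) * u0 A.

Definition shock_left (a : R) : R :=
  if shock_time a == +oo%E then a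
  else alpha (shock_position a) (fine (shock_time (turb_left a))).

Definition shock_right (a : R) : R :=
  if shock_time a == +oo%E then a
  else beta (shock_position a) (fine (shock_time (turb_left a))).

Context {T : Type}.
Variable X0 : T -> R.

Definition Z1 (t : R) (w : T) : R := phi 0 t (turb_left (X0 w)).
Definition Z2 (t : R) (w : T) : R := phi 0 t (turb_right (X0 w)).
Definition Z3 (t : R) (w : T) : R := phi 0 t (shock_left (X0 w)).
Definition Z4 (t : R) (w : T) : R := phi 0 t (shock_right (X0 w)).

End flow.

Section processes.
Context {R : realType} d {T : measurableType d}.
Variable P : {measure set T -> \bar R}.

Definition sigma_process (Z : R -> T -> R) (I : set R) : set (set T) :=
  <<s \bigcup_(r in I)
        preimage_set_system setT (Z r)
          (@measurable _ (measurableTypeR R)) >>.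

Definition backward_filtration (Z : R -> T -> R) (t : R) : set (set T) :=
  sigma_process Z [set r | t <= r].

Definition sub_sigma_algebra (G : set (set T)) : Prop :=
  sigma_algebra setT G /\ G `<=` measurable.

Definition measurable_wrt (G : set (set T)) (Y : T -> R) : Prop :=
  preimage_set_system setT Y (@measurable _ (measurableTypeR R)) `<=` G.

(* [M] is a version of E[Y | G]. As [P] need not be finite, [Y] is only
   required to be sigma-integrable with respect to [G], i.e. integrable on
   each member of a countable cover by sets of [G]; [M] is then unique up to
   a null set. For an integrable [Y] this is the usual notion. *)
Definition is_cond_exp (G : set (set T)) (Y M : T -> R) : Prop :=
  [/\ sub_sigma_algebra G,
      exists2 F : nat -> set T, \bigcup_n F n = setT &
        forall n, G (F n) /\ P.-integrable (F n) (EFin \o Y),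
      measurable_wrt G M &
      forall A, G A -> P.-integrable A (EFin \o Y) ->
        P.-integrable A (EFin \o M) /\
        (\int[P]_(w in A) (M w)%:E = \int[P]_(w in A) (Y w)%:E)%E].

(* Given the present, the past gives no further information on the events of
   the future. *)
Definition markovian (Z : R -> T -> R) : Prop :=
  forall (t : R) (B : set T), 0 <= t -> sigma_process Z [set r | t <= r] B ->
    exists2 M : T -> R,
      is_cond_exp (sigma_process Z [set t]) (\1_B : T -> R) M &
      is_cond_exp (sigma_process Z [set r | 0 <= r <= t]) (\1_B : T -> R) M.

Definition adapted (G : R -> set (set T)) (Y : R -> T -> R) : Prop :=
  forall t, 0 <= t -> measurable_wrt (G t) (Y t).

Definition backward_martingale (G : R -> set (set T)) (M : R -> T -> R) :=
  adapted G M /\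
  forall s t, 0 <= s -> s <= t -> is_cond_exp (G t) (M s) (M t).

(* Every path has finite total variation over the whole half-line. *)
Definition bounded_variation_process (Y : R -> T -> R) : Prop :=
  forall w, exists C : R, forall t, 0 <= t ->
    (total_variation 0 t (Y ^~ w) <= C%:E)%E.

Definition cadlag (f : R -> R) : Prop :=
  (forall t, 0 <= t -> f r @[r --> t^'+] --> f t) /\
  (forall t, 0 < t -> cvg (f r @[r --> t^'-])).

(* [t] is the forward time in [cadlag]; only the filtration and the martingale
   property are reversed. *)
Definition backward_cadlag_semimartingale
    (G : R -> set (set T)) (Y : R -> T -> R) : Prop :=
  {ae P, forall w, cadlag (Y ^~ w)} /\
  exists M V : R -> T -> R,
    [/\ backward_martingale G M, adapted G V, bounded_variation_process V &
        forall t w, 0 <= t -> Y t w = M t w + V t w].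

End processes.

(* Main.v *)
(* The set of particles that have met the particle [a] by time [t] is an
   interval, the cluster of [a], which grows with [t]; the velocity at the
   position of [a] is the mean of [u0] over it, so that the velocity of [X_t] at
   time [t] is E[u0(X_0) | X_t]. By convexity an end of a nontrivial cluster
   has met no other particle before, whence [tau (Z_0) = gamma]. Hence [Z_t] is
   alone, and determines [Z_0], for [t < gamma], while [Z_t = X_t] for
   [t >= gamma]. Moreover [Z_r] is a function of [Z_t] for [r >= t], so that the
   backward filtration is that of the sigma-algebras of the single variables
   [Z_t], for which [u(Z_t, t) 1_{gamma <= t} + E[u0(X_0) | Z_0] 1_{t < gamma}]
   is E[u0(X_0) | Z_t]; the processes of the statement differ from it by
   processes that are constant before [gamma] and vanish afterwards. The paths
   are right-continuous because clusters shrink to their intersection as time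
   decreases; at time 0 this is an almost sure statement, a Lebesgue
   differentiation theorem along clusters. *)
From HB Require Import structures.
Require Import Defs.
From mathcomp Require Import all_boot all_order all_algebra.
From mathcomp Require Import all_classical all_reals all_analysis.
From mathcomp Require Import measurable_realfun lra ring.

Set Implicit Arguments.
Unset Strict Implicit.
Unset Printing Implicit Defensive.

Import Order.TTheory GRing.Theory Num.Theory.
Import numFieldNormedType.Exports.

Local Open Scope classical_set_scope.
Local Open Scope ring_scope.

(** [shock_time] is defined by jumps of the velocity, whereas every argument is about clusters. For
    positive times the two agree because the one-sided limits of the velocity are the free speeds of
    the two ends of the cluster; a jump at time 0 is read off [u0_minus] and [u0_plus], and it is
    there that the Negative Jump Condition enters. As times and particles are uncountably many,
    measurability is always reduced to rationals: a nontrivial cluster contains one, so averaging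
    over clusters is a countable sum. Differentiation at time 0 rests on a weak-type bound,
    available because clusters of different times are nested or disjoint and can be treated in the
    order of time. As [P] may be infinite, a conditional expectation given [Z_t] calls for a cover
    by events of [Z_t] of finite mass. A bounded position does not provide one, since a particle
    alone at time [t] may represent an initial position that it meets only much later; hence the
    bound on the shock time in [shock_cover]. The four processes are handled together through
    [shock_representative]. *)

Section integration.
Context {d} {T : measurableType d} {R : realType}.
Variable mu : {measure set T -> \bar R}.

(** Dominated convergence for the restrictions [f \_ F n], dominated by [|f|]: at each point of [D]
    they are eventually equal to [f \_ A]. *)
Lemma cvg_Rintegral_set (f : T -> R) (D A : set T) (F : (set T)^nat) :
  measurable D -> measurable A -> (forall n, measurable (F n)) ->
  A `<=` D -> (forall n, F n `<=` D) -> mu.-integrable D (EFin \o f) ->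
  (forall x, D x -> \forall n \near \oo, F n x <-> A x) ->
  \int[mu]_(x in F n) f x @[n --> \oo] --> \int[mu]_(x in A) f x.
Proof.
move=> mD mA mF AD FD fi FA.
have restr B : measurable B -> B `<=` D ->
    \int[mu]_(x in B) f x = fine (\int[mu]_(x in D) ((f \_ B) x)%:E).
  move=> mB BD; congr fine; rewrite -{1}(setIidr BD) integral_mkcondr.
  by apply: eq_integral => x _; rewrite restrict_EFin.
rewrite restr//; under eq_cvg do rewrite restr//.
have intr B : measurable B -> B `<=` D -> mu.-integrable D (EFin \o (f \_ B)).
  move=> mB BD; rewrite -restrict_EFin; apply/integrable_restrict => //.
  apply: integrableS fi => //; first exact: measurableI.
apply: fine_cvg; rewrite fineK; last by apply: integrable_fin_num => //; exact: intr.
apply: (@dominated_cvg _ _ _ mu D mD (fun n => EFin \o (f \_ (F n)))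
  (EFin \o (f \_ A)) (abse \o (EFin \o f))) => //=.
- by move=> n; exact: measurable_int (intr _ (mF n) (FD n)).
- move=> x Dx; apply: (@cvg_near_cst _ _ _ _ \oo); have := FA x Dx.
  apply: filterS => n FnA /=; rewrite !patchE.
  by congr EFin; congr (if _ then _ else _); apply/idP/idP;
    rewrite !inE => /FnA.
- exact: integrable_abse.
- move=> n x Dx /=; rewrite !patchE; case: ifPn => // _.
  by rewrite normr0 lee_fin.
Qed.

Lemma cvg_Rintegral_near_set (f : T -> R) (D A : set T) (F : (set T)^nat) :
  measurable D -> measurable A -> (forall n, measurable (F n)) ->
  A `<=` D -> (\forall n \near \oo, F n `<=` D) -> mu.-integrable D (EFin \o f) ->
  (forall x, D x -> \forall n \near \oo, F n x <-> A x) ->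
  \int[mu]_(x in F n) f x @[n --> \oo] --> \int[mu]_(x in A) f x.
Proof.
move=> mD mA mF AD FD fi FA.
have : \int[mu]_(x in F n `&` D) f x @[n --> \oo] --> \int[mu]_(x in A) f x.
  apply: (cvg_Rintegral_set mD) => //.
  - by move=> n; exact: measurableI.
  - by move=> x Dx; apply: filterS (FA x Dx) => n FnA; split => [[/FnA]|/FnA].
apply: cvg_trans; apply: near_eq_cvg; apply: filterS FD => n FnD.
by rewrite setIidl.
Qed.

Lemma integrableB_EFin (f g : T -> R) (D : set T) : measurable D ->
  mu.-integrable D (EFin \o f) -> mu.-integrable D (EFin \o g) ->
  mu.-integrable D (EFin \o (fun x => f x - g x)).
Proof. by move=> mD fi gi; have := integrableB mD fi gi. Qed.

Lemma integrable_patch (f : T -> R) (D : set T) : measurable D ->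
  mu.-integrable D (EFin \o f) -> mu.-integrable setT (EFin \o (f \_ D)).
Proof. by move=> mD fi; rewrite -restrict_EFin; apply/(integrable_mkcond _ mD). Qed.

End integration.

(** * Clusters *)

(** Clusters are indexed by an initial particle instead of a position, so that the cluster of a
    fixed [a] can be followed in time. *)
Definition left_end {R : realType} (phi : R -> R -> R -> R) (t a : R) : R :=
  alpha phi (phi 0 t a) t.

Definition right_end {R : realType} (phi : R -> R -> R -> R) (t a : R) : R :=
  beta phi (phi 0 t a) t.

Section clusters.
Context {R : realType} {mu0 : {measure set (measurableTypeR R) -> \bar R}}
  {u0 : R -> R} {phi : R -> R -> R -> R}.
Hypothesis fl : sticky_flow mu0 u0 phi.
Local Notation lft := (left_end phi).
Local Notation rgt := (right_end phi).
Local Notation pos := (phi 0).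

Lemma clusterP t a b : 0 <= t -> (pos t b = pos t a) <-> (lft t a <= b <= rgt t a).
Proof.
move=> t0; have [_ E] := flow_cluster fl (pos t a) t0.
have := congr1 (fun A : set R => A b) E; rewrite /= in_itv /= => Eb.
by split => [|h]; [rewrite -Eb | move: h; rewrite -Eb].
Qed.

Lemma cluster_self t a : 0 <= t -> lft t a <= a <= rgt t a.
Proof. by move=> t0; apply/clusterP. Qed.

Lemma left_end_le t a : 0 <= t -> lft t a <= a.
Proof. by move=> /(cluster_self a)/andP[]. Qed.

Lemma right_end_ge t a : 0 <= t -> a <= rgt t a.
Proof. by move=> /(cluster_self a)/andP[]. Qed.

Lemma pos_left_end t a : 0 <= t -> pos t (lft t a) = pos t a.
Proof.
by move=> t0; apply/clusterP => //; rewrite lexx (le_trans (left_end_le _ t0))// right_end_ge.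
Qed.

Lemma pos_right_end t a : 0 <= t -> pos t (rgt t a) = pos t a.
Proof.
by move=> t0; apply/clusterP => //; rewrite lexx (le_trans (left_end_le _ t0))// right_end_ge.
Qed.

Lemma pos_alpha t x : 0 <= t -> pos t (alpha phi x t) = x.
Proof.
move=> t0; have [ab E] := flow_cluster fl x t0.
suff : (pos t @^-1` [set x]) (alpha phi x t) by [].
by rewrite E /= in_itv /= lexx.
Qed.

Lemma left_end_alpha t x : 0 <= t -> lft t (alpha phi x t) = alpha phi x t.
Proof. by move=> t0; rewrite /left_end pos_alpha. Qed.

Lemma right_end_alpha t x : 0 <= t -> rgt t (alpha phi x t) = beta phi x t.
Proof. by move=> t0; rewrite /right_end pos_alpha. Qed.

Lemma pos_freel t a : 0 <= t -> pos t a = lft t a + t * u0 (lft t a).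
Proof. by move=> t0; have [] := flow_ends fl (pos t a) t0. Qed.

Lemma pos_freer t a : 0 <= t -> pos t a = rgt t a + t * u0 (rgt t a).
Proof. by move=> t0; have [] := flow_ends fl (pos t a) t0. Qed.

Lemma left_end_free s t a : 0 <= s -> s <= t ->
  pos s (lft t a) = lft t a + s * u0 (lft t a).
Proof. by move=> s0 st; have [] := flow_free_ends fl (pos t a) s0 st. Qed.

Lemma right_end_free s t a : 0 <= s -> s <= t ->
  pos s (rgt t a) = rgt t a + s * u0 (rgt t a).
Proof. by move=> s0 st; have [] := flow_free_ends fl (pos t a) s0 st. Qed.

Lemma pos_le t a b : 0 <= t -> a <= b -> pos t a <= pos t b.
Proof. by move=> t0; apply: (flow_nondecreasing fl). Qed.

Lemma pos_lt t a b : 0 <= t -> pos t a < pos t b -> a < b.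
Proof. by move=> t0; rewrite !ltNge; apply: contra => /(pos_le t0). Qed.

Lemma right_end_lt_left_end t a b : 0 <= t -> pos t a < pos t b -> rgt t a < lft t b.
Proof.
by move=> t0 ab; apply: (pos_lt t0); rewrite pos_right_end// pos_left_end.
Qed.

Lemma right_end_homo t : 0 <= t -> {homo rgt t : a b / a <= b}.
Proof.
move=> t0 a b /(pos_le t0); rewrite le_eqVlt => /predU1P[e|h].
  by rewrite /right_end e.
apply: ltW; apply: lt_le_trans (right_end_lt_left_end t0 h) _.
by apply: (le_trans (left_end_le _ t0)); exact: right_end_ge.
Qed.

Lemma alpha_homo t : 0 <= t -> {homo (alpha phi)^~ t : x y / x <= y}.
Proof.
move=> t0 x y; rewrite le_eqVlt => /predU1P[->//|xy].
apply: ltW; apply: (pos_lt t0); by rewrite !pos_alpha.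
Qed.

Lemma beta_homo t : 0 <= t -> {homo (beta phi)^~ t : x y / x <= y}.
Proof.
move=> t0 x y /(alpha_homo t0)/(right_end_homo t0).
by rewrite !right_end_alpha.
Qed.

Lemma pos_semigroup s t a : 0 <= s -> s <= t -> pos t a = phi s (t - s) (pos s a).
Proof.
by move=> s0 st; rewrite (flow_semigroup fl) ?subr_ge0// addrC subrK.
Qed.

(** Particles that have met stay together: by the semigroup property the position at [t] is a
    function of the position at [s]. *)
Lemma pos_eq_le s t a b : 0 <= s -> s <= t -> pos s a = pos s b -> pos t a = pos t b.
Proof. by move=> s0 st e; rewrite !(pos_semigroup _ s0 st) e. Qed.

Lemma left_end_time s t a : 0 <= s -> s <= t -> lft t a <= lft s a.
Proof.
move=> s0 st; have t0 := le_trans s0 st.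
have /clusterP /andP[]// : pos t (lft s a) = pos t a.
by apply: (pos_eq_le s0 st); exact: pos_left_end.
Qed.

Lemma right_end_time s t a : 0 <= s -> s <= t -> rgt s a <= rgt t a.
Proof.
move=> s0 st; have t0 := le_trans s0 st.
have /clusterP /andP[]// : pos t (rgt s a) = pos t a.
by apply: (pos_eq_le s0 st); exact: pos_right_end.
Qed.

Lemma left_end0 a : lft 0 a = a.
Proof.
have := pos_left_end a (lexx 0); by rewrite !(flow0 fl).
Qed.

Lemma right_end0 a : rgt 0 a = a.
Proof.
have := pos_right_end a (lexx 0); by rewrite !(flow0 fl).
Qed.

Lemma unmerged t a : 0 <= t -> ~~ (lft t a < rgt t a) ->
  lft t a = a /\ rgt t a = a.
Proof.
move=> t0; rewrite -leNgt => ba.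
have /andP[la ar] := cluster_self a t0.
by split; apply/le_anti; rewrite ?la ?ar ?(le_trans _ ba)// ?(le_trans ba).
Qed.

Lemma merged_time s t a : 0 <= s -> s <= t -> lft s a < rgt s a -> lft t a < rgt t a.
Proof.
move=> s0 st h; apply: (le_lt_trans (left_end_time a s0 st)).
by apply: (lt_le_trans h); exact: right_end_time.
Qed.

Lemma cluster_preimage t a : 0 <= t ->
  `[lft t a, rgt t a]%classic = pos t @^-1` [set pos t a].
Proof.
move=> t0; apply/seteqP; split => b; rewrite /= in_itv /=.
  by move/clusterP; apply.
by move/(clusterP _ _ t0).
Qed.

End clusters.

(** * Local integrability, and means compared through signs of integrals *)

Section local_integrability.
Context {R : realType} {mu0 : {measure set (measurableTypeR R) -> \bar R}}.
Implicit Types f g : R -> R.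
Local Notation locint := (locally_mu_integrable mu0).

Lemma locint_integrable f (D : set (measurableTypeR R)) a b : locint f -> measurable D ->
  D `<=` `[a, b] -> mu0.-integrable D (EFin \o f).
Proof.
move=> [_ fi] mD Dab; apply: integrableS (fi `[a, b]%classic _) => //.
exact: segment_compact.
Qed.

Lemma locintD f g : locint f -> locint g -> locint (f \+ g).
Proof.
move=> [mf fi] [mg gi]; split; first exact: measurable_funD.
move=> K cK; have mK : measurable (K : set (measurableTypeR R)).
  exact: compact_measurable.
exact: integrableD (fi _ cK) (gi _ cK).
Qed.

Lemma locintZ k f : locint f -> locint (fun x => k * f x).
Proof.
move=> [mf fi]; split; first exact: measurable_funM.
move=> K cK; have mK : measurable (K : set (measurableTypeR R)).
  exact: compact_measurable.
exact: integrableZl (fi _ cK).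
Qed.

Hypothesis rad : radon mu0.

Lemma radon_finite (D : set (measurableTypeR R)) a b : measurable D -> D `<=` `[a, b] ->
  (mu0 D < +oo)%E.
Proof.
move=> mD Dab; apply: le_lt_trans (rad (@segment_compact R a b)).
by apply: le_measure; rewrite ?inE.
Qed.

Lemma radon_fin_num (D : set (measurableTypeR R)) a b : measurable D -> D `<=` `[a, b] ->
  mu0 D \is a fin_num.
Proof. by move=> mD Dab; rewrite ge0_fin_numE//; exact: radon_finite Dab. Qed.

Lemma locint_bounded_measurable f : measurable_fun [set: measurableTypeR R] f ->
  (forall K : set R, compact K -> [bounded f x | x in K]) -> locint f.
Proof.
move=> mf bf; split => // K cK.
apply: measurable_bounded_integrable.
- exact: compact_measurable.
- exact: rad.
- exact: measurable_funTS.
- exact: bf.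
Qed.

Lemma locint_cst k : locint (fun=> k).
Proof.
apply: locint_bounded_measurable => // K _.
by exists `|k|; split => // x /ltW kx y _; exact: kx.
Qed.

Lemma locint_id : locint idfun.
Proof.
apply: locint_bounded_measurable; first exact: measurable_id.
move=> K /compact_bounded[M [Mr MK]].
by exists M; split => // x /MK h y Ky; exact: h.
Qed.

Lemma Rintegral_subcst (D : set (measurableTypeR R)) a b f x : locint f -> measurable D ->
  D `<=` `[a, b] ->
  \int[mu0]_(c in D) (f c - x) = \int[mu0]_(c in D) f c - x * fine (mu0 D).
Proof.
move=> fi mD Dab.
rewrite RintegralB//; last 2 first.
  exact: locint_integrable Dab.
  exact: (locint_integrable (locint_cst x)) Dab.
by rewrite Rintegral_cst.
Qed.

(** Comparing a mean with [x] becomes the sign of an integral, a form that can be split along [D]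
    and combined between different times. *)
Lemma mean_le (D : set (measurableTypeR R)) a b f x : locint f -> measurable D ->
  D `<=` `[a, b] -> (0 < mu0 D)%E ->
  (mean mu0 D f <= x) = (\int[mu0]_(c in D) (f c - x) <= 0).
Proof.
move=> fi mD Dab D0; rewrite (Rintegral_subcst _ fi mD Dab) subr_le0 /mean.
by rewrite mulrC ler_pdivrMr// fine_gt0// D0 (radon_finite _ Dab).
Qed.

Lemma mean_ge (D : set (measurableTypeR R)) a b f x : locint f -> measurable D ->
  D `<=` `[a, b] -> (0 < mu0 D)%E ->
  (x <= mean mu0 D f) = (0 <= \int[mu0]_(c in D) (f c - x)).
Proof.
move=> fi mD Dab D0; rewrite (Rintegral_subcst _ fi mD Dab) subr_ge0 /mean.
by rewrite mulrC ler_pdivlMr// fine_gt0// D0 (radon_finite _ Dab).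
Qed.

Lemma mean_eq (D : set (measurableTypeR R)) a b f x : locint f -> measurable D ->
  D `<=` `[a, b] -> (0 < mu0 D)%E ->
  (x = mean mu0 D f) <-> (\int[mu0]_(c in D) (f c - x) = 0).
Proof.
move=> fi mD Dab D0; split => e; apply/le_anti.
  rewrite -(mean_le x fi mD Dab D0) -(mean_ge x fi mD Dab D0) -e.
  by rewrite lexx.
by rewrite (mean_le x fi mD Dab D0) (mean_ge x fi mD Dab D0) e lexx.
Qed.

Hypothesis supp : msupport mu0 = setT.

Lemma support_itv_gt0 a b (D : set (measurableTypeR R)) : a < b -> measurable D -> `]a, b[ `<=` D ->
  (0 < mu0 D)%E.
Proof.
move=> ab mD abD; apply: (@lt_le_trans _ _ (mu0 `]a, b[%classic)).
  have : msupport mu0 ((a + b) / 2) by rewrite supp.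
  by apply; [exact: interval_open|rewrite /= in_itv /=; lra].
by apply: le_measure; rewrite ?inE.
Qed.

(** Full support gives the strict inequality: a zero integral would place the whole of []c, d[]
    inside a null set. *)
Lemma Rintegral_gt0 a b (D : set (measurableTypeR R)) f c d : c < d -> locint f -> measurable D ->
  `]c, d[ `<=` D -> D `<=` `[a, b] -> (forall x, D x -> 0 <= f x) ->
  (forall x, x \in `]c, d[ -> 0 < f x) ->
  0 < \int[mu0]_(x in D) f x.
Proof.
move=> cd fi mD cdD Dab f0 fpos.
have Di := locint_integrable fi mD Dab.
rewrite lt_neqAle Rintegral_ge0// andbT eq_sym; apply/eqP => e.
have : (\int[mu0]_(x in D) `|(f x)%:E| = 0)%E.
  rewrite -[RHS]/(0%:E) -e /Rintegral fineK ?integrable_fin_num//.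
  by apply: eq_integral => x; rewrite inE => /f0 h; rewrite gee0_abs// lee_fin.
move/(@ae_eq_integral_abs _ _ _ mu0 _ mD).
have mfi : measurable_fun D (EFin \o f) by exact: measurable_int Di.
move=> /(_ mfi) [N [mN N0 DN]].
have : (0 < mu0 N)%E.
  apply: (support_itv_gt0 cd) => // x xcd; apply: DN => /= h.
  have := h (cdD _ xcd); have := fpos _ xcd.
  by move=> /[swap] -[->]; rewrite ltxx.
by rewrite N0 ltxx.
Qed.

End local_integrability.

(** * Barycenter and hull inequalities of a cluster *)

Section hull.
Context {R : realType} {mu0 : {measure set (measurableTypeR R) -> \bar R}}
  {u0 : R -> R} {phi : R -> R -> R -> R}.
Hypothesis adm : admissible mu0 u0.
Hypothesis fl : sticky_flow mu0 u0 phi.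
Local Notation lft := (left_end phi).
Local Notation rgt := (right_end phi).
Local Notation pos := (phi 0).

Lemma locint_free t : locally_mu_integrable mu0 (fun c => c + t * u0 c).
Proof.
have rad := adm_radon adm.
exact: locintD (locint_id rad) (locintZ t (adm_integrable adm)).
Qed.

(** The centred form covers trivial clusters as well: there the integrand vanishes at the only
    point, whether or not it is an atom. *)
Lemma barycenter t a : 0 <= t ->
  \int[mu0]_(c in `[lft t a, rgt t a]) (c + t * u0 c - pos t a) = 0.
Proof.
move=> t0; have [m|m] := boolP (lft t a < rgt t a).
  apply/(mean_eq (adm_radon adm) (a := lft t a) (b := rgt t a) _ (locint_free t)) => //.
    by apply: (support_itv_gt0 (adm_support adm) m) => // x; exact: subset_itv_oo_cc.
  exact: (flow_barycenter fl).
have [la ra] := unmerged fl t0 m.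
rewrite la ra set_itv1.
transitivity (\int[mu0]_(c in [set a]) (0 : R)); last by rewrite Rintegral_cst ?mul0r.
apply: eq_Rintegral => x; rewrite inE /= => ->.
by apply/eqP; rewrite subr_eq0 (pos_freel fl)// la.
Qed.

Lemma hull_left t a b : 0 <= t -> lft t a <= b <= rgt t a ->
  0 <= \int[mu0]_(c in `[lft t a, b]) (c + t * u0 c - pos t a).
Proof.
move=> t0 /andP[lb]; rewrite le_eqVlt => /predU1P[->|br]; first by rewrite barycenter.
move: lb; rewrite le_eqVlt => /predU1P[<-|lb].
  apply: Rintegral_ge0 => x; rewrite set_itv1 /= => ->.
  by rewrite subr_ge0 (pos_freel fl)// left_end_alpha.
have supp := adm_support adm.
have lpos : (0 < mu0 `[lft t a, b]%classic)%E.
  by apply: (support_itv_gt0 supp lb) => // x; exact: subset_itv_oo_cc.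
have rpos : (0 < mu0 `]b, rgt t a]%classic)%E.
  by apply: (support_itv_gt0 supp br) => // x; exact: subset_itv_oo_oc.
have [_] := flow_hull fl t0 lpos rpos.
by rewrite (mean_ge (adm_radon adm) (a := lft t a) (b := b) _ (locint_free t)).
Qed.

(** [flow_hull] speaks of []y, rgt t a]], and [b] may be an atom; the closed interval is the limit
    of []y n, rgt t a]] as [y n] increases to [b]. *)
Lemma hull_right t a b : 0 <= t -> lft t a <= b <= rgt t a ->
  \int[mu0]_(c in `[b, rgt t a]) (c + t * u0 c - pos t a) <= 0.
Proof.
move=> t0 /andP[]; rewrite le_eqVlt => /predU1P[<- _|lb br]; first by rewrite barycenter.
have supp := adm_support adm; have rad := adm_radon adm.
(* The shift to [n.+1] keeps the factor below 1, so [y n] stays strictly to the right of [lft t a]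
   and both masses required by [flow_hull] are positive. *)
pose y n := b - (b - lft t a) * harmonic n.+1.
have hy n : lft t a < y n < b.
  have h0 : 0 < harmonic n.+1 :> R by rewrite /harmonic invr_gt0.
  have h1 : harmonic n.+1 < 1 :> R by rewrite /harmonic invf_lt1// ltr1n.
  rewrite /y ltrBrDl -ltrBrDr ltrBlDr ltrDl.
  by rewrite -[X in _ < X]mulr1 ltr_pM2l ?h1 ?mulr_gt0// subr_gt0.
have ycvg : y n @[n --> \oo] --> b.
  rewrite -[X in _ --> X]subr0; apply: cvgB; first exact: cvg_cst.
  rewrite -(mulr0 (b - lft t a)); apply: cvgM; first exact: cvg_cst.
  by have := @cvg_harmonic R; rewrite -cvg_shiftS.
apply: (@cvgr_to_le _ \oo _ R
    (fun n => \int[mu0]_(c in `]y n, rgt t a]) (c + t * u0 c - pos t a))).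
  apply: (@cvg_Rintegral_set _ _ _ mu0 _ `[lft t a, rgt t a]%classic) => //.
  - by move=> x /=; rewrite !in_itv /= => /andP[bx ->]; rewrite (le_trans (ltW lb)).
  - move=> n x /=; rewrite !in_itv /= => /andP[bx ->]; rewrite andbT.
    by have /andP[/lt_trans/(_ bx)/ltW] := hy n.
  - exact: (locint_integrable (locintD (locint_free t) (locint_cst rad (- pos t a))) _ (@subset_refl _ _)).
  - move=> x _; have [bx|xb] := leP b x.
      near=> n; rewrite /= !in_itv /= bx.
      by have /andP[_ /lt_le_trans/(_ bx) ->] := hy n.
    have : \forall n \near \oo, x < y n.
      exact: (cvgr_gt b ycvg).
    apply: filterS => n xy; rewrite /= !in_itv /= (leNgt b x) xb (ltNge (y n) x).
    by rewrite (ltW xy).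
apply: nearW => n; have /andP[ly yb] := hy n.
have yr := lt_le_trans yb br.
have lpos : (0 < mu0 `[lft t a, y n]%classic)%E.
  by apply: (support_itv_gt0 supp ly) => // x; exact: subset_itv_oo_cc.
have rpos : (0 < mu0 `]y n, rgt t a]%classic)%E.
  by apply: (support_itv_gt0 supp yr) => // x; exact: subset_itv_oo_oc.
have [+ _] := flow_hull fl t0 lpos rpos.
rewrite (mean_le rad (a := y n) (b := rgt t a) _ (locint_free t))//.
by move=> x; exact: subset_itv_oc_cc.
Unshelve. all: by end_near.
Qed.

(* The ends of a nontrivial cluster at time [s] are overtaken right away: by
   convexity, the barycenter at time [t > s] would lie on the wrong side. *)
Lemma left_end_fresh s t a : 0 <= s -> s < t -> lft t a = a -> rgt s a = a.
Proof.
move=> s0 st la; have t0 := le_trans s0 (ltW st).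
have lsa : lft s a = a.
  apply/le_anti; rewrite (left_end_le fl)//= -{1}la.
  by rewrite (left_end_time fl)// ltW.
apply/le_anti; rewrite (right_end_ge fl)// andbT leNgt; apply/negP => ar.
have rad := adm_radon adm; have supp := adm_support adm.
have rr : rgt s a <= rgt t a by apply: (right_end_time fl); rewrite // ltW.
have := hull_left (a := a) (b := rgt s a) t0.
rewrite la (le_trans (ltW ar))// rr => /(_ isT).
apply/negP; rewrite -ltNge.
have sn0 : s != 0 by apply: contraTneq ar => ->; rewrite (right_end0 fl) ltxx.
have sgt0 : 0 < s by rewrite lt_neqAle eq_sym sn0.
have ts : 0 < t / s - 1 by rewrite subr_gt0 ltr_pdivlMr// mul1r.
have := barycenter a s0; rewrite lsa => bs.
have pa : pos s a = a + s * u0 a by rewrite (pos_freel fl)// lsa.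
have pb : pos t a = a + t * u0 a by rewrite (pos_freel fl)// la.
have li := locintD (locint_free s) (locint_cst rad (- pos s a)).
have lc := locintD (locint_id rad) (locint_cst rad (- a)).
have I f : locally_mu_integrable mu0 f -> mu0.-integrable `[a, rgt s a] (EFin \o f).
  by move=> fi; exact: (locint_integrable fi _ (@subset_refl _ _)).
(* [u0] is eliminated between the two times: [a] is free up to [t], so what differs from a multiple
   of the centred position at [s] is a multiple of [c - a]. The first part integrates to zero over
   the cluster of time [s], the second to something strictly positive. *)
have -> : \int[mu0]_(c in `[a, rgt s a]) (c + t * u0 c - pos t a) =
    \int[mu0]_(c in `[a, rgt s a])
      ((t / s) * (c + s * u0 c - pos s a) - (t / s - 1) * (c - a)).
  by apply: eq_Rintegral => c _; rewrite pa pb; field.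
rewrite RintegralB//; last 2 first.
  exact: I (locintZ _ li).
  exact: I (locintZ _ lc).
rewrite !RintegralZl//; last 2 first.
  exact: I lc.
  exact: I li.
rewrite bs mulr0 sub0r oppr_lt0 mulr_gt0//.
apply: (Rintegral_gt0 supp (a := a) (b := rgt s a) ar lc) => //.
- by move=> x; exact: subset_itv_oo_cc.
- by move=> x /=; rewrite in_itv /= subr_ge0 => /andP[].
- by move=> x /=; rewrite in_itv /= subr_gt0 => /andP[].
Qed.

Lemma right_end_fresh s t a : 0 <= s -> s < t -> rgt t a = a -> lft s a = a.
Proof.
move=> s0 st ra; have t0 := le_trans s0 (ltW st).
have rsa : rgt s a = a.
  apply/le_anti; rewrite (right_end_ge fl)// andbT -{2}ra.
  by rewrite (right_end_time fl)// ltW.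
apply/le_anti; rewrite (left_end_le fl)//= leNgt; apply/negP => ar.
have rad := adm_radon adm; have supp := adm_support adm.
have rr : lft t a <= lft s a by apply: (left_end_time fl); rewrite // ltW.
have := hull_right (a := a) (b := lft s a) t0.
rewrite ra (le_trans rr)//= (ltW ar) => /(_ isT).
apply/negP; rewrite -ltNge.
have sn0 : s != 0 by apply: contraTneq ar => ->; rewrite (left_end0 fl) ltxx.
have sgt0 : 0 < s by rewrite lt_neqAle eq_sym sn0.
have ts : 0 < t / s - 1 by rewrite subr_gt0 ltr_pdivlMr// mul1r.
have := barycenter a s0; rewrite rsa => bs.
have pa : pos s a = a + s * u0 a by rewrite (pos_freer fl)// rsa.
have pb : pos t a = a + t * u0 a by rewrite (pos_freer fl)// ra.
have li := locintD (locint_free s) (locint_cst rad (- pos s a)).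
have lc := locintD (locintZ (-1) (locint_id rad)) (locint_cst rad a).
have I f : locally_mu_integrable mu0 f -> mu0.-integrable `[lft s a, a] (EFin \o f).
  by move=> fi; exact: (locint_integrable fi _ (@subset_refl _ _)).
have -> : \int[mu0]_(c in `[lft s a, a]) (c + t * u0 c - pos t a) =
    \int[mu0]_(c in `[lft s a, a])
      ((t / s) * (c + s * u0 c - pos s a) + (t / s - 1) * (-1 * c + a)).
  by apply: eq_Rintegral => c _; rewrite pa pb; field.
rewrite RintegralD//; last 2 first.
  exact: I (locintZ _ li).
  exact: I (locintZ _ lc).
rewrite !RintegralZl//; last 2 first.
  exact: I lc.
  exact: I li.
rewrite bs mulr0 add0r mulr_gt0//.
apply: (Rintegral_gt0 supp (a := lft s a) (b := a) ar lc) => //.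
- by move=> x; exact: subset_itv_oo_cc.
- by move=> x /=; rewrite in_itv /= mulN1r addrC subr_ge0 => /andP[].
- by move=> x /=; rewrite in_itv /= mulN1r addrC subr_gt0 => /andP[].
Qed.

End hull.

(** The bound on absolute values over each piece is what makes [g] integrable on the union; only
    then can the equal integrals be summed. *)
Lemma integral_bigcup_averaged {d} {T : measurableType d} {R : realType}
    (mu : {measure set T -> \bar R}) (f g : T -> R) (B : (set T)^nat) :
  (forall n, measurable (B n)) -> trivIset setT B ->
  mu.-integrable (\bigcup_n B n) (EFin \o f) ->
  (forall n, measurable_fun (B n) g) ->
  (forall n, \int[mu]_(x in B n) `|(g x)%:E| <= \int[mu]_(x in B n) `|(f x)%:E|)%E ->
  (forall n, \int[mu]_(x in B n) (g x)%:E = \int[mu]_(x in B n) (f x)%:E)%E ->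
  mu.-integrable (\bigcup_n B n) (EFin \o g) /\
  (\int[mu]_(x in \bigcup_n B n) (g x)%:E = \int[mu]_(x in \bigcup_n B n) (f x)%:E)%E.
Proof.
move=> mB tB fi mg gf gfE.
have mgU : measurable_fun (\bigcup_n B n) g by exact/measurable_fun_bigcup.
have gi : mu.-integrable (\bigcup_n B n) (EFin \o g).
  apply/integrableP; split; first exact/measurable_EFinP.
  have [/measurable_EFinP mf] := integrableP _ _ _ fi.
  apply: le_lt_trans.
  rewrite !ge0_integral_bigcup//; last 2 first.
  - by apply/measurable_EFinP/measurableT_comp.
  - by apply/measurable_EFinP/measurableT_comp.
  by apply: lee_nneseries => n _; [move=> ?; exact: integral_ge0|exact: gf].
split => //; rewrite !integral_bigcup//.
by apply: eq_eseriesr => n _; exact: gfE.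
Qed.

(** An enumeration by [nat], so that unions over rationals are countable unions; integers that code
    no rational give 0, itself a rational. *)
Definition rational_nth {R : realType} (n : nat) : R :=
  if unpickle n is Some q then ratr q else 0.

Lemma rational_nth_dense {R : realType} (x y : R) : x < y ->
  exists n, x < rational_nth n < y.
Proof.
move=> /rat_in_itvoo[q]; rewrite in_itv /= => xy.
by exists (pickle q); rewrite /rational_nth pickleK.
Qed.

(** A version of the conditional expectation of [f] given [phi 0 t]. A trivial cluster may have
    measure zero, where [mean] is a division by zero; the value [f a] replaces it. *)
Definition cluster_mean {R : realType} (mu0 : {measure set (measurableTypeR R) -> \bar R})
    (phi : R -> R -> R -> R) (f : R -> R) (t a : R) : R :=
  if left_end phi t a < right_end phi t a
  then mean mu0 `[left_end phi t a, right_end phi t a] f else f a.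

(** The unions of clusters of time [t]: when measurable, these are the sets on which averaging over
    clusters preserves integrals. *)
Definition saturated {R : realType} (phi : R -> R -> R -> R) (t : R) (S : set R) :=
  forall a b, S a -> phi 0 t b = phi 0 t a -> S b.

(** * Cluster means as conditional expectations *)

Section averaging.
Context {R : realType} {mu0 : {measure set (measurableTypeR R) -> \bar R}}
  {u0 : R -> R} {phi : R -> R -> R -> R}.
Hypothesis adm : admissible mu0 u0.
Hypothesis fl : sticky_flow mu0 u0 phi.
Local Notation lft := (left_end phi).
Local Notation rgt := (right_end phi).
Local Notation pos := (phi 0).

Lemma cluster_mean_pos f t a b : 0 <= t -> lft t a < rgt t a ->
  pos t a = pos t b -> cluster_mean mu0 phi f t a = cluster_mean mu0 phi f t b.
Proof. by move=> t0 m e; move: m; rewrite /cluster_mean /left_end /right_end e => ->. Qed.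

Lemma cluster_mean_free t a : 0 <= t ->
  cluster_mean mu0 phi (fun c => c + t * u0 c) t a = pos t a.
Proof.
move=> t0; rewrite /cluster_mean; case: ifPn => [m|/(unmerged fl t0)[la _]].
  by rewrite -(flow_barycenter fl).
by rewrite (pos_freel fl)// la.
Qed.

Lemma velocity_pos t a : 0 <= t ->
  velocity mu0 u0 phi (pos t a) t = cluster_mean mu0 phi u0 t a.
Proof.
move=> t0; rewrite /velocity /cluster_mean -/(lft t a) -/(rgt t a).
by case: ifPn => // /(unmerged fl t0)[->].
Qed.

Let merged_nth t n : set R :=
  [set b | lft t (rational_nth n) < rgt t (rational_nth n) /\
     pos t b = pos t (rational_nth n)].

(** A nontrivial cluster contains a rational, so there are only countably many of them. *)
Let mergedE t : 0 <= t -> [set a | lft t a < rgt t a] = \bigcup_n merged_nth t n.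
Proof.
move=> t0; apply/seteqP; split => [a /= m|a [n _] /= [m e]]; last first.
  by rewrite /left_end /right_end e.
have [n /andP[/ltW ln /ltW nr]] := rational_nth_dense m.
have e : pos t (rational_nth n) = pos t a by apply/(clusterP fl _ _ t0); rewrite ln.
by exists n => //; rewrite /merged_nth /= /left_end /right_end e.
Qed.

Let merged_nth_measurable t n : 0 <= t -> measurable (merged_nth t n).
Proof.
move=> t0; rewrite /merged_nth; have [m|m] := boolP (lft t (rational_nth n) < rgt t (rational_nth n)).
  rewrite (_ : mkset _ = `[lft t (rational_nth n), rgt t (rational_nth n)]%classic)//.
  by rewrite (cluster_preimage fl)//; apply/seteqP; split => x //= [].
by rewrite (_ : mkset _ = set0)//; apply/seteqP; split => x //= [].
Qed.

Lemma merged_measurable t : 0 <= t ->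
  measurable ([set a | lft t a < rgt t a] : set (measurableTypeR R)).
Proof.
by move=> t0; rewrite mergedE//; apply: bigcupT_measurable => n; exact: merged_nth_measurable.
Qed.

(** On each nontrivial cluster contained in [S] the cluster mean is a constant with the same
    integral as [f], and elsewhere it is [f]. There are countably many such clusters, over which
    [integral_bigcup_averaged] sums. *)
Lemma integral_cluster_mean f (t : R) (S : set (measurableTypeR R)) :
  locally_mu_integrable mu0 f -> 0 <= t -> measurable S -> saturated phi t S ->
  mu0.-integrable S (EFin \o f) ->
  mu0.-integrable S (EFin \o cluster_mean mu0 phi f t) /\
  (\int[mu0]_(a in S) (cluster_mean mu0 phi f t a)%:E = \int[mu0]_(a in S) (f a)%:E)%E.
Proof.
move=> lf t0 mS sS fS; set g := cluster_mean mu0 phi f t.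
have rad := adm_radon adm; have supp := adm_support adm.
pose M : set (measurableTypeR R) := [set a | lft t a < rgt t a].
have mM : measurable M by exact: merged_measurable.
(* Several rationals lie in the same cluster; [seqDU] keeps only the first of them. As [S] is
   saturated, each [B n] is either empty or a whole nontrivial cluster. *)
pose B n : set (measurableTypeR R) := seqDU (merged_nth t) n `&` S.
have mB n : measurable (B n).
  apply: measurableI => //; apply: measurableD; first exact: merged_nth_measurable.
  by apply: bigsetU_measurable => i _; exact: merged_nth_measurable.
have UB : \bigcup_n B n = M `&` S.
  by rewrite -setI_bigcupl -seqDU_bigcup_eq /M mergedE.
have clB n a : B n a -> B n = `[lft t a, rgt t a]%classic /\ lft t a < rgt t a.
  move=> [[[m e] nprev] Sa]; split; last by rewrite /left_end /right_end e.
  rewrite (cluster_preimage fl)//; apply/seteqP; split => [b [[[_ e'] _] _]|b /= ba].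
    by rewrite /= e' e.
  split; last exact: sS Sa ba.
  split; first by split => //; rewrite ba.
  move: nprev; apply: contra_not; rewrite -!bigcup_mkord => -[i ni [mi ei]].
  by exists i => //; split => //; rewrite -ba.
have BE n : B n = set0 \/ exists a, [/\ B n = `[lft t a, rgt t a]%classic,
    lft t a < rgt t a & forall b, B n b -> g b = mean mu0 (B n) f].
  have [|/set0P[a Ba]] := eqVneq (B n) set0; [by left|right; exists a].
  have [EB m] := clB _ _ Ba; split => // b Bb.
  by rewrite /g /cluster_mean; have [<- ->] := clB _ _ Bb.
have mg n : measurable_fun (B n) g.
  have [->|[a [_ _ gB]]] := BE n; first exact: measurable_fun_set0.
  apply: (eq_measurable_fun (cst (mean mu0 (B n) f))); last exact: measurable_cst.
  by move=> b; rewrite inE => /gB ->.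
have fB n : mu0.-integrable (B n) (EFin \o f).
  by apply: integrableS fS => // x [].
have mean_int n : (\int[mu0]_(x in B n) (mean mu0 (B n) f)%:E =
    \int[mu0]_(x in B n) (f x)%:E)%E.
  have [->|[a [EB m _]]] := BE n; first by rewrite !integral_set0.
  rewrite integral_cst// -(fineK (integrable_fin_num (mB n) (fB n))).
  have Bpos : (0 < mu0 (B n))%E.
    by rewrite EB; apply: (support_itv_gt0 supp m) => // x; exact: subset_itv_oo_cc.
  have Bfin : mu0 (B n) \is a fin_num.
    by rewrite EB; exact: (radon_fin_num rad _ (@subset_refl _ _)).
  rewrite -(fineK Bfin) -EFinM /mean -[in RHS]/(\int[mu0]_(x in B n) f x)%R.
  congr EFin; rewrite mulrAC mulVf ?mul1r//.
  by rewrite gt_eqF// fine_gt0// Bpos ltey_eq Bfin.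
have gB n x : B n x -> g x = mean mu0 (B n) f.
  by have [->//|[a [_ _ ]]] := BE n; exact.
have gi n : (\int[mu0]_(x in B n) (g x)%:E = \int[mu0]_(x in B n) (f x)%:E)%E.
  by rewrite -mean_int; apply: eq_integral => x; rewrite inE => /gB ->.
have gfabs n : (\int[mu0]_(x in B n) `|(g x)%:E| <= \int[mu0]_(x in B n) `|(f x)%:E|)%E.
  apply: (@le_trans _ _ `|\int[mu0]_(x in B n) (f x)%:E|%E); last first.
    by apply: le_abse_integral => //; exact: measurable_int (fB n).
  rewrite -mean_int integral_cst// abseM (gee0_abs (measure_ge0 _ _)).
  rewrite -integral_cst//.
  rewrite le_eqVlt; apply/predU1P; left.
  by apply: eq_integral => x; rewrite inE => /gB ->.
have tB : trivIset setT B.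
  exact: trivIset_setIr (@trivIset_seqDU _ _).
have := integral_bigcup_averaged mB tB _ mg gfabs gi.
rewrite UB => /(_ _)[|giM gE].
  by apply: integrableS fS => //; exact: measurableI.
have SE : S = (M `&` S) `|` (S `\` M) by rewrite setIC setUIDK.
have gN x : (S `\` M) x -> g x = f x.
  by move=> [_ /negP m]; rewrite /g /cluster_mean ifN.
have giN : mu0.-integrable (S `\` M) (EFin \o g).
  have mSM : measurable (S `\` M) by exact: measurableD.
  apply: (eq_integrable mSM (EFin \o f)); last exact: integrableS fS.
  by move=> x; rewrite inE => /gN /= ->.
have mMS : measurable (M `&` S) by exact: measurableI.
have mSM : measurable (S `\` M) by exact: measurableD.
have mgS : measurable_fun S (EFin \o g).
  rewrite SE; apply/measurable_funU => //.
  by split; [exact: measurable_int giM|exact: measurable_int giN].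
have giS : mu0.-integrable S (EFin \o g).
  apply/integrableP; split => //; rewrite SE ge0_integral_setU//.
  - by apply: lte_add_pinfty; [have /integrableP[] := giM|have /integrableP[] := giN].
  - by rewrite -SE; exact: measurableT_comp.
  - by apply/disj_setPS => x [[Mx _] [_ /(_ Mx)]].
split => //.
have dis : [disjoint M `&` S & S `\` M].
  by apply/disj_setPS => x [[Mx _] [_ /(_ Mx)]].
rewrite SE !integral_setU// -?SE//; last exact: measurable_int fS.
congr (_ + _)%E => //.
by apply: eq_integral => x; rewrite inE => /gN ->.
Qed.

End averaging.

(** * Shock times *)

Section shock_times.
Context {R : realType} {mu0 : {measure set (measurableTypeR R) -> \bar R}}
  {u0 : R -> R} {phi : R -> R -> R -> R}.
Hypothesis adm : admissible mu0 u0.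
Hypothesis fl : sticky_flow mu0 u0 phi.
Local Notation lft := (left_end phi).
Local Notation rgt := (right_end phi).
Local Notation pos := (phi 0).

Implicit Types t s x y a b : R.

Lemma locint_free_sub t x :
  locally_mu_integrable mu0 (fun c => c + t * u0 c - x).
Proof. exact: locintD (locint_free adm t) (locint_cst (adm_radon adm) (- x)). Qed.

Lemma locint_sub x : locally_mu_integrable mu0 (fun c => u0 c - x).
Proof. exact: locintD (adm_integrable adm) (locint_cst (adm_radon adm) (- x)). Qed.

(** Replacing [c] by its lower bound [a] in [c + t * u0 c - x] turns a bound on the centre of mass
    into a bound on the mean velocity. *)
Lemma mean_velocity_le t a b x (D : set (measurableTypeR R)) : 0 < t -> measurable D ->
  (0 < mu0 D)%E -> D `<=` `[a, b] ->
  \int[mu0]_(c in D) (c + t * u0 c - x) <= 0 ->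
  mean mu0 D u0 <= (x - a) / t.
Proof.
move=> t0 mD D0 Dab Dx.
rewrite (mean_le (adm_radon adm) _ (adm_integrable adm) mD Dab D0).
rewrite -(pmulr_rle0 _ t0) -RintegralZl//; last exact: locint_integrable (locint_sub _) mD Dab.
apply: le_trans Dx; apply: le_Rintegral => //.
- exact: locint_integrable (locintZ _ (locint_sub _)) mD Dab.
- exact: locint_integrable (locint_free_sub _ _) mD Dab.
- move=> c /Dab; rewrite /= in_itv /= => /andP[ac _].
  rewrite mulrBr mulrCA mulfV ?gt_eqF// mulr1; lra.
Qed.

Lemma mean_velocity_ge t a b x (D : set (measurableTypeR R)) : 0 < t -> measurable D ->
  (0 < mu0 D)%E -> D `<=` `[a, b] ->
  0 <= \int[mu0]_(c in D) (c + t * u0 c - x) ->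
  (x - b) / t <= mean mu0 D u0.
Proof.
move=> t0 mD D0 Dab Dx.
rewrite (mean_ge (adm_radon adm) _ (adm_integrable adm) mD Dab D0).
rewrite -(pmulr_rge0 _ t0) -RintegralZl//; last exact: locint_integrable (locint_sub _) mD Dab.
apply: (le_trans Dx); apply: le_Rintegral => //.
- exact: locint_integrable (locint_free_sub _ _) mD Dab.
- exact: locint_integrable (locintZ _ (locint_sub _)) mD Dab.
- move=> c /Dab; rewrite /= in_itv /= => /andP[_ cb].
  rewrite mulrBr mulrCA mulfV ?gt_eqF// mulr1; lra.
Qed.

Lemma velocity_left_end t a : 0 < t -> (pos t a - lft t a) / t = u0 (lft t a).
Proof.
move=> t0; rewrite (pos_freel fl _ (ltW t0)) addrAC subrr add0r mulrAC.
by rewrite mulfV ?gt_eqF// mul1r.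
Qed.

Lemma velocity_right_end t a : 0 < t -> (pos t a - rgt t a) / t = u0 (rgt t a).
Proof.
move=> t0; rewrite (pos_freer fl _ (ltW t0)) addrAC subrr add0r mulrAC.
by rewrite mulfV ?gt_eqF// mul1r.
Qed.

(** The bounds are the speeds [u0 (rgt t a)] and [u0 (lft t a)] of the two ends. Written with
    positions, they pass to limits, which [u0] itself would not. *)
Lemma cluster_velocity_bounds t a : 0 < t ->
  (pos t a - rgt t a) / t <= cluster_mean mu0 phi u0 t a <= (pos t a - lft t a) / t.
Proof.
move=> t0; have t0' := ltW t0; rewrite /cluster_mean; case: ifPn => [m|/(unmerged fl t0')[la ra]].
  have Dpos : (0 < mu0 `[lft t a, rgt t a]%classic)%E.
    by apply: (support_itv_gt0 (adm_support adm) m) => // x; exact: subset_itv_oo_cc.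
  have b0 := barycenter adm fl a t0'.
  rewrite (mean_velocity_ge (a := lft t a) t0)//= ?b0//.
  by apply: (mean_velocity_le (b := rgt t a) t0); rewrite ?b0.
by rewrite velocity_left_end// velocity_right_end// la ra lexx.
Qed.

(** A particle just to the left of [alpha phi x t] is strictly behind [x] at time [t]; for [y]
    between its position and [x], monotonicity confines [alpha phi y t]. *)
Lemma alpha_cvg_left t x : 0 <= t -> alpha phi y t @[y --> x^'-] --> alpha phi x t.
Proof.
move=> t0; apply/cvgrPdist_lt => e e0.
have zx : pos t (alpha phi x t - e) < x.
  rewrite -[X in _ < X](pos_alpha fl x t0) lt_neqAle (pos_le fl)// ?lerBlDr ?lerDl 1?ltW// andbT.
  apply/eqP => /(clusterP fl _ _ t0) /andP[+ _].
  by rewrite (left_end_alpha fl)// lerBrDl gerDr leNgt e0.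
near=> y; have yx : y < x by near: y; exact: nbhs_left_lt.
have zy : pos t (alpha phi x t - e) < y by near: y; exact: nbhs_left_gt.
have := alpha_homo fl t0 (ltW yx).
have : alpha phi x t - e < alpha phi y t by apply: (pos_lt fl t0); rewrite (pos_alpha fl).
by move=> ? ?; rewrite ger0_norm; lra.
Unshelve. all: by end_near.
Qed.

Lemma beta_cvg_right t x : 0 <= t -> beta phi y t @[y --> x^'+] --> beta phi x t.
Proof.
move=> t0; apply/cvgrPdist_lt => e e0.
have pb y : pos t (beta phi y t) = y.
  by rewrite -(right_end_alpha fl)// (pos_right_end fl)// (pos_alpha fl).
have zx : x < pos t (beta phi x t + e).
  rewrite -[X in X < _](pb x) lt_neqAle (pos_le fl)// ?lerDl 1?ltW// andbT.
  rewrite eq_sym; apply/eqP => /(clusterP fl _ _ t0) /andP[_].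
  by rewrite /right_end pb gerDl leNgt e0.
near=> y; have yx : x < y by near: y; exact: nbhs_right_gt.
have zy : y < pos t (beta phi x t + e) by near: y; exact: nbhs_right_lt.
have := beta_homo fl t0 (ltW yx).
have : beta phi y t < beta phi x t + e by apply: (pos_lt fl t0); rewrite pb.
by move=> ? ?; rewrite ler0_norm; lra.
Unshelve. all: by end_near.
Qed.

Lemma alpha_le_beta x t : 0 <= t -> alpha phi x t <= beta phi x t.
Proof. by move=> t0; have [] := flow_cluster fl x t0. Qed.

Lemma beta_lt_alpha t x y : 0 <= t -> x < y -> beta phi x t < alpha phi y t.
Proof.
move=> t0 xy; rewrite -(right_end_alpha fl)// -(left_end_alpha fl y)//.
by apply: (right_end_lt_left_end fl t0); rewrite !(pos_alpha fl).
Qed.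

Lemma velocity_bounds t x : 0 < t ->
  (x - beta phi x t) / t <= velocity mu0 u0 phi x t <= (x - alpha phi x t) / t.
Proof.
move=> t0; have := cluster_velocity_bounds (alpha phi x t) t0.
have t0' := ltW t0; rewrite -(velocity_pos fl _ t0').
by rewrite (left_end_alpha fl _ t0') (right_end_alpha fl _ t0') (pos_alpha fl _ t0').
Qed.

(** For [y < x] the cluster at [y] ends before the one at [x] begins, so both its ends are squeezed
    towards [alpha phi x t], and with them the two bounds on the velocity. *)
Lemma velocity_minusE t x : 0 < t ->
  velocity_minus mu0 u0 phi x t = ((x - alpha phi x t) / t)%:E.
Proof.
move=> t0; rewrite /velocity_minus gt_eqF//; congr EFin.
apply: cvg_lim => //; have t0' := ltW t0.
have yx : y @[y --> x^'-] --> x by apply: cvg_at_left_filter; exact: cvg_id.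
have ac := @alpha_cvg_left t x t0'.
apply: (@squeeze_cvgr _ _ _ _ (fun y => (y - beta phi y t) / t) (fun y => (y - alpha phi y t) / t)).
- by apply: nearW => y; exact: velocity_bounds.
- apply: cvgMl; apply: cvgB => //.
  apply: (@squeeze_cvgr _ _ _ _ (alpha phi ^~ t) (fun=> alpha phi x t)) => //; last exact: cvg_cst.
  near=> y; have yx' : y < x by near: y; exact: nbhs_left_lt.
  by rewrite alpha_le_beta//= ltW// beta_lt_alpha.
- by apply: cvgMl; exact: cvgB.
Unshelve. all: by end_near.
Qed.

Lemma velocity_plusE t x : 0 < t ->
  velocity_plus mu0 u0 phi x t = ((x - beta phi x t) / t)%:E.
Proof.
move=> t0; rewrite /velocity_plus gt_eqF//; congr EFin.
apply: cvg_lim => //; have t0' := ltW t0.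
have yx : y @[y --> x^'+] --> x by apply: cvg_at_right_filter; exact: cvg_id.
have ac := @beta_cvg_right t x t0'.
apply: (@squeeze_cvgr _ _ _ _ (fun y => (y - beta phi y t) / t) (fun y => (y - alpha phi y t) / t)).
- by apply: nearW => y; exact: velocity_bounds.
- by apply: cvgMl; exact: cvgB.
- apply: cvgMl; apply: cvgB => //.
  apply: (@squeeze_cvgr _ _ _ _ (fun=> beta phi x t) (beta phi ^~ t)) => //; last exact: cvg_cst.
  near=> y; have yx' : x < y by near: y; exact: nbhs_right_gt.
  by rewrite alpha_le_beta// andbT ltW// beta_lt_alpha.
Unshelve. all: by end_near.
Qed.

(** For positive [t] the two traces are [(x - alpha phi x t) / t] and [(x - beta phi x t) / t], so
    they differ exactly when the cluster is nontrivial; the converse direction follows. *)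
Lemma velocity_jump t a : 0 < t ->
  velocity_minus mu0 u0 phi (pos t a) t <> velocity_plus mu0 u0 phi (pos t a) t ->
  lft t a < rgt t a.
Proof.
move=> t0; rewrite velocity_minusE// velocity_plusE// -/(lft t a) -/(rgt t a).
apply: contra_notT => /(unmerged fl (ltW t0))[-> ->] //.
Qed.

Lemma velocity_nojump t a : 0 < t -> lft t a < rgt t a ->
  velocity_minus mu0 u0 phi (pos t a) t <> velocity_plus mu0 u0 phi (pos t a) t.
Proof.
move=> t0 m; rewrite velocity_minusE// velocity_plusE// -/(lft t a) -/(rgt t a).
by move=> [] /(mulIf (invr_neq0 (lt0r_neq0 t0))) /addrI /oppr_inj e; move: m; rewrite e ltxx.
Qed.

End shock_times.

(** * Jumps at time 0, and shock times in terms of clusters *)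

Section initial_jump.
Context {R : realType} {mu0 : {measure set (measurableTypeR R) -> \bar R}}
  {u0 : R -> R} {phi : R -> R -> R -> R}.
Hypothesis adm : admissible mu0 u0.
Hypothesis fl : sticky_flow mu0 u0 phi.
Local Notation lft := (left_end phi).
Local Notation rgt := (right_end phi).
Local Notation pos := (phi 0).
Implicit Types t s x y a b : R.

Lemma pos_gt_right_end t b c : 0 <= t -> rgt t b < c -> pos t b < pos t c.
Proof.
move=> t0 bc; have := pos_le fl t0 (ltW bc).
rewrite (pos_right_end fl)// le_eqVlt => /predU1P[e|//].
by have /(clusterP fl _ _ t0)/andP[_] := esym e; rewrite leNgt bc.
Qed.

Lemma pos_lt_left_end t b c : 0 <= t -> c < lft t b -> pos t c < pos t b.
Proof.
move=> t0 bc; have := pos_le fl t0 (ltW bc).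
rewrite (pos_left_end fl)// le_eqVlt => /predU1P[e|//].
by have /(clusterP fl _ _ t0)/andP[] := e; rewrite leNgt bc.
Qed.

Lemma saturated_itvoo t a b : 0 <= t -> saturated phi t `]rgt t a, lft t b[.
Proof.
move=> t0 c d; rewrite /= !in_itv /= => /andP[ac cb] e; apply/andP; split.
  rewrite ltNge; apply/negP => /(pos_le fl t0).
  by rewrite e (pos_right_end fl)// leNgt pos_gt_right_end.
rewrite ltNge; apply/negP => /(pos_le fl t0).
by rewrite e (pos_left_end fl)// leNgt pos_lt_left_end.
Qed.

(** On a union of clusters the free positions can be exchanged for the true ones, whose order is
    known. *)
Lemma Rintegral_free_saturated t a (D : set (measurableTypeR R)) p q : 0 <= t -> measurable D ->
  D `<=` `[p, q] -> saturated phi t D ->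
  \int[mu0]_(c in D) (c + t * u0 c - pos t a) =
  \int[mu0]_(c in D) (pos t c - pos t a) /\
  mu0.-integrable D (EFin \o (fun c => pos t c - pos t a)).
Proof.
move=> t0 mD Dpq sD; have lf := locint_free adm t.
have [] := integral_cluster_mean adm fl lf t0 mD sD (locint_integrable lf mD Dpq).
set g := cluster_mean _ _ _ _ => gi ge.
have gE : g = pos t by apply/funext => c; rewrite /g (cluster_mean_free fl).
rewrite {}gE in gi ge.
have ci : mu0.-integrable D (EFin \o fun=> pos t a).
  exact: locint_integrable (locint_cst (adm_radon adm) _) mD Dpq.
split; last exact: integrableB_EFin.
rewrite !RintegralB//; last exact: locint_integrable lf mD Dpq.
by congr (_ - _); rewrite /Rintegral ge.
Qed.

(** As [a] is still the left end of its cluster at [t], the free positions of [[a - e, a[] do not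
    exceed [pos t a] on average: on the part in the cluster of [a - e] by [hull_right], on the rest,
    which is saturated, by monotonicity of the flow. *)
Lemma mean_left_le t a e : 0 < t -> lft t a = a -> 0 < e ->
  mean mu0 `[a - e, a[ u0 <= u0 a + e / t.
Proof.
move=> t0 la e0; have t0' := ltW t0; set b := a - e.
have ba : b < a by rewrite /b gtrBl.
have mpos : (0 < mu0 `[b, a[%classic)%E.
  by apply: (support_itv_gt0 (adm_support adm) ba) => // x; exact: subset_itv_oo_co.
have sub : `[b, a[ `<=` `[b, a] by exact: subset_itv_co_cc.
have -> : u0 a + e / t = (pos t a - b) / t.
  by rewrite (pos_freel fl)// la /b; field; rewrite gt_eqF.
apply: (mean_velocity_le adm (b := a) t0) => //.
set r := rgt t b.
have ab : pos t b < pos t a by apply: pos_lt_left_end => //; rewrite la.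
have ra : r < a by rewrite -la; exact: (right_end_lt_left_end fl).
have br : b <= r by exact: (right_end_ge fl).
have DE : `[b, a[%classic = `[b, r] `|` `]r, a[ :> set R.
  by rewrite -itv_bndbnd_setU// ?bnd_simp// ltW.
have lf := locint_free_sub adm.
rewrite DE Rintegral_setU//; first last.
- by apply/disj_setPS => x [] /=; rewrite !in_itv /= => /andP[_ xr] /andP[]; rewrite ltNge xr.
- by rewrite -DE; apply: (locint_integrable (lf _ _)) sub.
have sub2 : `]r, a[ `<=` `[r, a] by exact: subset_itv_oo_cc.
rewrite -[leRHS]addr0; apply: lerD; last first.
  have sat : saturated phi t `]r, a[ by have := @saturated_itvoo t b a t0'; rewrite la.
  have [//|-> gi] := Rintegral_free_saturated a t0' _ sub2 sat.
  rewrite -oppr_ge0 -[X in 0 <= X]mulN1r -RintegralZl//.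
  apply: Rintegral_ge0 => c; rewrite /= in_itv /= => /andP[_ /ltW/(pos_le fl t0')].
  by rewrite mulN1r oppr_ge0 subr_le0.
apply: le_trans (hull_right adm fl (a := b) (b := b) t0' _); last exact: (cluster_self fl).
apply: le_Rintegral => //.
- exact: locint_integrable (lf _ _) _ (@subset_refl _ _).
- exact: locint_integrable (lf _ _) _ (@subset_refl _ _).
- by move=> c _; rewrite lerD2l lerN2 ltW.
Qed.

Lemma mean_right_ge t a e : 0 < t -> rgt t a = a -> 0 < e ->
  u0 a - e / t <= mean mu0 `]a, a + e] u0.
Proof.
move=> t0 ra e0; have t0' := ltW t0; set b := a + e.
have ba : a < b by rewrite /b ltrDl.
have mpos : (0 < mu0 `]a, b]%classic)%E.
  by apply: (support_itv_gt0 (adm_support adm) ba) => // x; exact: subset_itv_oo_oc.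
have sub : `]a, b] `<=` `[a, b] by exact: subset_itv_oc_cc.
have -> : u0 a - e / t = (pos t a - b) / t.
  by rewrite (pos_freer fl)// ra /b; field; rewrite gt_eqF.
apply: (mean_velocity_ge adm (a := a) t0) => //.
set r := lft t b.
have ab : pos t a < pos t b by apply: pos_gt_right_end => //; rewrite ra.
have ar : a < r by rewrite -ra; exact: (right_end_lt_left_end fl).
have rb : r <= b by exact: (left_end_le fl).
have DE : `]a, b]%classic = `]a, r[ `|` `[r, b] :> set R.
  by rewrite -itv_bndbnd_setU// ?bnd_simp// ltW.
have lf := locint_free_sub adm.
rewrite DE Rintegral_setU//; first last.
- by apply/disj_setPS => x [] /=; rewrite !in_itv /= => /andP[_ xr] /andP[]; rewrite leNgt xr.
- by rewrite -DE; apply: (locint_integrable (lf _ _)) sub.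
have sub2 : `]a, r[ `<=` `[a, r] by exact: subset_itv_oo_cc.
rewrite -[leLHS]addr0; apply: lerD.
  have sat : saturated phi t `]a, r[ by have := @saturated_itvoo t a b t0'; rewrite ra.
  have [//|-> gi] := Rintegral_free_saturated a t0' _ sub2 sat.
  apply: Rintegral_ge0 => c; rewrite /= in_itv /= => /andP[/ltW/(pos_le fl t0') + _].
  by rewrite subr_ge0.
apply: le_trans (hull_left adm fl (a := b) (b := b) t0' _) _; first exact: (cluster_self fl).
apply: le_Rintegral => //.
- exact: locint_integrable (lf _ _) _ (@subset_refl _ _).
- exact: locint_integrable (lf _ _) _ (@subset_refl _ _).
- by move=> c _; rewrite lerD2l lerN2 ltW.
Qed.

(** A particle alone at time [t] has one-sided means over a window [e] that overshoot [u0 a] on the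
    left, or undershoot it on the right, by at most [e / t]. Hence [u0_minus <= u0 <= u0_plus] at
    [a], and the Negative Jump Condition is the reverse chain. *)
Lemma initial_nojump t a : 0 < t -> ~~ (lft t a < rgt t a) ->
  u0_minus mu0 u0 a = u0_plus mu0 u0 a.
Proof.
move=> t0 /(unmerged fl (ltW t0))[la ra]; have [pu um] := adm_negative_jump adm a.
(* A window shorter than [e * t] makes the error of the mean at most [e]. *)
have bnd (e : R) : 0 < e -> 0^'+ `]0, e * t[%classic.
  move=> e0; near=> x; rewrite /= in_itv /=; apply/andP; split.
    by near: x; exact: nbhs_right_gt.
  by near: x; apply: nbhs_right_lt; exact: mulr_gt0.
have mu : (u0_minus mu0 u0 a <= (u0 a)%:E)%E.
  apply/lee_addgt0Pr => e e0; apply: ge_ereal_inf.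
  exists (ereal_sup [set (mean mu0 `[a - x, a[ u0)%:E | x in `]0%R, e * t[%classic]).
    by exists (`]0, e * t[%classic) => //; exact: bnd.
  apply: ge_ereal_sup => _ [x + <-]; rewrite /= in_itv /= => /andP[x0 xe].
  rewrite -EFinD lee_fin (le_trans (mean_left_le t0 la x0))// lerD2l.
  by rewrite ler_pdivrMr// ltW.
have up : ((u0 a)%:E <= u0_plus mu0 u0 a)%E.
  rewrite /u0_plus limf_einfE; apply/lee_subgt0Pr => e e0; apply: le_ereal_sup_tmp.
  exists (ereal_inf [set (mean mu0 `]a, a + x] u0)%:E | x in `]0%R, e * t[%classic]).
    by exists (`]0, e * t[%classic) => //; exact: bnd.
  apply: le_ereal_inf_tmp => _ [x + <-]; rewrite /= in_itv /= => /andP[x0 xe].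
  rewrite -EFinB lee_fin; apply: le_trans (mean_right_ge t0 ra x0).
  by rewrite lerD2l lerN2 ler_pdivrMr// ltW.
by apply/le_anti; rewrite (le_trans mu up) (le_trans pu um).
Unshelve. all: by end_near.
Qed.

Lemma shock_time_ge0 a : (0 <= shock_time mu0 u0 phi a)%E.
Proof. by apply: le_ereal_inf_tmp => _ [t [t0 _] <-]; rewrite lee_fin. Qed.

Lemma shock_time_le t a : 0 < t -> lft t a < rgt t a ->
  (shock_time mu0 u0 phi a <= t%:E)%E.
Proof.
move=> t0 m; apply: ereal_inf_lbound; exists t => //; split; first exact: ltW.
exact: (velocity_nojump adm fl).
Qed.

(** The infimum may come from a jump at time 0, where no cluster is nontrivial; [initial_nojump]
    then gives a nontrivial cluster at every positive time. From a later jump, merging simply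
    persists. *)
Lemma shock_time_lt t a : (shock_time mu0 u0 phi a < t%:E)%E -> 0 < t /\ lft t a < rgt t a.
Proof.
move=> tau_t; have t0 : 0 < t by rewrite -lte_fin (le_lt_trans (shock_time_ge0 a)).
split => //; have [_ [s [s0 js] <-]] := ereal_inf_lt tau_t.
rewrite lte_fin => st; move: s0; rewrite le_eqVlt => /predU1P[s0|s0].
  move: js; rewrite -s0 (flow0 fl)// /velocity_minus /velocity_plus eqxx.
  by apply: contra_notT; exact: initial_nojump.
apply: (merged_time fl (ltW s0) (ltW st)).
exact: (velocity_jump adm fl).
Qed.

Lemma shock_time_ltP t a : (shock_time mu0 u0 phi a < t%:E)%E <->
  exists s, 0 < s < t /\ lft s a < rgt s a.
Proof.
split=> [h|[s [/andP[s0 st] m]]]; last first.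
  by apply: (le_lt_trans (shock_time_le s0 m)); rewrite lte_fin.
(* The midpoint leaves room on both sides: at [tau a] itself the cluster may still be trivial, and
   the witness must precede [t]. *)
have [r [hr rt]] : exists r, (shock_time mu0 u0 phi a < r%:E)%E /\ r < t.
  have tfin : shock_time mu0 u0 phi a \is a fin_num.
    by rewrite ge0_fin_numE ?shock_time_ge0// (lt_trans h)// ltry.
  move: h; rewrite -(fineK tfin) lte_fin => h.
  by exists ((fine (shock_time mu0 u0 phi a) + t) / 2); rewrite lte_fin; split; lra.
by have [r0 m] := shock_time_lt hr; exists r; rewrite r0.
Qed.

End initial_jump.

(** * Regularity in time *)

Section time_regularity.
Context {R : realType} {mu0 : {measure set (measurableTypeR R) -> \bar R}}
  {u0 : R -> R} {phi : R -> R -> R -> R}.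
Hypothesis adm : admissible mu0 u0.
Hypothesis fl : sticky_flow mu0 u0 phi.
Local Notation lft := (left_end phi).
Local Notation rgt := (right_end phi).
Local Notation pos := (phi 0).
Implicit Types t s x y a b : R.

(** Up to time [t] the particle stays between the free paths of the two ends of its cluster of time
    [t], and these paths meet at [pos t a]. *)
Lemma pos_cvg_left t a : 0 < t -> pos s a @[s --> t^'-] --> pos t a.
Proof.
move=> t0; have t0' := ltW t0.
have st : s @[s --> t^'-] --> t by apply: cvg_at_left_filter; exact: cvg_id.
apply: (@squeeze_cvgr _ _ _ _ (fun s => lft t a + s * u0 (lft t a))
  (fun s => rgt t a + s * u0 (rgt t a))).
- near=> s; have s0 : 0 <= s by apply: ltW; near: s; exact: nbhs_left_gt.
  have st' : s <= t by apply: ltW; near: s; exact: nbhs_left_lt.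
  rewrite -(left_end_free fl)// -(right_end_free fl)//.
  by rewrite !(pos_le fl)//; [exact: (right_end_ge fl)|exact: (left_end_le fl)].
- by rewrite (pos_freel fl)//; apply: cvgD; [exact: cvg_cst|exact: cvgMl].
- by rewrite (pos_freer fl)//; apply: cvgD; [exact: cvg_cst|exact: cvgMl].
Unshelve. all: by end_near.
Qed.

(** For [s > t] the right end of the cluster of time [s] was free, and not behind [a], at time [t];
    its straight path therefore bounds [pos s a] from below by a line through [pos t a]. The left
    end bounds it from above in the same way. *)
Lemma pos_cvg_right t a : 0 < t -> pos s a @[s --> t^'+] --> pos t a.
Proof.
move=> t0; have t0' := ltW t0.
have st : s @[s --> t^'+] --> t by apply: cvg_at_right_filter; exact: cvg_id.
pose T := t + 1.
(* The point at time [s] of the straight line that leaves [c] at time 0 and passes through [pos t a]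
   at time [t]. It decreases in [c] for [s > t], so the ends of the later cluster of time [T] give
   bounds independent of the cluster of time [s]. *)
pose bound c s := s / t * pos t a - c * (s / t - 1).
have bcvg c : bound c s @[s --> t^'+] --> pos t a.
  rewrite -[X in _ --> X](_ : t / t * pos t a - c * (t / t - 1) = _); last first.
    by rewrite mulfV ?gt_eqF// subrr mul1r mulr0 subr0.
  have st1 : s / t @[s --> t^'+] --> t / t by exact: cvgMl.
  apply: cvgB; first exact: cvgMl.
  by apply: cvgMr; apply: cvgB => //; exact: cvg_cst.
apply: (@squeeze_cvgr _ _ _ _ (bound (rgt T a)) (bound (lft T a))) => //.
near=> s; have ts : t < s by near: s; exact: nbhs_right_gt.
have s0 : 0 < s by exact: lt_trans ts.
have sT : s <= T by apply: ltW; near: s; apply: nbhs_right_lt; rewrite /T ltrDl.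
have ts1 : 0 <= s / t - 1 by rewrite subr_ge0 ler_pdivlMr// mul1r ltW.
have st0 : 0 <= s / t by rewrite divr_ge0// ltW.
apply/andP; split.
  apply: (@le_trans _ _ (bound (rgt s a) s)).
    by rewrite lerD2l lerN2 ler_wpM2r// (right_end_time fl)// ltW.
  have : pos t a <= rgt s a + t * u0 (rgt s a).
    rewrite -(right_end_free fl)// ?(ltW ts)//.
    by apply: (pos_le fl t0'); apply: (right_end_ge fl); exact: ltW.
  move=> /(ler_wpM2l st0); rewrite /bound (pos_freer fl a (ltW s0)) => h.
  rewrite lerBlDr; apply: (le_trans h); rewrite le_eqVlt; apply/predU1P; left.
  by field; rewrite gt_eqF.
apply: (@le_trans _ _ (bound (lft s a) s)); last first.
  by rewrite lerD2l lerN2 ler_wpM2r// (left_end_time fl)// ltW.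
have : lft s a + t * u0 (lft s a) <= pos t a.
  rewrite -(left_end_free fl)// ?(ltW ts)//.
  by apply: (pos_le fl t0'); apply: (left_end_le fl); exact: ltW.
move=> /(ler_wpM2l st0); rewrite /bound (pos_freel fl a (ltW s0)) => h.
rewrite lerBrDr; apply: le_trans h; rewrite le_eqVlt; apply/predU1P; left.
by field; rewrite gt_eqF.
Unshelve. all: by end_near.
Qed.

Lemma pos_eq_right t a b : 0 < t -> (forall s, t < s -> pos s b = pos s a) ->
  pos t b = pos t a.
Proof.
move=> t0 h; have t0' := ltW t0.
rewrite -(cvg_lim (@norm_hausdorff _ _) (@pos_cvg_right t b t0)).
apply: cvg_lim => //.
apply: cvg_trans (@pos_cvg_right t a t0); apply: near_eq_cvg; near=> s.
by rewrite h.
Unshelve. all: by end_near.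
Qed.

(** Two particles together at all times after [t] are together at [t] by right continuity; and a
    pair apart at [s] was apart at all earlier times. *)
Lemma separated_later t a b : 0 < t -> pos t b != pos t a ->
  exists2 s, t < s & forall r, t <= r -> r <= s -> pos r b != pos r a.
Proof.
move=> t0 /eqP ba; apply: contrapT => h; apply/ba/pos_eq_right => // s ts.
apply: contrapT => /eqP sba; apply: h; exists s => // r tr rs.
apply: contra_neq sba; apply: (pos_eq_le fl _ rs).
by apply: le_trans tr; exact: ltW.
Qed.

Lemma cvg_mean (f : R -> R) p q (A : set (measurableTypeR R))
    (F : (set (measurableTypeR R))^nat) :
  locally_mu_integrable mu0 f -> measurable A -> (forall n, measurable (F n)) ->
  A `<=` `[p, q] -> (0 < mu0 A)%E -> (\forall n \near \oo, F n `<=` `[p, q]) ->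
  (forall x, `[p, q]%classic x -> \forall n \near \oo, F n x <-> A x) ->
  mean mu0 (F n) f @[n --> \oo] --> mean mu0 A f.
Proof.
move=> lf mA mF Apq A0 Fpq FA.
have cvgint g : locally_mu_integrable mu0 g ->
    \int[mu0]_(x in F n) g x @[n --> \oo] --> \int[mu0]_(x in A) g x.
  move=> lg; apply: (@cvg_Rintegral_near_set _ _ _ mu0 g `[p, q]%classic A F) => //.
  exact: (locint_integrable lg _ (@subset_refl _ _)).
have rad := adm_radon adm.
apply: cvgM; last exact: cvgint.
apply: cvgV; first by rewrite gt_eqF// fine_gt0// A0 (radon_finite rad mA Apq).
have fineE B : measurable B -> fine (mu0 B) = \int[mu0]_(x in B) (1 : R).
  by move=> mB; rewrite Rintegral_cst// mul1r.
rewrite fineE//; under eq_cvg do rewrite fineE//.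
exact: cvgint (locint_cst rad 1).
Qed.

(** A nontrivial cluster is the decreasing limit of the later ones, and its positive mass lets the
    quotient of integrals converge. For a trivial cluster the masses may tend to zero; there the
    mean is squeezed between the speeds of the ends, which converge because the later clusters
    shrink to [a]. *)
Lemma cluster_mean_cvg_right t a : 0 < t ->
  cluster_mean mu0 phi u0 s a @[s --> t^'+] --> cluster_mean mu0 phi u0 t a.
Proof.
move=> t0; have t0' := ltW t0; have [m|m] := boolP (lft t a < rgt t a).
  apply/cvg_at_rightP => u [tu ucvg].
  have [M [_ uM]] := cvg_seq_bounded (cvgP _ ucvg).
  (* A single time after all the [u n]: its cluster contains theirs and is the domain of the
     dominated convergence. *)
  pose T := M + 1.
  have uT n : u n <= T.
    by apply: (le_trans (ler_norm _)); apply: (uM T) => //; rewrite /T ltrDl.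
  have mn n : lft (u n) a < rgt (u n) a by exact: (merged_time fl t0' (ltW (tu n))).
  rewrite /cluster_mean m; under eq_cvg do rewrite mn.
  have sub s : 0 <= s -> s <= T -> `[lft s a, rgt s a] `<=` `[lft T a, rgt T a].
    move=> s0 sT x; rewrite /= !in_itv /= => /andP[lx xr].
    by rewrite (le_trans (left_end_time fl a s0 sT))// (le_trans xr)// (right_end_time fl).
  apply: (cvg_mean (p := lft T a) (q := rgt T a)) => //.
  - exact: adm_integrable adm.
  - by apply: sub => //; exact: le_trans (ltW (tu 0%N)) (uT 0%N).
  - by apply: (support_itv_gt0 (adm_support adm) m) => // x; exact: subset_itv_oo_cc.
  - by apply: nearW => n; apply: sub => //; exact: le_trans t0' (ltW (tu n)).
  move=> x _; have [xa|/(separated_later t0)[s ts sep]] := eqVneq (pos t x) (pos t a).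
    apply: nearW => n; rewrite /= !in_itv /=.
    split=> _; apply/(clusterP fl) => //; first exact: le_trans (ltW (tu n)).
    exact: (pos_eq_le fl t0' (ltW (tu n))).
  have : \forall n \near \oo, u n < s by exact: (cvgr_lt t ucvg).
  apply: filterS => n us; rewrite /= !in_itv /=.
  split=> /(clusterP fl) => [/(_ (le_trans t0' (ltW (tu n))))|/(_ t0')] e.
    by have := sep _ (ltW (tu n)) (ltW us); rewrite e eqxx.
  by have := sep _ (lexx t) (ltW ts); rewrite e eqxx.
have [la ra] := unmerged fl t0' m.
have near_end b : b != a -> \forall s \near t^'+, pos s b != pos s a.
  move=> ba; have : pos t b != pos t a.
    apply: contra_neq ba => /(clusterP fl _ _ t0'); rewrite la ra => ab.
    exact/esym/le_anti.
  move=> /(separated_later t0)[s ts sep]; near=> r; apply: sep.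
    by apply: ltW; near: r; exact: nbhs_right_gt.
  by apply: ltW; near: r; exact: nbhs_right_lt.
have st : s @[s --> t^'+] --> t by apply: cvg_at_right_filter; exact: cvg_id.
have cu : cluster_mean mu0 phi u0 t a = (pos t a - a) / t.
  by have := velocity_left_end fl a t0; rewrite la => ->; rewrite /cluster_mean ifN.
have vt : t^-1 \in GRing.unit by rewrite unitfE invr_neq0// gt_eqF.
have stV : s^-1 @[s --> t^'+] --> t^-1 by apply: cvgV => //; rewrite gt_eqF.
have pt := @pos_cvg_right t a t0.
rewrite cu; apply: (@squeeze_cvgr _ _ _ _
  (fun s => (pos s a - rgt s a) / s) (fun s => (pos s a - lft s a) / s)).
- near=> s; apply: (cluster_velocity_bounds adm fl).
  by apply: (lt_trans t0); near: s; exact: nbhs_right_gt.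
- apply: cvgM => //; apply: cvgB => //.
  apply/cvgrPdist_lt => e e0; near=> s.
  have ts : t <= s by apply: ltW; near: s; exact: nbhs_right_gt.
  have s0 : 0 <= s by exact: le_trans ts.
  have ar := right_end_ge fl a s0.
  rewrite ler0_norm ?subr_le0// opprB ltrBlDl ltNge; apply/negP => h.
  have : pos s (a + e) != pos s a.
    by near: s; apply: near_end; rewrite gt_eqF// ltrDl.
  apply/negP; rewrite negbK; apply/eqP/(clusterP fl) => //; rewrite h andbT.
  by rewrite (le_trans (left_end_le fl a s0))// lerDl ltW.
- apply: cvgM => //; apply: cvgB => //.
  apply/cvgrPdist_lt => e e0; near=> s.
  have ts : t <= s by apply: ltW; near: s; exact: nbhs_right_gt.
  have s0 : 0 <= s by exact: le_trans ts.
  have ar := left_end_le fl a s0.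
  rewrite ger0_norm ?subr_ge0// ltrBlDr -ltrBlDl ltNge; apply/negP => h.
  have : pos s (a - e) != pos s a.
    by near: s; apply: near_end; rewrite lt_eqF// gtrBl.
  apply/negP; rewrite negbK; apply/eqP/(clusterP fl) => //; rewrite h/=.
  by rewrite (le_trans _ (right_end_ge fl a s0))// gerBl ltW.
Unshelve. all: by end_near.
Qed.

(** Earlier clusters increase to their union [U], and the limit is the mean over [U]. A collision at
    [t] may make the cluster of [t] larger than [U], so only existence of the limit is claimed. If
    nothing merges before [t], the velocity is constantly [u0 a]. *)
Lemma cluster_mean_cvg_left t a : 0 < t ->
  cvg (cluster_mean mu0 phi u0 s a @[s --> t^'-]).
Proof.
move=> t0; have t0' := ltW t0.
have [[s0 /andP[s00 s0t] m]|none] :=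
    pselect (exists2 s, 0 < s < t & lft s a < rgt s a); last first.
  apply: (cvgP (u0 a)); apply: cvg_near_cst; near=> s.
  rewrite /cluster_mean ifN//; apply/negP => m; apply: none; exists s => //.
  by apply/andP; split; near: s; [exact: nbhs_left_gt|exact: nbhs_left_lt].
pose U : set (measurableTypeR R) := [set x | exists2 s, 0 < s < t & pos s x = pos s a].
have UD : U `<=` `[lft t a, rgt t a].
  move=> x [s /andP[/ltW s0' /ltW st] e]; rewrite /= in_itv /=.
  by apply/(clusterP fl) => //; exact: (pos_eq_le fl s0' st).
have sU s : 0 < s < t -> `[lft s a, rgt s a] `<=` U.
  move=> /andP[s1 st] x; rewrite /= in_itv /= => /(clusterP fl _ _ (ltW s1)) e.
  by exists s => //; rewrite s1.
have mU : measurable U.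
  have -> : U = \bigcup_(n in [set n | 0 < (rational_nth n : R) < t])
      `[lft (rational_nth n) a, rgt (rational_nth n) a]%classic.
    apply/seteqP; split => [x [s /andP[s1 st] e]|x [q /= q0 xq]].
      have [q /andP[sq qt]] := rational_nth_dense st.
      exists q; first by rewrite /= (lt_trans s1).
      rewrite /= in_itv /=; apply/(clusterP fl); first by rewrite ltW// (lt_trans s1).
      exact: (pos_eq_le fl (ltW s1) (ltW sq)).
    exact: sU q0 _ xq.
  by apply: bigcup_measurable => q _.
apply: (cvgP (mean mu0 U u0)); apply/cvg_at_leftP => u [ut ucvg].
have u_gt s : s < t -> \forall n \near \oo, s < u n by exact: (cvgr_gt t ucvg).
have : mean mu0 `[lft (u n) a, rgt (u n) a] u0 @[n --> \oo] --> mean mu0 U u0.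
  apply: (cvg_mean (p := lft t a) (q := rgt t a)) => //.
  - exact: adm_integrable adm.
  - apply: (support_itv_gt0 (adm_support adm) m) => // x xs.
    by apply: (sU s0); [rewrite s00|exact: subset_itv_oo_cc].
  - apply: filterS (u_gt 0 t0) => n un0; apply: subset_trans UD.
    by apply: sU; rewrite un0 ut.
  - move=> x _; have [[s /andP[s1 st] e]|nU] := pselect (U x).
      apply: filterS (u_gt s st) => n sun; split => [_|_]; first by exists s; rewrite ?s1.
      rewrite /= in_itv /=; apply/(clusterP fl); first exact: le_trans (ltW s1) (ltW sun).
      exact: (pos_eq_le fl (ltW s1) (ltW sun)).
    apply: filterS (u_gt 0 t0) => n un0; split => [xu|//].
    by apply: (sU (u n)) xu; rewrite un0 ut.
apply: cvg_trans; apply: near_eq_cvg.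
apply: filterS (u_gt s0 s0t) => n sun.
by rewrite /cluster_mean (merged_time fl (ltW s00) (ltW sun) m).
Unshelve. all: by end_near.
Qed.

End time_regularity.

(** * Turbulent intervals *)

Section turbulent_intervals.
Context {R : realType} {mu0 : {measure set (measurableTypeR R) -> \bar R}}
  {u0 : R -> R} {phi : R -> R -> R -> R}.
Hypothesis adm : admissible mu0 u0.
Hypothesis fl : sticky_flow mu0 u0 phi.
Local Notation lft := (left_end phi).
Local Notation rgt := (right_end phi).
Local Notation pos := (phi 0).
Local Notation tau := (shock_time mu0 u0 phi).
Local Notation turb := (turbulent mu0 u0 phi).
Implicit Types t s x y a b c : R.

Lemma shock_time_fine a : tau a <> +oo%E ->
  exists2 t, 0 <= t & tau a = t%:E.
Proof.
move=> ta; exists (fine (tau a)).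
  by apply: fine_ge0; exact: shock_time_ge0.
by rewrite fineK// ge0_fin_numE ?shock_time_ge0// ltey; exact/eqP.
Qed.

Lemma unshocked t a : 0 <= t -> (t%:E < tau a)%E -> lft t a = a /\ rgt t a = a.
Proof.
move=> t0 h; apply: (unmerged fl t0); apply/negP => m.
move: t0; rewrite le_eqVlt => /predU1P[t0|t0].
  by move: m; rewrite -t0 (left_end0 fl) (right_end0 fl) ltxx.
by have := shock_time_le adm fl t0 m; rewrite leNgt h.
Qed.

(** At its shock time [a] may lie strictly inside a cluster, where [flow_ends] says nothing about
    it; the formula is the left limit of its free motion. *)
Lemma pos_shock_time t a : tau a = t%:E -> pos t a = a + t * u0 a.
Proof.
move=> e; have : 0 <= t by rewrite -lee_fin -e shock_time_ge0.
rewrite le_eqVlt => /predU1P[<-|t0]; first by rewrite mul0r addr0 (flow0 fl).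
rewrite -(cvg_lim (@norm_hausdorff _ _) (pos_cvg_left fl (a := a) t0)).
apply: cvg_lim => //.
have : a + s * u0 a @[s --> t^'-] --> a + t * u0 a.
  apply: cvgD; first exact: cvg_cst.
  by apply: cvgMl; apply: cvg_at_left_filter; exact: cvg_id.
apply: cvg_trans; apply: near_eq_cvg; near=> s.
have s0 : 0 <= s by apply: ltW; near: s; exact: nbhs_left_gt.
have st : (s%:E < tau a)%E by rewrite e lte_fin; near: s; exact: nbhs_left_lt.
by rewrite (pos_freel fl)//; have [-> _] := unshocked s0 st.
Unshelve. all: by end_near.
Qed.

(** The least interval containing both points, in whichever order they come: members of a turbulent
    interval lie on either side of [a]. *)
Definition between a b c := (a <= c <= b) || (b <= c <= a).

Lemma betweenl a b : between a b a.
Proof. by rewrite /between !lexx andbT andTb; exact: le_total. Qed.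

Lemma betweenr a b : between a b b.
Proof. by rewrite /between !lexx andbT andTb; exact: le_total. Qed.

Lemma turbulentP t a b : tau a = t%:E -> turb a b <->
  (forall c, between a b c -> tau c = t%:E /\ pos t c = pos t a).
Proof.
move=> e; rewrite /turbulent e/=; split=> [[I [itvI Ia h] Ib] c abc|h].
  apply: h.
  by move: abc => /orP[] /itvI; exact.
exists (between a b); last exact: betweenr.
split=> [||c /h//]; last exact: betweenl.
by rewrite /between => x y /orP[] /andP[h1 h2] /orP[] /andP[h3 h4] z /andP[h5 h6];
  apply/orP; have [?|?] := leP a b; [left|right|left|right|left|right|left|right]; lra.
Qed.

Lemma turbulent_oo a : tau a = +oo%E -> turb a = [set a].
Proof. by move=> e; rewrite /turbulent e eqxx. Qed.

Lemma turbulent_self a : turb a a.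
Proof.
have [/turbulent_oo ->//|/shock_time_fine[t _ e]] := pselect (tau a = +oo%E).
by apply/(turbulentP _ e) => c /orP[]/andP[h1 h2];
  rewrite (_ : c = a)//; apply/le_anti; rewrite h1 h2.
Qed.

Lemma turbulent_cluster t a b : tau a = t%:E -> turb a b ->
  lft t a <= b <= rgt t a.
Proof.
move=> e /(turbulentP _ e)/(_ b) h; apply/(clusterP fl).
  by rewrite -lee_fin -e shock_time_ge0.
by apply: (h _).2; exact: betweenr.
Qed.

Lemma turbulent_interval a b c : turb a b -> between a b c -> turb a c.
Proof.
have [/turbulent_oo ->/= ->|/shock_time_fine[t _ e]] := pselect (tau a = +oo%E).
  by rewrite /between => /orP[]/andP[h1 h2]; apply/le_anti; rewrite h1 h2.
move=> /(turbulentP _ e) h abc; apply/(turbulentP _ e) => d acd; apply: h.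
by move: abc acd; rewrite /between => /orP[]/andP[h1 h2]/orP[]/andP[h3 h4]; apply/orP;
  first [by left; lra | by right; lra].
Qed.

Lemma turbulent_has_inf a : has_inf (turb a).
Proof.
split; first by exists a; exact: turbulent_self.
have [/turbulent_oo ->|/shock_time_fine[t _ e]] := pselect (tau a = +oo%E).
  by exists a => b /= ->.
by exists (lft t a) => b /(turbulent_cluster e)/andP[].
Qed.

Lemma turbulent_has_sup a : has_sup (turb a).
Proof.
split; first by exists a; exact: turbulent_self.
have [/turbulent_oo ->|/shock_time_fine[t _ e]] := pselect (tau a = +oo%E).
  by exists a => b /= ->.
by exists (rgt t a) => b /(turbulent_cluster e)/andP[].
Qed.

Lemma turb_left_le a : turb_left mu0 u0 phi a <= a.
Proof. by apply: ge_inf; [case: (turbulent_has_inf a)|exact: turbulent_self]. Qed.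

Lemma turb_right_ge a : a <= turb_right mu0 u0 phi a.
Proof. by apply: ub_le_sup; [case: (turbulent_has_sup a)|exact: turbulent_self]. Qed.

Lemma turb_left_lt a b : turb_left mu0 u0 phi a < b -> b <= a -> turb a b.
Proof.
move=> Ab ba; have e0 : 0 < b - turb_left mu0 u0 phi a by rewrite subr_gt0.
have [c tc cb] := inf_adherent e0 (turbulent_has_inf a).
apply: (turbulent_interval tc); rewrite /between; apply/orP; right.
by rewrite ba andbT ltW// (lt_le_trans cb)// /turb_left addrC subrK.
Qed.

Lemma turb_right_gt a b : b < turb_right mu0 u0 phi a -> a <= b -> turb a b.
Proof.
move=> bA ab; have e0 : 0 < turb_right mu0 u0 phi a - b by rewrite subr_gt0.
have [c tc cb] := sup_adherent e0 (turbulent_has_sup a).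
apply: (turbulent_interval tc); rewrite /between; apply/orP; left.
by rewrite ab ltW// (le_lt_trans _ cb)// /turb_right opprB addrCA subrr addr0.
Qed.

(** The left end [A] could only shock earlier by merging on its left or its right. A neighbour on
    the right is in the turbulent interval and unshocked before [t], so [A] remains the right end of
    its clusters; by [right_end_fresh] such a right end has met nobody on its left either. *)
Lemma turb_left_shock t a : tau a = t%:E ->
  tau (turb_left mu0 u0 phi a) = t%:E /\ pos t (turb_left mu0 u0 phi a) = pos t a.
Proof.
move=> e; set A := turb_left mu0 u0 phi a.
have : A <= a := turb_left_le a.
rewrite le_eqVlt => /predU1P[->//|Aa].
have t0 : 0 <= t by rewrite -lee_fin -e shock_time_ge0.
have pA : pos t A = pos t a.
  apply/(clusterP fl _ _ t0); rewrite (le_trans (ltW Aa) (right_end_ge fl _ t0)) andbT.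
  by apply: lb_le_inf => [|b /(turbulent_cluster e)/andP[]//]; exact: (turbulent_has_inf a).1.
split; last exact: pA.
have ra : a <= rgt t A by rewrite /right_end pA; exact: (right_end_ge fl).
have mA : lft t A < rgt t A.
  by apply: le_lt_trans (lt_le_trans Aa ra); exact: (left_end_le fl).
have tgt0 : 0 < t.
  rewrite lt_neqAle t0 andbT; apply/eqP => t00; move: mA.
  by rewrite -t00 (left_end0 fl) (right_end0 fl) ltxx.
apply/le_anti; rewrite (shock_time_le adm fl)//= leNgt; apply/negP.
have rgtA s : 0 < s < t -> rgt s A = A.
  move=> /andP[s0 st]; apply/le_anti; rewrite (right_end_ge fl _ (ltW s0)) andbT.
  rewrite leNgt; apply/negP => h.
  (* A point strictly to the right of [A], both in the turbulent interval and in the cluster of [A]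
     at time [s]: its shock time would be at most [s]. *)
  pose c := Num.min a (rgt s A).
  have Ac : A < c by rewrite lt_min Aa h.
  have ca : c <= a by rewrite ge_min lexx.
  have /(turbulentP _ e) /(_ c) [|+ _] := turb_left_lt Ac ca.
    by rewrite /between lexx ca orbT.
  have cA : pos s c = pos s A.
    apply/(clusterP fl) => //; first exact: ltW.
    rewrite (le_trans (left_end_le fl _ (ltW s0)) (ltW Ac))/=.
    by rewrite ge_min lexx orbT.
  move=> ec; have : (tau c <= s%:E)%E.
    apply: (shock_time_le adm fl) => //; rewrite /left_end /right_end cA.
    exact: le_lt_trans (left_end_le fl _ (ltW s0)) h.
  by rewrite ec lee_fin leNgt st.
move=> /(shock_time_ltP adm fl)[s [/andP[s0 st]]].
(* [right_end_fresh] asks that [A] still be a right end at some time later than [s], here one before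
   [t]. *)
have s't : 0 < (s + t) / 2 < t by apply/andP; split; lra.
rewrite (rgtA s) ?s0// (right_end_fresh adm fl (ltW s0) _ (rgtA _ s't)) ?ltxx//; lra.
Qed.

Lemma turb_right_shock t a : tau a = t%:E ->
  tau (turb_right mu0 u0 phi a) = t%:E /\ pos t (turb_right mu0 u0 phi a) = pos t a.
Proof.
move=> e; set A := turb_right mu0 u0 phi a.
have : a <= A := turb_right_ge a.
rewrite le_eqVlt => /predU1P[<-//|Aa].
have t0 : 0 <= t by rewrite -lee_fin -e shock_time_ge0.
have pA : pos t A = pos t a.
  apply/(clusterP fl _ _ t0); rewrite (le_trans (left_end_le fl _ t0) (ltW Aa)) /=.
  by apply: ge_sup => [|b /(turbulent_cluster e)/andP[]//]; exact: (turbulent_has_sup a).1.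
split; last exact: pA.
have ra : lft t A <= a by rewrite /left_end pA; exact: (left_end_le fl).
have mA : lft t A < rgt t A.
  by apply: lt_le_trans (le_lt_trans ra Aa) _; exact: (right_end_ge fl).
have tgt0 : 0 < t.
  rewrite lt_neqAle t0 andbT; apply/eqP => t00; move: mA.
  by rewrite -t00 (left_end0 fl) (right_end0 fl) ltxx.
apply/le_anti; rewrite (shock_time_le adm fl)//= leNgt; apply/negP.
have lftA s : 0 < s < t -> lft s A = A.
  move=> /andP[s0 st]; apply/le_anti; rewrite (left_end_le fl _ (ltW s0)) /=.
  rewrite leNgt; apply/negP => h.
  pose c := Num.max a (lft s A).
  have Ac : c < A by rewrite gt_max Aa h.
  have ca : a <= c by rewrite le_max lexx.
  have /(turbulentP _ e) /(_ c) [|+ _] := turb_right_gt Ac ca.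
    by rewrite /between lexx ca.
  have cA : pos s c = pos s A.
    apply/(clusterP fl) => //; first exact: ltW.
    rewrite (le_trans (ltW Ac) (right_end_ge fl _ (ltW s0))) andbT.
    by rewrite le_max lexx orbT.
  move=> ec; have : (tau c <= s%:E)%E.
    apply: (shock_time_le adm fl) => //; rewrite /left_end /right_end cA.
    exact: lt_le_trans h (right_end_ge fl _ (ltW s0)).
  by rewrite ec lee_fin leNgt st.
move=> /(shock_time_ltP adm fl)[s [/andP[s0 st]]].
have s't : 0 < (s + t) / 2 < t by apply/andP; split; lra.
rewrite (lftA s) ?s0// (left_end_fresh adm fl (ltW s0) _ (lftA _ s't)) ?ltxx//; lra.
Qed.

End turbulent_intervals.

(** * Shock times and measurability of the representatives *)

Section representatives.
Context {R : realType} {mu0 : {measure set (measurableTypeR R) -> \bar R}}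
  {u0 : R -> R} {phi : R -> R -> R -> R}.
Hypothesis adm : admissible mu0 u0.
Hypothesis fl : sticky_flow mu0 u0 phi.
Local Notation lft := (left_end phi).
Local Notation rgt := (right_end phi).
Local Notation pos := (phi 0).
Local Notation tau := (shock_time mu0 u0 phi).
Local Notation turb := (turbulent mu0 u0 phi).
Implicit Types t s x y a b c : R.

(** By [left_end_fresh] the left end of the cluster of time [t] is alone at every earlier time, and
    it merges at [t] if the cluster is nontrivial; otherwise it is [a] itself. *)
Lemma left_end_shock t a : tau a = t%:E -> tau (lft t a) = t%:E.
Proof.
move=> e; have t0 : 0 <= t by rewrite -lee_fin -e shock_time_ge0.
have [m|/(unmerged fl t0)[-> //]] := boolP (lft t a < rgt t a).
have ll : lft t (lft t a) = lft t a by rewrite /left_end (pos_left_end fl).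
have tgt0 : 0 < t.
  rewrite lt_neqAle t0 andbT; apply/eqP => t00; move: m.
  by rewrite -t00 (left_end0 fl) (right_end0 fl) ltxx.
apply/le_anti/andP; split.
  by apply: (shock_time_le adm fl) => //; rewrite ll /right_end (pos_left_end fl).
rewrite leNgt; apply/negP => /(shock_time_ltP adm fl)[s [/andP[s0 st]]].
rewrite (left_end_fresh adm fl (ltW s0) st ll) ltNge.
by rewrite -[leLHS]ll (left_end_time fl _ (ltW s0) (ltW st)).
Qed.

Lemma right_end_shock t a : tau a = t%:E -> tau (rgt t a) = t%:E.
Proof.
move=> e; have t0 : 0 <= t by rewrite -lee_fin -e shock_time_ge0.
have [m|/(unmerged fl t0)[_ -> //]] := boolP (lft t a < rgt t a).
have ll : rgt t (rgt t a) = rgt t a by rewrite /right_end (pos_right_end fl).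
have tgt0 : 0 < t.
  rewrite lt_neqAle t0 andbT; apply/eqP => t00; move: m.
  by rewrite -t00 (left_end0 fl) (right_end0 fl) ltxx.
apply/le_anti/andP; split.
  by apply: (shock_time_le adm fl) => //; rewrite ll /left_end (pos_right_end fl).
rewrite leNgt; apply/negP => /(shock_time_ltP adm fl)[s [/andP[s0 st]]].
rewrite (right_end_fresh adm fl (ltW s0) st ll) ltNge.
by rewrite -[leRHS]ll (right_end_time fl _ (ltW s0) (ltW st)).
Qed.

Lemma shock_positionE t a : tau a = t%:E -> shock_position mu0 u0 phi a = pos t a.
Proof.
move=> e; have [eA <-] := turb_left_shock adm fl e.
by rewrite /shock_position eA (pos_shock_time adm fl eA).
Qed.

(** The definition goes through the left end of the turbulent interval, which has the same shock
    time and the same shock position as [a]. *)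
Lemma shock_leftE t a : tau a = t%:E -> shock_left mu0 u0 phi a = lft t a.
Proof.
move=> e; rewrite /shock_left (shock_positionE e) e/=.
by have [-> _] := turb_left_shock adm fl e.
Qed.

Lemma shock_rightE t a : tau a = t%:E -> shock_right mu0 u0 phi a = rgt t a.
Proof.
move=> e; rewrite /shock_right (shock_positionE e) e/=.
by have [-> _] := turb_left_shock adm fl e.
Qed.

(** Monotonicity will give measurability. If the order were reversed, [a] would belong to the
    turbulent interval of [b], and its own interval would have to extend down to the left end of
    that one. *)
Lemma turb_left_homo : {homo turb_left mu0 u0 phi : a b / a <= b}.
Proof.
move=> a b ab; rewrite leNgt; apply/negP => BA.
have Aa := turb_left_le fl a.
have /(turb_left_lt fl)/(_ ab) tba := lt_le_trans BA Aa.
have [e|/shock_time_fine[t _ e]] := pselect (tau b = +oo%E).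
  move: tba BA; rewrite (turbulent_oo e) => /= ->.
  by rewrite ltxx.
have [eB pB] := turb_left_shock adm fl e.
have [ea pa] : tau a = t%:E /\ pos t a = pos t b.
  by apply: ((turbulentP _ e).1 tba); exact: betweenr.
suff : turb a (turb_left mu0 u0 phi b).
  move=> h; have : turb_left mu0 u0 phi a <= turb_left mu0 u0 phi b.
    by apply: ge_inf h; case: (turbulent_has_inf fl a).
  by rewrite leNgt BA.
apply/(turbulentP _ ea) => c; rewrite /between => /orP[|/andP[Bc ca]].
  move=> /andP[ac cB]; have {}ac := le_trans ac cB.
  by move: (lt_le_trans BA Aa); rewrite ltNge ac.
move: Bc; rewrite le_eqVlt => /predU1P[<-|Bc]; first by rewrite eB pB pa.
have /((turbulentP _ e).1)/(_ c) := turb_left_lt fl Bc (le_trans ca ab).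
by rewrite pa; apply; exact: betweenr.
Qed.

Lemma turb_right_homo : {homo turb_right mu0 u0 phi : a b / a <= b}.
Proof.
move=> b a ba; rewrite leNgt; apply/negP => AB.
have Aa := turb_right_ge fl a.
have /(turb_right_gt fl)/(_ ba) tba := le_lt_trans Aa AB.
have [e|/shock_time_fine[t _ e]] := pselect (tau b = +oo%E).
  move: tba AB; rewrite (turbulent_oo e) => /= ->.
  by rewrite ltxx.
have [eB pB] := turb_right_shock adm fl e.
have [ea pa] : tau a = t%:E /\ pos t a = pos t b.
  by apply: ((turbulentP _ e).1 tba); exact: betweenr.
suff : turb a (turb_right mu0 u0 phi b).
  move=> h; have : turb_right mu0 u0 phi b <= turb_right mu0 u0 phi a.
    by apply: ub_le_sup h; case: (turbulent_has_sup fl a).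
  by rewrite leNgt AB.
apply/(turbulentP _ ea) => c; rewrite /between => /orP[/andP[ac cB]|]; last first.
  move=> /andP[Bc ca]; have {}ca := le_trans Bc ca.
  by move: (le_lt_trans Aa AB); rewrite ltNge ca.
move: cB; rewrite le_eqVlt => /predU1P[->|cB]; first by rewrite eB pB pa.
have /((turbulentP _ e).1)/(_ c) := turb_right_gt fl cB (le_trans ba ac).
by rewrite pa; apply; exact: betweenr.
Qed.

Lemma measurable_shock_time_lt t :
  measurable ([set a | (tau a < t%:E)%E] : set (measurableTypeR R)).
Proof.
rewrite (_ : mkset _ = \bigcup_(n in [set n | 0 < (rational_nth n : R) < t])
    [set a | lft (rational_nth n) a < rgt (rational_nth n) a]).
  apply: bigcup_measurable => n /= /andP[n0 _].
  by apply: (merged_measurable fl); exact: ltW.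
apply/seteqP; split => a /=.
  move=> /(shock_time_ltP adm fl)[s [/andP[s0 /rational_nth_dense[n /andP[sn nt]]] m]].
  exists n; first by rewrite /= (lt_trans s0).
  exact: (merged_time fl (ltW s0) (ltW sn)).
by move=> [n /= n0 m]; apply/(shock_time_ltP adm fl); exists (rational_nth n).
Qed.

Lemma measurable_shock_time_ge t :
  measurable ([set a | (t%:E <= tau a)%E] : set (measurableTypeR R)).
Proof.
rewrite (_ : mkset _ = ~` [set a | (tau a < t%:E)%E]).
  by apply: measurableC; exact: measurable_shock_time_lt.
by apply/seteqP; split => a /=; rewrite leNgt => /negP.
Qed.

Lemma measurable_shock_time_le t :
  measurable ([set a | (tau a <= t%:E)%E] : set (measurableTypeR R)).
Proof.
rewrite (_ : mkset _ = \bigcap_n [set a | (tau a < (t + harmonic n)%:E)%E]).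
  by apply: bigcapT_measurable => n; exact: measurable_shock_time_lt.
apply/seteqP; split => a /= h.
  by move=> n _ /=; rewrite (le_lt_trans h)// lte_fin ltrDl /harmonic invr_gt0.
apply/lee_addgt0Pr => e e0.
have [n ne] : exists n, harmonic n < e :> R.
  have [N _ /(_ N (leqnn N)) NE] := @cvgr_lt _ _ _ _ _ _ (@cvg_harmonic R) _ e0.
  by exists N.
by apply/ltW/(lt_trans (h n I)); rewrite -EFinD lte_fin ltrD2l.
Qed.

Lemma measurable_shock_time_gt t :
  measurable ([set a | (t%:E < tau a)%E] : set (measurableTypeR R)).
Proof.
rewrite (_ : mkset _ = ~` [set a | (tau a <= t%:E)%E]).
  by apply: measurableC; exact: measurable_shock_time_le.
by apply/seteqP; split => a /=; rewrite ltNge => /negP.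
Qed.

Lemma measurable_shock_time_fin :
  measurable ([set a | (tau a < +oo)%E] : set (measurableTypeR R)).
Proof.
rewrite (_ : mkset _ = \bigcup_n [set a | (tau a <= n%:R%:E)%E]).
  by apply: bigcupT_measurable => n; exact: measurable_shock_time_le.
apply/seteqP; split => a /= h; last by have [n _ h2] := h; exact: le_lt_trans h2 (ltry _).
have [|t t0 e] := @shock_time_fine _ mu0 u0 phi a; first by move=> e; move: h; rewrite e.
exists (Num.truncn t).+1 => //=; rewrite e lee_fin; exact/ltW/truncnS_gt.
Qed.

(** For a shock time in []0, +oo[] this says that [b] is in the cluster of [a] at time [tau a].
    Since [tau a] varies with [a], the condition is stated at the rational times after it, which
    makes it a countable intersection; [pos_eq_right] recovers the time [tau a]. *)
Let same_shock b : set (measurableTypeR R) :=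
  [set a | (0%:E < tau a)%E /\ (tau a < +oo)%E /\ forall n, 0 < (rational_nth n : R) ->
     (tau a < (rational_nth n)%:E)%E -> pos (rational_nth n) a = pos (rational_nth n) b].

Let same_shock_measurable b : measurable (same_shock b).
Proof.
rewrite (_ : same_shock b = [set a | (0%:E < tau a)%E] `&` ([set a | (tau a < +oo)%E] `&`
   \bigcap_n (if 0 < (rational_nth n : R) then [set a | ((rational_nth n)%:E <= tau a)%E] `|`
      `[lft (rational_nth n) b, rgt (rational_nth n) b] else setT))).
  apply: measurableI; first exact: measurable_shock_time_gt.
  apply: measurableI; first exact: measurable_shock_time_fin.
  apply: bigcapT_measurable => n; case: ifP => // n0.
  by apply: measurableU => //; exact: measurable_shock_time_ge.
apply/seteqP; split => a /= [h1 [h2 h3]]; do 2 split => //.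
  move=> n _; case: ifPn => // n0 /=; have [?|tn] := leP (rational_nth n)%:E (tau a).
    by left.
  by right; rewrite in_itv /=; apply/(clusterP fl); [exact: ltW|exact: h3].
move=> n n0 tn; have := h3 n I; rewrite n0 => -[/=|].
  by rewrite leNgt tn.
by rewrite /= in_itv /= => /(clusterP fl); apply; exact: ltW.
Qed.

Let same_shockP t a b : tau a = t%:E -> 0 < t -> same_shock b a <-> pos t b = pos t a.
Proof.
move=> e t0; split => [[_ [_ h]]|ba].
  apply: (pos_eq_right fl t0) => s ts.
  have [n /andP[tn ns]] := rational_nth_dense ts.
  have n0 := lt_trans t0 tn.
  by apply: (pos_eq_le fl (ltW n0) (ltW ns)); rewrite h// e lte_fin.
split; first by rewrite e lte_fin.
split; first by rewrite e ltry.
move=> n n0; rewrite e lte_fin => tn.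
by apply: (pos_eq_le fl (ltW t0) (ltW tn)).
Qed.

(** [shock_left] need not be monotone, since the cluster of a later shock can contain that of an
    earlier one. Instead, [shock_left a < r] holds when [a < r] or when some rational below [r] lies
    in the first shock cluster of [a]. *)
Lemma measurable_shock_left :
  measurable_fun [set: measurableTypeR R] (shock_left mu0 u0 phi : _ -> measurableTypeR R).
Proof.
apply: (measurability (@RGenCInfty.G R)) => [|/= _ [_] [r] -> <-].
  exact: RGenCInfty.measurableE.
rewrite setTI (_ : _ @^-1` _ = ~` (`]-oo, r[%classic `|`
  \bigcup_(n in [set n | (rational_nth n : R) < r])
    (`[rational_nth n, +oo[%classic `&` same_shock (rational_nth n)))).
  apply: measurableC; apply: measurableU => //; apply: bigcup_measurable => n _.
  by apply: measurableI => //; exact: same_shock_measurable.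
have eqC (A B : set R) : ~` A = B -> A = ~` B by move=> <-; rewrite setCK.
apply: eqC; apply/seteqP; split => a /=; rewrite !in_itv /= andbT.
  move=> /negP; rewrite -ltNge => ar; have [?|ra] := ltP a r; [by left|right].
  have [e|/shock_time_fine[t t0 e]] := pselect (tau a = +oo%E).
    by move: ar; rewrite /shock_left e eqxx ltNge ra.
  move: ar; rewrite (shock_leftE e) => ar.
  have tgt0 : 0 < t.
    rewrite lt_neqAle t0 andbT; apply/eqP => t00; move: ar.
    by rewrite -t00 (left_end0 fl) ltNge ra.
  have [n /andP[ln nr]] := rational_nth_dense ar; exists n => //; split.
    by rewrite /= in_itv /= andbT ltW// (lt_le_trans nr).
  apply/(same_shockP _ e tgt0)/(clusterP fl _ _ t0); rewrite (ltW ln)/=.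
  by rewrite ltW// (lt_le_trans nr)// (le_trans ra)// (right_end_ge fl).
have le_left : shock_left mu0 u0 phi a <= a.
  have [e|/shock_time_fine[t t0 e]] := pselect (tau a = +oo%E).
    by rewrite /shock_left e eqxx.
  by rewrite (shock_leftE e) (left_end_le fl).
move=> [ar|[n /= nr [_ sa]]]; apply/negP; rewrite -ltNge.
  exact: le_lt_trans ar.
have [t t0 e] : exists2 t, 0 < t & tau a = t%:E.
  have [gt0 [fin _]] := sa.
  have [|t t0 e] := @shock_time_fine _ mu0 u0 phi a; first by move=> e; move: fin; rewrite e.
  by exists t => //; rewrite -lte_fin -e.
rewrite (shock_leftE e); apply: le_lt_trans nr.
by have /(same_shockP _ e t0)/(clusterP fl _ _ (ltW t0))/andP[] := sa.
Qed.

Lemma measurable_shock_right :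
  measurable_fun [set: measurableTypeR R] (shock_right mu0 u0 phi : _ -> measurableTypeR R).
Proof.
apply: (measurability (@RGenOInfty.G R)) => [|/= _ [_] [r] -> <-].
  exact: RGenOInfty.measurableE.
rewrite setTI (_ : _ @^-1` _ = `]r, +oo[%classic `|`
  \bigcup_(n in [set n | r < (rational_nth n : R)])
    (`]-oo, rational_nth n]%classic `&` same_shock (rational_nth n))).
  apply: measurableU => //; apply: bigcup_measurable => n _.
  by apply: measurableI => //; exact: same_shock_measurable.
apply/seteqP; split => a /=; rewrite !in_itv /= !andbT.
  move=> ar; have [?|ra] := ltP r a; [by left|right].
  have [e|/shock_time_fine[t t0 e]] := pselect (tau a = +oo%E).
    by move: ar; rewrite /shock_right e eqxx ltNge ra.
  move: ar; rewrite (shock_rightE e) => ar.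
  have tgt0 : 0 < t.
    rewrite lt_neqAle t0 andbT; apply/eqP => t00; move: ar.
    by rewrite -t00 (right_end0 fl) ltNge ra.
  have [n /andP[rn nr]] := rational_nth_dense ar; exists n => //; split.
    by rewrite /= in_itv /= ltW// (le_lt_trans ra).
  apply/(same_shockP _ e tgt0)/(clusterP fl _ _ t0); rewrite (ltW nr) andbT.
  by rewrite ltW// (le_lt_trans _ rn)// (le_trans _ ra)// (left_end_le fl).
have ge_right : a <= shock_right mu0 u0 phi a.
  have [e|/shock_time_fine[t t0 e]] := pselect (tau a = +oo%E).
    by rewrite /shock_right e eqxx.
  by rewrite (shock_rightE e) (right_end_ge fl).
move=> [ar|[n /= nr [_ sa]]].
  exact: lt_le_trans ge_right.
have [t t0 e] : exists2 t, 0 < t & tau a = t%:E.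
  have [gt0 [fin _]] := sa.
  have [|t t0 e] := @shock_time_fine _ mu0 u0 phi a; first by move=> e; move: fin; rewrite e.
  by exists t => //; rewrite -lte_fin -e.
rewrite (shock_rightE e); apply: (lt_le_trans nr).
by have /(same_shockP _ e t0)/(clusterP fl _ _ (ltW t0))/andP[] := sa.
Qed.

End representatives.

(* What [turb_left], [turb_right], [shock_left] and [shock_right] have in common:
   all that is used of the maps [g] such that [Z_t = phi 0 t (g X_0)]. *)
Definition shock_representative {R : realType}
    (mu0 : {measure set (measurableTypeR R) -> \bar R}) (u0 : R -> R)
    (phi : R -> R -> R -> R) (g : R -> R) : Prop :=
  [/\ measurable_fun [set: measurableTypeR R] (g : _ -> measurableTypeR R),
      forall a, shock_time mu0 u0 phi (g a) = shock_time mu0 u0 phi a,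
      forall t a, shock_time mu0 u0 phi a = t%:E -> phi 0 t (g a) = phi 0 t a &
      forall a, shock_time mu0 u0 phi a = +oo%E -> g a = a].

Section representative_instances.
Context {R : realType} {mu0 : {measure set (measurableTypeR R) -> \bar R}}
  {u0 : R -> R} {phi : R -> R -> R -> R}.
Hypothesis adm : admissible mu0 u0.
Hypothesis fl : sticky_flow mu0 u0 phi.
Local Notation tau := (shock_time mu0 u0 phi).
Local Notation rep := (shock_representative mu0 u0 phi).

Let representative_intro (g : R -> R) :
  measurable_fun [set: measurableTypeR R] (g : _ -> measurableTypeR R) ->
  (forall a, tau a = +oo%E -> g a = a) ->
  (forall t a, tau a = t%:E -> tau (g a) = t%:E /\ phi 0 t (g a) = phi 0 t a) ->
  rep g.
Proof.
move=> mg goo gfin; split; [exact: mg| |by move=> t a /gfin[]|exact: goo].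
move=> a.
have [e|/shock_time_fine[t _ e]] := pselect (tau a = +oo%E).
  by rewrite goo.
by have [-> _] := gfin _ _ e.
Qed.

Lemma turb_left_representative : rep (turb_left mu0 u0 phi).
Proof.
apply: representative_intro.
- exact: nondecreasing_measurable (turb_left_homo adm fl).
- by move=> a e; rewrite /turb_left (turbulent_oo e) inf1.
- by move=> t a; exact: (turb_left_shock adm fl).
Qed.

Lemma turb_right_representative : rep (turb_right mu0 u0 phi).
Proof.
apply: representative_intro.
- exact: nondecreasing_measurable (turb_right_homo adm fl).
- by move=> a e; rewrite /turb_right (turbulent_oo e) sup1.
- by move=> t a; exact: (turb_right_shock adm fl).
Qed.

Lemma shock_left_representative : rep (shock_left mu0 u0 phi).
Proof.
apply: representative_intro.
- exact: measurable_shock_left.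
- by move=> a e; rewrite /shock_left e eqxx.
- move=> t a e; rewrite (shock_leftE adm fl e) (left_end_shock adm fl e).
  by rewrite (pos_left_end fl)// -lee_fin -e shock_time_ge0.
Qed.

Lemma shock_right_representative : rep (shock_right mu0 u0 phi).
Proof.
apply: representative_intro.
- exact: measurable_shock_right.
- by move=> a e; rewrite /shock_right e eqxx.
- move=> t a e; rewrite (shock_rightE adm fl e) (right_end_shock adm fl e).
  by rewrite (pos_right_end fl)// -lee_fin -e shock_time_ge0.
Qed.

End representative_instances.

(** * Lebesgue differentiation along clusters *)

Section regularity.
Context {R : realType}.
Variable nu : {measure set (measurableTypeR R) -> \bar R}.
Hypothesis nufin : (nu setT < +oo)%E.

(** Both approximations are required at once because complementation exchanges them; regular sets
    then form a sigma-algebra, and only rays have to be examined. *)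
Definition inner_outer_regular (A : set R) : Prop :=
  forall e : R, 0 < e -> exists U F : set R,
    [/\ open U, closed F, F `<=` A, A `<=` U & (nu (U `\` F) < e%:E)%E].

Let fin (A : set (measurableTypeR R)) : measurable A -> (nu A < +oo)%E.
Proof. by move=> mA; apply: le_lt_trans nufin; apply: le_measure; rewrite ?inE. Qed.

Let open_mR (U : set R) : open U -> measurable (U : set (measurableTypeR R)).
Proof. exact: open_measurable. Qed.

Let closed_mR (U : set R) : closed U -> measurable (U : set (measurableTypeR R)).
Proof. exact: closed_measurable. Qed.

Let regular_ray (x : R) : inner_outer_regular `[x, +oo[.
Proof.
move=> e e0; pose U n : set (measurableTypeR R) := `]x - harmonic n, +oo[%classic.
have mU n : measurable (U n) by exact: measurable_itv.
have mD n : measurable (U n `\` `[x, +oo[%classic) by exact: measurableD.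
have : nu (U n `\` `[x, +oo[%classic) @[n --> \oo] --> nu (\bigcap_n (U n `\` `[x, +oo[%classic)).
  apply: nonincreasing_cvg_mu => //; first exact: fin.
  - by apply: bigcapT_measurable.
  - move=> n m nm; apply/subsetPset; apply: setSD => y; rewrite /U /= !in_itv /= !andbT.
    apply: le_lt_trans; rewrite lerD2l lerN2 /harmonic/= lef_pV2 ?posrE ?ltr0n//.
    by rewrite ler_nat ltnS.
rewrite (_ : \bigcap_n _ = set0); last first.
  apply/seteqP; split => // y h; have [_] := h 0%N I.
  rewrite /= in_itv /= andbT => /negP; rewrite -ltNge => yx.
  have xy : 0 < x - y by rewrite subr_gt0.
  have [N _ /(_ N (leqnn N))] := @cvgr_lt _ _ _ _ _ _ (@cvg_harmonic R) _ xy.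
  have [+ _] := h N I; rewrite /U /= in_itv /= andbT ltrBlDr -ltrBlDl => h1.
  by move=> /(lt_trans h1); rewrite ltxx.
rewrite measure0 => /fine_cvgP[_ /cvgr_lt /(_ e e0)][N _ /(_ N (leqnn N)) h].
exists (U N), `[x, +oo[%classic; split => //; rewrite /U.
- exact: rray_closed.
- move=> y; rewrite /= !in_itv /= !andbT; apply: lt_le_trans.
  by rewrite ltrBlDr ltrDl /harmonic invr_gt0.
- have := fin (mD N); rewrite -ge0_fin_numE ?measure_ge0// => /fineK <-.
  by rewrite lte_fin.
Qed.

Let regular_setC A : inner_outer_regular A -> inner_outer_regular (~` A).
Proof.
move=> rA e /rA[U [F [oU cF FA AU UF]]]; exists (~` F), (~` U); split.
- exact: closed_openC.
- exact: open_closedC.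
- exact: subsetC.
- exact: subsetC.
- by rewrite setDE setCK setIC -setDE.
Qed.

Let regular_bigcup (A : (set R)^nat) :
  (forall n, inner_outer_regular (A n)) -> inner_outer_regular (\bigcup_n A n).
Proof.
move=> rA e e0.
have /choice[UF UFP] : forall n, exists UF : set R * set R,
    [/\ open UF.1, closed UF.2, UF.2 `<=` A n, A n `<=` UF.1 &
      (nu (UF.1 `\` UF.2) < (e / 2 / (2 ^ n.+1)%:R)%:E)%E].
  move=> n; have [|U [F ?]] := rA n (e / 2 / (2 ^ n.+1)%:R); last by exists (U, F).
  by rewrite !divr_gt0// ltr0n expn_gt0.
(* A countable union of closed sets need not be closed, so it is truncated, using continuity from
   above of the finite measure. The series of errors spends only [e / 2], which leaves a strict
   inequality for the truncation. *)
pose U := \bigcup_n (UF n).1; pose FN N := \bigcup_(n < N) (UF n).2.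
have oU : open U by apply: bigcup_open => n _; have [] := UFP n.
have mU : measurable (U : set (measurableTypeR R)) by exact: open_mR.
have cFN N : closed (FN N).
  rewrite /FN bigcup_mkord; apply: closed_bigsetU => n _; by have [] := UFP n.
have mDN N : measurable (U `\` FN N : set (measurableTypeR R)).
  by apply: measurableD => //; exact: closed_mR.
have mUFn n : measurable ((UF n).1 `\` (UF n).2 : set (measurableTypeR R)).
  by have [? ? _ _ _] := UFP n; apply: measurableD; [exact: open_mR|exact: closed_mR].
have : nu (U `\` FN N) @[N --> \oo] --> nu (\bigcap_N (U `\` FN N)).
  apply: nonincreasing_cvg_mu => //; first exact: fin.
  - exact: bigcapT_measurable.
  - move=> n m nm; apply/subsetPset; apply: setDS => x [k /= kn xk]; exists k => //=.
    exact: leq_trans nm.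
have small : (nu (\bigcap_N (U `\` FN N)) < e%:E)%E.
  apply: (@le_lt_trans _ _ (nu (\bigcup_n ((UF n).1 `\` (UF n).2)))).
    apply: le_measure; rewrite ?inE; [exact: bigcapT_measurable|exact: bigcupT_measurable|].
    move=> x h; have [[n _ xn] _] := h 0%N I; exists n => //; split => // xF.
    by have [_] := h n.+1 I; apply; exists n => //=.
  apply: (@le_lt_trans _ _ (\sum_(n <oo) nu ((UF n).1 `\` (UF n).2))%E).
    apply: measure_sigma_subadditive => //; exact: bigcupT_measurable.
  apply: (@le_lt_trans _ _ (\sum_(n <oo) (0 + (e / 2 / (2 ^ n.+1)%:R)%:E))%E).
    apply: lee_nneseries => // n _; rewrite add0e; apply: ltW.
    by have [] := UFP n.
  apply: (@le_lt_trans _ _ (\sum_(n <oo) (0 : \bar R) + (e / 2)%:E)%E).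
    by apply: epsilon_trick => //; rewrite divr_ge0// ltW.
  rewrite eseries0// add0e lte_fin; lra.
have capfin : nu (\bigcap_N (U `\` FN N)) \is a fin_num.
  by rewrite ge0_fin_numE// (lt_trans small)// ltry.
rewrite -(fineK capfin) in small *; rewrite lte_fin in small.
move=> /fine_cvgP[_ /cvgr_lt /(_ e small)][N _ /(_ N (leqnn N)) h].
exists U, (FN N); split => //.
- move=> x [n _ xn]; exists n => //; have [_ _ FA _ _] := UFP n; exact: FA.
- move=> x [n _ xn]; exists n => //; have [_ _ _ AU _] := UFP n; exact: AU.
- have := fin (mDN N); rewrite -ge0_fin_numE ?measure_ge0// => /fineK <-.
  by rewrite lte_fin.
Qed.

Lemma finite_measure_regular (A : set (measurableTypeR R)) :
  measurable A -> inner_outer_regular A.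
Proof.
have -> : @measurable _ (measurableTypeR R) = <<s (@RGenCInfty.G R) >>.
  exact: RGenCInfty.measurableE.
apply: smallest_sub.
  split.
  - by move=> e e0; exists set0, set0; split; rewrite ?setD0 ?measure0//; exact: closed0.
  - by move=> B; rewrite setTD; exact: regular_setC.
  - by move=> F; exact: regular_bigcup.
by move=> _ [x ->]; exact: regular_ray.
Qed.

Lemma outer_regular (A : set (measurableTypeR R)) (e : R) : measurable A -> 0 < e ->
  exists U : set R, [/\ open U, A `<=` U & (nu (U `\` A) < e%:E)%E].
Proof.
move=> mA e0; have [U [F [oU cF FA AU UF]]] := finite_measure_regular mA e0.
exists U; split => //; apply: le_lt_trans UF; apply: le_measure; rewrite ?inE.
- by apply: measurableD => //; exact: open_mR.
- by apply: measurableD; [exact: open_mR|exact: closed_mR].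
- exact: setDS.
Qed.

End regularity.

(** * A maximal inequality along clusters *)

Section differentiation.
Context {R : realType} {mu0 : {measure set (measurableTypeR R) -> \bar R}}
  {u0 : R -> R} {phi : R -> R -> R -> R}.
Hypothesis adm : admissible mu0 u0.
Hypothesis fl : sticky_flow mu0 u0 phi.
Local Notation lft := (left_end phi).
Local Notation rgt := (right_end phi).
Local Notation pos := (phi 0).
Local Notation tau := (shock_time mu0 u0 phi).
Local Notation cmean := (cluster_mean mu0 phi).
Implicit Types t s x y a b c p q : R.

(** Outer regularity of [mu0] restricted to [[p, q]], combined with absolute continuity of the
    integral of [|f|]. *)
Lemma locint_outer_approx (f : R -> R) p q (N : set (measurableTypeR R)) (e : R) :
  locally_mu_integrable mu0 f -> measurable N -> N `<=` `]p, q[ -> 0 < e ->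
  exists U : set R, [/\ open U, N `<=` U, U `<=` `]p, q[ &
    \int[mu0]_(x in U `\` N) `|f x| < e].
Proof.
move=> lf mN Npq e0; pose D : set (measurableTypeR R) := `[p, q]%classic.
have mD : measurable D by exact: measurable_itv.
have DpD : `]p, q[ `<=` D by exact: subset_itv_oo_cc.
have fD : mu0.-integrable D (EFin \o f) by exact: locint_integrable lf mD (@subset_refl _ _).
have gi := integrable_patch mD fD.
have [dl [dl0 small]] := integral_normr_continuous gi e0.
pose nu := mrestr mu0 mD.
have nufin : (nu setT < +oo)%E.
  by rewrite /nu /mrestr setTI; exact: (radon_finite (adm_radon adm) mD (@subset_refl _ _)).
have [U0 [oU0 NU0 U0N]] := outer_regular nufin mN dl0.
have oU : open (U0 `&` `]p, q[) by apply: openI => //; exact: interval_open.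
exists (U0 `&` `]p, q[); split => //.
  by move=> x Nx; split; [exact: NU0|exact: Npq].
have mU : measurable (U0 `&` `]p, q[ : set (measurableTypeR R)) by exact: open_measurable.
have mUN : measurable ((U0 `&` `]p, q[) `\` N : set (measurableTypeR R)) by exact: measurableD.
rewrite (@eq_Rintegral _ _ _ mu0 _ (fun x => `|(f \_ D) x|)); last first.
  move=> x; rewrite inE => -[[_ /DpD Dx] _].
  by rewrite /= patchE mem_set.
apply: small => //; apply: le_lt_trans U0N; rewrite /nu /mrestr.
have mU0 : measurable (U0 : set (measurableTypeR R)) by exact: open_measurable.
apply: le_measure; rewrite ?inE//.
- by apply: measurableI => //; exact: measurableD.
- by move=> x [[U0x /DpD Dx] Nx].
Qed.

(** However [S] is described, it is a countable union of closed intervals, one for each rational in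
    it. *)
Lemma saturated_measurable t (S : set R) : 0 <= t -> saturated phi t S ->
  S `<=` [set a | lft t a < rgt t a] -> measurable (S : set (measurableTypeR R)).
Proof.
move=> t0 sS Sm.
rewrite (_ : S = \bigcup_(n in [set n | S (rational_nth n)])
    `[lft t (rational_nth n), rgt t (rational_nth n)]%classic).
  by apply: bigcup_measurable => n _; exact: measurable_itv.
apply/seteqP; split => [a Sa|a [n /= Sn]]; last first.
  by rewrite /= in_itv /= => /(clusterP fl _ _ t0); exact: sS.
have [n /andP[/ltW ln /ltW nr]] := rational_nth_dense (Sm _ Sa).
have e : pos t (rational_nth n) = pos t a by apply/(clusterP fl _ _ t0); rewrite ln.
by exists n; [exact: sS e|rewrite (cluster_preimage fl)].
Qed.

Lemma saturated_merged t : 0 <= t -> saturated phi t [set a | lft t a < rgt t a].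
Proof. by move=> t0 a b /=; rewrite /left_end /right_end => + ->. Qed.

Lemma measurable_cluster_mean (f : R -> R) t : 0 <= t ->
  measurable_fun [set: measurableTypeR R] f ->
  measurable_fun [set: measurableTypeR R] (cmean f t).
Proof.
move=> t0 mf _ B mB; rewrite setTI.
have mM := merged_measurable fl t0.
pose M : set (measurableTypeR R) := [set a | lft t a < rgt t a].
rewrite (_ : _ @^-1` _ = (cmean f t @^-1` B `&` M) `|` (f @^-1` B `&` ~` M)).
  apply: measurableU; last first.
    by apply: measurableI; [rewrite -[_ @^-1` _]setTI; exact: mf|exact: measurableC].
  apply: (saturated_measurable t0) => [a b [Ba Ma] e|a []//].
  split; last exact: saturated_merged Ma e.
  by rewrite /preimage /= (@cluster_mean_pos _ _ _ f t b a)//; rewrite (saturated_merged t0 Ma).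
apply/seteqP; split => a /=.
  have [Ma|nMa] := pselect (M a); first by left.
  by move=> h; right; split => //; move: h; rewrite /cluster_mean ifN//; exact/negP.
by move=> [[]//|[Ba /negP nMa]]; rewrite /cluster_mean ifN.
Qed.

(* [V t], the union of the nontrivial clusters of time [t] lying in [U] where
   the mean of [f] exceeds [q], is saturated at every earlier time; so adding
   smaller and smaller times keeps the integral of [f - q] nonnegative. *)
Section maximal.
Variables (f : R -> R) (U : set R) (q lo hi : R).
Hypothesis lf : locally_mu_integrable mu0 f.
Hypothesis Ub : U `<=` `]lo, hi[.

Definition large_mean t : set R :=
  [set a | [/\ lft t a < rgt t a, `[lft t a, rgt t a] `<=` U & q < cmean f t a]].

Lemma large_mean_saturated s t : 0 <= s -> s <= t -> saturated phi s (large_mean t).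
Proof.
move=> s0 st a b [m sU qm] e; have t0 := le_trans s0 st.
have {}e : pos t b = pos t a by exact: (pos_eq_le fl s0 st e).
have m' : lft t b < rgt t b by rewrite /left_end /right_end e.
split => //; first by move: sU; rewrite /left_end /right_end e.
by rewrite (cluster_mean_pos f t0 m' e).
Qed.

Lemma large_mean_measurable t : 0 <= t ->
  measurable (large_mean t : set (measurableTypeR R)).
Proof.
move=> t0; apply: (saturated_measurable t0); last by move=> a [].
exact: large_mean_saturated.
Qed.

Lemma large_mean_sub t : 0 <= t -> large_mean t `<=` U.
Proof.
move=> t0 a [_ + _]; apply; rewrite /= in_itv /=; exact: (cluster_self fl).
Qed.

Let lfq : locally_mu_integrable mu0 (fun x => f x - q).
Proof. exact: locintD lf (locint_cst (adm_radon adm) (- q)). Qed.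

Let fqi (A : set (measurableTypeR R)) : measurable A -> A `<=` U ->
  mu0.-integrable A (EFin \o (fun x => f x - q)).
Proof.
move=> mA AU; apply: (locint_integrable lfq mA (a := lo) (b := hi)).
by apply: subset_trans AU (subset_trans Ub _); exact: subset_itv_oo_cc.
Qed.

Lemma large_mean_integral t (A : set (measurableTypeR R)) : 0 <= t ->
  measurable A -> saturated phi t A -> A `<=` large_mean t ->
  0 <= \int[mu0]_(x in A) (f x - q).
Proof.
move=> t0 mA sA AV.
have AU : A `<=` U by apply: subset_trans AV (large_mean_sub t0).
have Aab : A `<=` `[lo, hi].
  by apply: subset_trans AU (subset_trans Ub _); exact: subset_itv_oo_cc.
have fi := locint_integrable lf mA Aab.
have qi := locint_integrable (locint_cst (adm_radon adm) q) mA Aab.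
have [gi gE] := integral_cluster_mean adm fl lf t0 mA sA fi.
have -> : \int[mu0]_(x in A) (f x - q) = \int[mu0]_(x in A) (cmean f t x - q).
  by rewrite !RintegralB//; congr (_ - _); rewrite /Rintegral gE.
by apply: Rintegral_ge0 => x /AV[_ _ /ltW]; rewrite subr_ge0.
Qed.

Lemma large_mean_bigcup (l : seq R) : sorted <=%O l -> {in l, forall t, 0 <= t} ->
  let W : set (measurableTypeR R) := [set a | exists2 t, t \in l & large_mean t a] in
  [/\ measurable W, W `<=` U & 0 <= \int[mu0]_(x in W) (f x - q)].
Proof.
elim: l => [_ _ W|s l IH].
  have -> : W = set0 by apply/seteqP; split => // a [t].
  by split => //; rewrite Rintegral_set0.
rewrite /= (path_sortedE le_trans) => /andP[/allP sl /IH{}IH] l0.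
have s0 : 0 <= s by apply: l0; rewrite mem_head.
have [|mW WU W0] := IH; first by move=> t tl; apply: l0; rewrite inE tl orbT.
set W' := [set a | _]; set W := [set a | _] in mW WU W0.
have W'E : W' = W `|` (large_mean s `\` W).
  apply/seteqP; split => a.
    move=> [t]; rewrite inE => /predU1P[-> h|tl h]; last by left; exists t.
    by have [?|?] := pselect (W a); [left|right].
  move=> [[t tl h]|[h _]]; first by exists t => //; rewrite inE tl orbT.
  by exists s => //; rewrite mem_head.
have mV := large_mean_measurable s0.
have mVW : measurable (large_mean s `\` W : set (measurableTypeR R)) by exact: measurableD.
have VWU : large_mean s `\` W `<=` U by move=> a [/(large_mean_sub s0)].
have sW : saturated phi s W.
  move=> a b [t tl h] e; exists t => //.
  exact: large_mean_saturated (sl _ tl) _ _ h e.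
rewrite W'E; split; first exact: measurableU.
  by move=> a [/WU|/VWU].
rewrite Rintegral_setU//.
- rewrite addr_ge0// (large_mean_integral s0)//.
  move=> a b [Va Wa] e; split; first exact: large_mean_saturated _ _ _ _ Va e.
  by apply: contra_not Wa => Wb; apply: sW Wb _.
- by apply: fqi; [exact: measurableU|move=> a [/WU|/VWU]].
- by apply/disj_setPS => a [Wa [_ /(_ Wa)]].
Qed.

Lemma large_mean_all :
  let V : set (measurableTypeR R) :=
    \bigcup_(n in [set n | 0 < (rational_nth n : R)]) large_mean (rational_nth n) in
  [/\ measurable V, V `<=` U & 0 <= \int[mu0]_(x in V) (f x - q)].
Proof.
move=> V.
have mV : measurable V.
  by apply: bigcup_measurable => n /= /ltW; exact: large_mean_measurable.
have VU : V `<=` U by move=> a [n /= /ltW n0]; exact: large_mean_sub.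
split => //.
(* The positive ones among the first [N] rationals, in increasing order; as [N] grows, the finite
   unions exhaust [V] and their integrals converge. *)
pose l N := sort <=%O [seq t <- [seq (rational_nth n : R) | n <- iota 0 N] | 0 < t].
have lP N : [/\ measurable [set a | exists2 t, t \in l N & large_mean t a],
    [set a | exists2 t, t \in l N & large_mean t a] `<=` U &
    0 <= \int[mu0]_(x in [set a | exists2 t, t \in l N & large_mean t a]) (f x - q)].
  apply: large_mean_bigcup; first exact: sort_sorted le_total _.
  by move=> t; rewrite mem_sort mem_filter => /andP[/ltW].
pose D : set (measurableTypeR R) := `[lo, hi]%classic.
have UD : U `<=` D by apply: subset_trans Ub _; exact: subset_itv_oo_cc.
apply: (@cvgr_to_ge _ \oo _ R
    (fun N => \int[mu0]_(x in [set a | exists2 t, t \in l N & large_mean t a]) (f x - q))).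
  apply: (@cvg_Rintegral_set _ _ _ mu0 _ D) => //.
  - exact: measurable_itv.
  - by move=> N; have [] := lP N.
  - by apply: subset_trans UD.
  - by move=> N; have [_ h _] := lP N; apply: subset_trans UD.
  - exact: (locint_integrable lfq _ (@subset_refl _ _)).
  - move=> a _; have [[n /= n0 h]|nV] := pselect (V a).
      near=> N; split => _; first by exists n.
      exists (rational_nth n) => //; rewrite mem_sort mem_filter n0/=.
      apply/mapP; exists n => //; rewrite mem_iota/= add0n.
      by near: N; exact: nbhs_infty_gt.
    apply: nearW => N; split => // -[t]; rewrite mem_sort mem_filter.
    by move=> /andP[t0 /mapP[n _ tn]] h; case: nV; exists n; rewrite /= -tn.
by apply: nearW => N; have [] := lP N.
Unshelve. all: by end_near.
Qed.

End maximal.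

End differentiation.

(** * The initial trace of the velocity *)

Section initial_trace.
Context {R : realType} {mu0 : {measure set (measurableTypeR R) -> \bar R}}
  {u0 : R -> R} {phi : R -> R -> R -> R}.
Hypothesis adm : admissible mu0 u0.
Hypothesis fl : sticky_flow mu0 u0 phi.
Local Notation lft := (left_end phi).
Local Notation rgt := (right_end phi).
Local Notation pos := (phi 0).
Local Notation tau := (shock_time mu0 u0 phi).
Local Notation cmean := (cluster_mean mu0 phi).
Implicit Types t s x y a b c p q : R.

(* If [b < a] shared all positive times, then, by the hull inequalities on both
   sides of the midpoint, a positive constant would be bounded by [t K]. *)
Lemma initially_separated_lt a b : b < a -> exists2 t, 0 < t & pos t b != pos t a.
Proof.
move=> ba; apply: contrapT => h.
have same t : 0 < t -> pos t b = pos t a.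
  by move=> t0; apply: contrapT => /eqP ne; apply: h; exists t.
have rad := adm_radon adm; have supp := adm_support adm.
have lu := adm_integrable adm.
pose y := (a + b) / 2; pose L := lft 1 a; pose S := rgt 1 a.
pose D : set (measurableTypeR R) := `[L, S]%classic.
have mD : measurable D by exact: measurable_itv.
have [Lb aS] : L <= b /\ a <= S.
  have /(clusterP fl _ _ ler01)/andP[-> _] := same 1 ltr01.
  by rewrite /S (right_end_ge fl).
have by_ : b < y by rewrite /y; lra.
have ya : y < a by rewrite /y; lra.
have sub (A : set R) : A `<=` D -> A `<=` `[L, S] by [].
have uD : mu0.-integrable D (EFin \o u0) by exact: locint_integrable lu mD (@subset_refl _ _).
pose K := \int[mu0]_(c in D) `|u0 c|.
have K0 : 0 <= K by exact: Rintegral_ge0.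
have Kb (A : set (measurableTypeR R)) : measurable A -> A `<=` D ->
    `|\int[mu0]_(c in A) u0 c| <= K.
  move=> mA AD; have uA : mu0.-integrable A (EFin \o u0) by exact: integrableS uD.
  apply: le_trans (le_normr_Rintegral mA uA) _; rewrite /K /Rintegral fine_le//.
  - by apply: integrable_fin_num => //; exact: (integrable_norm uA).
  - by apply: integrable_fin_num => //; exact: (integrable_norm uD).
  apply: ge0_subset_integral => //.
  by apply/measurable_EFinP; apply: measurableT_comp => //; apply/measurable_EFinP; exact: measurable_int uD.
have lc k : locally_mu_integrable mu0 (fun c => c - k).
  exact: locintD (locint_id rad) (locint_cst rad (- k)).
have lc' k : locally_mu_integrable mu0 (fun c => k + -1 * c).
  exact: locintD (locint_cst rad k) (locintZ _ (locint_id rad)).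
(* First moments about the midpoint of the two halves of [[b, a]]: they do not depend on time, and
   are positive by full support. *)
pose m1 := \int[mu0]_(c in `[b, y]) (y + -1 * c).
pose m2 := \int[mu0]_(c in `[y, a]) (c - y).
have m1pos : 0 < m1.
  apply: (Rintegral_gt0 supp (a := b) (b := y) by_ (lc' y)) => //.
  - by move=> x; exact: subset_itv_oo_cc.
  - by move=> x /=; rewrite in_itv /= => /andP[_ xy]; lra.
  - by move=> x /=; rewrite in_itv /= => /andP[_ xy]; lra.
have m2pos : 0 < m2.
  apply: (Rintegral_gt0 supp (a := y) (b := a) ya (lc y)) => //.
  - by move=> x; exact: subset_itv_oo_cc.
  - by move=> x /=; rewrite in_itv /= => /andP[xy _]; lra.
  - by move=> x /=; rewrite in_itv /= => /andP[xy _]; lra.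
pose m := Num.min m1 m2.
have m0 : 0 < m by rewrite lt_min m1pos m2pos.
have K1 : 0 < K + 1 by lra.
(* The bound by 1 keeps the cluster inside [D]; the other gives [t * K < m], the denominator being
   positive even if [K] vanishes. *)
pose t := Num.min 1 (m / (K + 1)).
have t0 : 0 < t by rewrite lt_min ltr01 divr_gt0.
have t0' := ltW t0.
have t1 : t <= 1 by rewrite ge_min lexx.
have tK : t * K < m.
  have : t * (K + 1) <= m by rewrite -ler_pdivlMr// ge_min lexx orbT.
  by rewrite mulrDr mulr1; move: t0; lra.
have [lb ar] : lft t a <= b /\ a <= rgt t a.
  have /(clusterP fl _ _ t0')/andP[-> _] := same t t0.
  by rewrite (right_end_ge fl).
have Ll : L <= lft t a by exact: (left_end_time fl _ t0' t1).
have rS : rgt t a <= S by exact: (right_end_time fl _ t0' t1).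
have yin : lft t a <= y <= rgt t a by apply/andP; split; lra.
have sublft : `[lft t a, y] `<=` D.
  by move=> x; rewrite /D /= !in_itv /= => /andP[? ?]; apply/andP; split; lra.
have subrgt : `[y, rgt t a] `<=` D.
  by move=> x; rewrite /D /= !in_itv /= => /andP[? ?]; apply/andP; split; lra.
have intD (A : set (measurableTypeR R)) f : measurable A -> A `<=` D ->
    locally_mu_integrable mu0 f -> mu0.-integrable A (EFin \o f).
  by move=> mA AD lf; exact: locint_integrable lf mA AD.
have split_free (A : set (measurableTypeR R)) : measurable A -> A `<=` D ->
    \int[mu0]_(c in A) (c + t * u0 c - pos t a) =
    \int[mu0]_(c in A) (c - pos t a) + t * \int[mu0]_(c in A) u0 c.
  move=> mA AD; rewrite -RintegralZl//; last exact: intD.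
  rewrite -RintegralD//; [|exact: intD|by apply: intD => //; exact: locintZ].
  by apply: eq_Rintegral => c _; ring.
have tKb (A : set (measurableTypeR R)) : measurable A -> A `<=` D ->
    `|t * \int[mu0]_(c in A) u0 c| < m.
  move=> mA AD; rewrite normrM (ger0_norm t0'); apply: le_lt_trans tK.
  by rewrite ler_pM2l//; exact: Kb.
(* The half of the cluster beyond [y], seen from the common position, has a moment of at least [m]
   about it, which the term in [t * u0] cannot compensate. *)
have [yx|xy] := leP y (pos t a).
  have := hull_left adm fl t0' yin; rewrite split_free//.
  have := tKb _ (measurable_itv `[lft t a, y]) sublft; rewrite ltr_norml => /andP[_ h1] h2.
  have : m1 <= - \int[mu0]_(c in `[lft t a, y]) (c - pos t a).
    rewrite -mulN1r -RintegralZl//; last by apply: intD.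
    apply: (@le_trans _ _ (\int[mu0]_(c in `[lft t a, y]) (y + -1 * c))).
      rewrite /m1 /Rintegral fine_le//.
      + by apply: integrable_fin_num => //; apply: intD => //; apply: subset_trans sublft => x; rewrite /= !in_itv /= => /andP[? ->]; rewrite andbT; lra.
      + by apply: integrable_fin_num => //; exact: intD.
      apply: ge0_subset_integral => //.
      + by apply: measurable_int; apply: intD; last exact: (lc' y).
      + by move=> x /=; rewrite in_itv /= lee_fin => /andP[_ ?]; lra.
      + by move=> x; rewrite /= !in_itv /= => /andP[? ->]; rewrite andbT; lra.
    apply: le_Rintegral => //; [exact: intD|by apply: intD => //; exact: locintZ|].
    by move=> x _; lra.
  have : m <= m1 by rewrite ge_min lexx.
  by lra.
have := hull_right adm fl t0' yin; rewrite split_free//.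
have := tKb _ (measurable_itv `[y, rgt t a]) subrgt; rewrite ltr_norml => /andP[h1 _] h2.
have : m2 <= \int[mu0]_(c in `[y, rgt t a]) (c - pos t a).
  apply: (@le_trans _ _ (\int[mu0]_(c in `[y, rgt t a]) (c - y))).
    rewrite /m2 /Rintegral fine_le//.
    + by apply: integrable_fin_num => //; apply: intD => //; apply: subset_trans subrgt => x; rewrite /= !in_itv /= => /andP[-> ?]; lra.
    + by apply: integrable_fin_num => //; exact: intD.
    apply: ge0_subset_integral => //.
    + by apply: measurable_int; apply: intD; last exact: (lc y).
    + by move=> x /=; rewrite in_itv /= lee_fin => /andP[? _]; lra.
    + by move=> x; rewrite /= !in_itv /= => /andP[-> ?]; lra.
  apply: le_Rintegral => //; [exact: intD|exact: intD|].
  by move=> x _; lra.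
have : m <= m2 by rewrite ge_min lexx orbT.
by lra.
Qed.

Lemma initially_separated a b : a != b -> exists2 t, 0 < t & pos t b != pos t a.
Proof.
rewrite neq_lt => /orP[/initially_separated_lt[t t0 ne]|]; last exact: initially_separated_lt.
by exists t; rewrite // eq_sym.
Qed.

(** Clusters are intervals, so it is enough to keep [a - e] and [a + e] out; once apart from [a] at
    some positive time, they are apart at all earlier times. *)
Lemma cluster_shrinks a (U : set R) : open U -> U a ->
  exists2 d, 0 < d & forall t, 0 < t -> t < d -> `[lft t a, rgt t a] `<=` U.
Proof.
move=> oU Ua; have [e e0 aeU] : exists2 e, 0 < e & `](a - e), (a + e)[%classic `<=` U.
  have := open_itvoo_subset oU Ua => -[e /= e0 h].
  exists (e / 2); first by rewrite divr_gt0.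
  apply: h => /=; last by rewrite divr_gt0.
  by rewrite sub0r normrN gtr0_norm ?divr_gt0//; lra.
have [|s s0 sep1] := @initially_separated a (a - e); first by rewrite gt_eqF// gtrBl.
have [|r r0 sep2] := @initially_separated a (a + e); first by rewrite lt_eqF// ltrDl.
exists (Num.min s r); first by rewrite lt_min s0 r0.
move=> t t0; rewrite lt_min => /andP[ts tr] x; rewrite /= in_itv /= => /andP[lx xr].
have t0' := ltW t0; apply: aeU; rewrite /= in_itv /=; apply/andP; split.
  rewrite ltNge; apply/negP => xa; move: sep1; apply/negP; rewrite negbK; apply/eqP.
  apply: (pos_eq_le fl t0' (ltW ts)); apply/(clusterP fl _ _ t0').
  by rewrite (le_trans lx xa) (le_trans _ (right_end_ge fl a t0'))// gerBl ltW.
rewrite ltNge; apply/negP => xa; move: sep2; apply/negP; rewrite negbK; apply/eqP.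
apply: (pos_eq_le fl t0' (ltW tr)); apply/(clusterP fl _ _ t0').
by rewrite (le_trans xa xr) (le_trans (left_end_le fl a t0'))// lerDl ltW.
Qed.

(** The particles where the means exceed [f] by a fixed gap at arbitrarily small times, restricted
    to rational times for measurability and to a bounded window for finiteness. The condition on
    [tau a] makes every cluster of [a] at a positive time nontrivial, as [large_mean] demands. *)
Let frequently_large (f : R -> R) n p q : set (measurableTypeR R) :=
  [set a | [/\ `]-(n%:R), n%:R[%classic a, (tau a <= 0%:E)%E, f a < p &
    forall k, exists j, 0 < (rational_nth j : R) < harmonic k /\
      q < cmean f (rational_nth j) a]].

(** In an open [U] containing [N] with little of [|f - q|] outside [N], the clusters of large mean
    cover [N], because clusters shrink. Then [0 <= \int (f - q)] over their union, which is at most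
    [(p - q) * mu0 N + e]. *)
Lemma frequently_large_negligible (f : R -> R) n p q :
  locally_mu_integrable mu0 f -> p < q -> mu0.-negligible (frequently_large f n p q).
Proof.
move=> lf pq; set N := frequently_large f n p q.
have [mf _] := lf.
have mN : measurable N.
  rewrite (_ : N = `]-(n%:R), n%:R[%classic `&` ([set a | (tau a <= 0%:E)%E] `&`
    (f @^-1` `]-oo, p[ `&` \bigcap_k \bigcup_(j in [set j | 0 < (rational_nth j : R) < harmonic k])
       (cmean f (rational_nth j)) @^-1` `]q, +oo[))).
    apply: measurableI; first exact: measurable_itv.
    apply: measurableI; first exact: (measurable_shock_time_le adm fl).
    apply: measurableI; first by rewrite -[_ @^-1` _]setTI; apply: mf.
    apply: bigcapT_measurable => k; apply: bigcup_measurable => j /= /andP[j0 _].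
    rewrite -[_ @^-1` _]setTI; apply: (measurable_cluster_mean fl (ltW j0) mf) => //.
  apply/seteqP; split => a.
    move=> [an ta fp h]; split => //; split => //; split; first by rewrite /preimage /= in_itv.
    by move=> k _; have [j [j0 qj]] := h k; exists j => //; rewrite /= in_itv /= andbT.
  move=> [an [ta [+ h]]]; rewrite /= in_itv /= => fp; split => // k.
  by have [j j0 +] := h k I; rewrite /= in_itv /= andbT => qj; exists j.
exists N; split => //.
have Nab : N `<=` `](-(n%:R)), n%:R[ by move=> a [].
have Nfin : mu0 N \is a fin_num.
  apply: (radon_fin_num (adm_radon adm) mN (a := -(n%:R)) (b := n%:R)).
  by apply: subset_trans Nab _; exact: subset_itv_oo_cc.
suff h e : 0 < e -> (q - p) * fine (mu0 N) <= e.
  rewrite -(fineK Nfin); congr EFin; apply/le_anti.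
  rewrite fine_ge0// andbT -(pmulr_rle0 _ (_ : 0 < q - p)) ?subr_gt0//.
  by apply/ler_addgt0Pr => e e0; rewrite add0r; exact: h.
move=> e0; have rad := adm_radon adm.
have lfq : locally_mu_integrable mu0 (fun x => f x - q).
  exact: locintD lf (locint_cst rad (- q)).
have [U [oU NU Un small]] := locint_outer_approx adm lfq mN Nab e0.
have [mV VU V0] := large_mean_all adm fl q lf Un.
set V := \bigcup_(_ in _) _ in mV VU V0.
have NV : N `<=` V.
  move=> a Na; have [_ ta fp fr] := Na.
  have [dl dl0 dlU] := cluster_shrinks oU (NU _ Na).
  have [k kd] : exists k, harmonic k < dl :> R.
    have [M _ /(_ M (leqnn M)) ?] := @cvgr_lt _ _ _ _ _ _ (@cvg_harmonic R) _ dl0.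
    by exists M.
  have [j [/andP[j0 jk] qj]] := fr k; exists j => //; split => //.
    have tj : (tau a < (rational_nth j)%:E)%E by rewrite (le_lt_trans ta)// lte_fin.
    by have [] := shock_time_lt adm fl tj.
  exact: dlU (lt_trans jk kd).
have Uab : U `<=` `[-(n%:R), n%:R].
  by apply: subset_trans Un _; exact: subset_itv_oo_cc.
have mU : measurable (U : set (measurableTypeR R)) by exact: open_measurable.
have intU (A : set (measurableTypeR R)) g : measurable A -> A `<=` U ->
    locally_mu_integrable mu0 g -> mu0.-integrable A (EFin \o g).
  by move=> mA AU lg; apply: (locint_integrable lg mA (subset_trans AU Uab)).
have mVN : measurable (V `\` N : set (measurableTypeR R)) by exact: measurableD.
have mUN : measurable (U `\` N : set (measurableTypeR R)) by exact: measurableD.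
have VE : V = N `|` (V `\` N) by rewrite setDUK.
move: V0; rewrite VE Rintegral_setU//; last 2 first.
- by rewrite -VE; exact: intU.
- by apply/disj_setPS => a [Na [_ /(_ Na)]].
have hN : \int[mu0]_(x in N) (f x - q) <= (p - q) * fine (mu0 N).
  rewrite -Rintegral_cst//; apply: le_Rintegral => //.
  - by apply: intU.
  - by apply: intU => //; exact: locint_cst.
  - by move=> x [_ _ /ltW fx _]; rewrite lerD2r.
have hVN : \int[mu0]_(x in V `\` N) (f x - q) <= e.
  have iVN : mu0.-integrable (V `\` N) (EFin \o (fun x => f x - q)).
    by apply: intU => //; move=> a [/VU].
  have iUN : mu0.-integrable (U `\` N) (EFin \o (fun x => f x - q)).
    by apply: intU => // a [].
  apply: (le_trans (ler_norm _)); apply: (le_trans (le_normr_Rintegral mVN iVN)).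
  apply: le_trans (ltW small); rewrite /Rintegral fine_le//.
  - by apply: integrable_fin_num => //; exact: (integrable_norm iVN).
  - by apply: integrable_fin_num => //; exact: (integrable_norm iUN).
  apply: ge0_subset_integral => //.
  - by apply: measurable_int; exact: (integrable_norm iUN).
  - by move=> a [/VU Ua Na].
move=> V0; have := le_trans V0 (lerD hN hVN).
by rewrite -(opprB q p) mulNr addrC subr_ge0.
Qed.

(** Rational times control all of them: by right continuity a mean too large at [t] is still too
    large at a rational time just after [t]. *)
Let not_frequently_large (f : R -> R) a e :
  (tau a <= 0%:E)%E -> 0 < e ->
  (forall t, 0 < t -> cmean f s a @[s --> t^'+] --> cmean f t a) ->
  (forall n i j, (rational_nth i : R) < rational_nth j ->
    ~ frequently_large f n (rational_nth i) (rational_nth j) a) ->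
  \forall t \near 0^'+, cmean f t a < f a + e.
Proof.
move=> ta e0 rc nf.
have [j /andP[fj je]] : exists j, f a < rational_nth j < f a + e.
  by apply: rational_nth_dense; rewrite ltrDl.
have [i /andP[fi ij]] := rational_nth_dense fj.
pose n := (Num.truncn `|a|).+1.
have an : `]-(n%:R), n%:R[%classic a.
  by rewrite /= in_itv /= -ltr_norml; exact: truncnS_gt.
have [k hk] : exists k, forall l, 0 < (rational_nth l : R) < harmonic k ->
    cmean f (rational_nth l) a <= rational_nth j.
  apply: contrapT => h; apply: (nf n i j ij); split => // k.
  apply: contrapT => h2; apply: h; exists k => l lk; rewrite leNgt; apply/negP => jl.
  by apply: h2; exists l.
near=> t; apply: le_lt_trans je; rewrite leNgt; apply/negP => jt.
have t0 : 0 < t by near: t; exact: nbhs_right_gt.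
have tk : t < harmonic k.
  by near: t; apply: nbhs_right_lt; rewrite /harmonic invr_gt0.
have [d /= d0 dP] : \forall s \near t^'+, rational_nth j < cmean f s a.
  exact: (cvgr_gt _ (rc t t0) _ jt).
have [l /andP[tl lm]] : exists l, t < rational_nth l < Num.min (harmonic k) (t + d).
  by apply: rational_nth_dense; rewrite lt_min tk ltrDl.
move: lm; rewrite lt_min => /andP[lk ld].
have := hk l; rewrite (lt_trans t0 tl) lk => /(_ isT); rewrite leNgt.
by rewrite dP//= ltr0_norm ?subr_lt0// opprB ltrBlDl.
Unshelve. all: by end_near.
Qed.

Lemma cluster_meanN (f : R -> R) t a : locally_mu_integrable mu0 f ->
  cmean (fun x => -1 * f x) t a = - cmean f t a.
Proof.
move=> lf; rewrite /cluster_mean; case: ifP => _; last by rewrite mulN1r.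
rewrite /mean RintegralZl//; first by rewrite mulrCA mulN1r.
exact: (locint_integrable lf _ (@subset_refl _ _)).
Qed.

(** The upper bound is applied to [u0] and to its opposite; the exceptional set is a countable union
    over windows and pairs of rationals. *)
Lemma initial_velocity_ae :
  {ae mu0, forall a, tau a = 0%:E -> cmean u0 t a @[t --> 0^'+] --> u0 a}.
Proof.
have lu := adm_integrable adm; have luN := locintZ (-1) lu.
pose bad f : set (measurableTypeR R) := \bigcup_n \bigcup_i \bigcup_j
  (if (rational_nth i : R) < rational_nth j
   then frequently_large f n (rational_nth i) (rational_nth j) else set0).
have bad0 f : locally_mu_integrable mu0 f -> mu0.-negligible (bad f).
  move=> lf; do 3 apply: negligible_bigcup => ?.
  by case: ifP => h; [exact: frequently_large_negligible|exact: negligible_set0].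
apply: (@negligibleS _ _ _ mu0 (bad u0 `|` bad (fun x => -1 * u0 x))); last first.
  by apply: negligibleU; exact: bad0.
move=> a /= h; apply: contrapT => nbad; apply: h => ta.
have good f : ~ bad f a -> forall n i j, (rational_nth i : R) < rational_nth j ->
    ~ frequently_large f n (rational_nth i) (rational_nth j) a.
  by move=> nb n i j ij fa; apply: nb; exists n => //; exists i => //; exists j => //; rewrite ij.
have ta0 : (tau a <= 0%:E)%E by rewrite ta.
have rc t : 0 < t -> cmean u0 s a @[s --> t^'+] --> cmean u0 t a.
  exact: cluster_mean_cvg_right.
apply/cvgrPdist_lt => e e0.
have up := not_frequently_large ta0 e0 rc (good u0 (fun h => nbad (or_introl h))).
have down : \forall t \near 0^'+, cmean (fun x => -1 * u0 x) t a < -1 * u0 a + e.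
  apply: (not_frequently_large ta0 e0 _ (good _ (fun h => nbad (or_intror h)))).
  move=> t t0; rewrite cluster_meanN//; under eq_cvg do rewrite cluster_meanN//.
  by apply: cvgN; exact: rc.
apply: filterS2 up down => t h1; rewrite cluster_meanN// => h2.
by rewrite ltr_norml; apply/andP; split; lra.
Qed.

End initial_trace.

(** * Conditional expectations *)

Section conditional_expectation.
Context {R : realType} {d} {T : measurableType d}.
Variable P : {measure set T -> \bar R}.
Implicit Types (G : set (set T)) (Y M : T -> R).

(** On each of the two sets where [g] keeps its sign, the integral of [|g|] is the absolute value of
    the integral of [g], hence of that of [f]. *)
Lemma integral_abs_le (f g : T -> R) (F N : set T) :
  measurable F -> measurable N -> N `<=` F ->
  P.-integrable F (EFin \o f) -> measurable_fun F g ->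
  (forall x, (F `\` N) x -> 0 <= g x) -> (forall x, N x -> g x <= 0) ->
  (\int[P]_(x in F `\` N) (g x)%:E = \int[P]_(x in F `\` N) (f x)%:E)%E ->
  (\int[P]_(x in N) (g x)%:E = \int[P]_(x in N) (f x)%:E)%E ->
  (\int[P]_(x in F) `|(g x)%:E| <= \int[P]_(x in F) `|(f x)%:E|)%E.
Proof.
move=> mF mN NF fi mg gp gn ep en.
have mFN : measurable (F `\` N) by exact: measurableD.
have FE : F = (F `\` N) `|` N by rewrite setUC setDUK.
have dis : [disjoint F `\` N & N] by apply/disj_setPS => x [[_ Nx]].
have mf : measurable_fun F (EFin \o f) := measurable_int P fi.
have part (A : set T) : measurable A -> A `<=` F ->
    (`|\int[P]_(x in A) (g x)%:E| <= \int[P]_(x in A) `|(f x)%:E| ->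
     \int[P]_(x in A) `|(g x)%:E| = `|\int[P]_(x in A) (g x)%:E| ->
     \int[P]_(x in A) `|(g x)%:E| <= \int[P]_(x in A) `|(f x)%:E|)%E.
  by move=> mA AF h ->.
have abs (A : set T) : measurable A -> A `<=` F ->
    (\int[P]_(x in A) (g x)%:E = \int[P]_(x in A) (f x)%:E)%E ->
    (`|\int[P]_(x in A) (g x)%:E| <= \int[P]_(x in A) `|(f x)%:E|)%E.
  move=> mA AF ->; apply: le_abse_integral => //.
  exact: measurable_funS mf.
rewrite FE !ge0_integral_setU//; last 2 first.
- by rewrite -FE; exact: measurableT_comp.
- by rewrite -FE; apply: measurableT_comp => //; exact/measurable_EFinP.
apply: leeD.
  apply: part => //; first exact: abs.
  rewrite gee0_abs; last by apply: integral_ge0 => x /gp; rewrite lee_fin.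
  by apply: eq_integral => x; rewrite inE => /gp g0; rewrite gee0_abs// lee_fin.
apply: part => //; first exact: abs.
have nE : (\int[P]_(x in N) `|(g x)%:E| = - \int[P]_(x in N) (g x)%:E)%E.
  rewrite -[LHS]oppeK -integral_ge0N; last by move=> x _; exact: abse_ge0.
  congr (- _)%E; apply: eq_integral => x; rewrite inE => /gn g0.
  by rewrite lee0_abs ?lee_fin// oppeK.
rewrite nE lee0_abs// -oppe_ge0 -nE.
by apply: integral_ge0 => x _; exact: abse_ge0.
Qed.

Section sub_sigma_algebra_closure.
Variable G : set (set T).
Hypothesis sG : Defs.sub_sigma_algebra G.

Let GE : @measurable _ (g_sigma_algebraType G) = G.
Proof. by rewrite /measurable/=; apply: sigma_algebra_id; case: sG. Qed.

Lemma sub_sigmaT : G setT.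
Proof. by rewrite -GE; exact: measurableT. Qed.

Lemma sub_sigmaI (A B : set T) : G A -> G B -> G (A `&` B).
Proof. by rewrite -GE; exact: measurableI. Qed.

Lemma sub_sigmaD (A B : set T) : G A -> G B -> G (A `\` B).
Proof. by rewrite -GE; exact: measurableD. Qed.

Lemma sub_sigmaC (A : set T) : G A -> G (~` A).
Proof. by rewrite -GE; exact: measurableC. Qed.

Lemma sub_sigma_seqDU (F : (set T)^nat) n : (forall k, G (F k)) -> G (seqDU F n).
Proof.
rewrite -GE => mF; apply: measurableD => //.
by apply: bigsetU_measurable => i _.
Qed.

Lemma measurable_wrt_preimage Y (B : set (measurableTypeR R)) :
  measurable_wrt G Y -> measurable B -> G (Y @^-1` B).
Proof. by move=> mY mB; apply: mY; exists B => //; rewrite setTI. Qed.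

Lemma measurable_wrt_measurable Y : measurable_wrt G Y ->
  measurable_fun setT (Y : _ -> measurableTypeR R).
Proof.
by move=> mY _ B mB; rewrite setTI; apply: sG.2; exact: measurable_wrt_preimage.
Qed.

Lemma measurable_wrt_indic B : G B -> measurable_wrt G (\1_B : T -> R).
Proof.
move=> GB _ [D mD <-]; rewrite setTI preimage_indic.
have G0 : G set0 by rewrite -(setCT) ; exact: sub_sigmaC sub_sigmaT.
by case: ifP => _; case: ifP => _ //; [exact: sub_sigmaT|exact: sub_sigmaC].
Qed.

(** Integrals need comparing only inside the sets of one cover, and no integrability of [M] is
    assumed: cutting at the sign of [M], which is an event of [G], bounds [|M|] by [|Y|] in integral
    on each piece. *)
Lemma is_cond_exp_cover Y M (F : (set T)^nat) :
  (\bigcup_n F n = setT) -> (forall n, G (F n)) ->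
  (forall n, P.-integrable (F n) (EFin \o Y)) -> measurable_wrt G M ->
  (forall n A, G A -> A `<=` F n ->
     (\int[P]_(w in A) (M w)%:E = \int[P]_(w in A) (Y w)%:E)%E) ->
  is_cond_exp P G Y M.
Proof.
move=> UF GF Fi mM FE; split => //; first by exists F.
move=> A GA Ai; pose B n := A `&` seqDU F n.
have GB n : G (B n) by apply: sub_sigmaI => //; exact: sub_sigma_seqDU.
have mB n : measurable (B n) by exact: sG.2.
have BF n : B n `<=` F n by move=> x [_ []].
have mMT := measurable_wrt_measurable mM.
have UB : \bigcup_n B n = A by rewrite -setI_bigcupr -seqDU_bigcup_eq UF setIT.
have Bi n : P.-integrable (B n) (EFin \o Y).
  by apply: integrableS Ai => //; [exact: sG.2|move=> x []].
have mMB n : measurable_fun (B n) M by exact: measurable_funTS.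
have BE n : (\int[P]_(w in B n) (M w)%:E = \int[P]_(w in B n) (Y w)%:E)%E.
  exact: FE (GB n) (BF n).
have := integral_bigcup_averaged mB _ _ mMB _ BE.
rewrite UB; apply => //; first exact: trivIset_setIl (@trivIset_seqDU _ _).
move=> n; pose N := B n `&` M @^-1` `]-oo, 0[.
have GN : G N by apply: sub_sigmaI => //; exact: measurable_wrt_preimage.
have NB : N `<=` B n by exact: subIsetl.
have GBN : G (B n `\` N) by exact: sub_sigmaD.
apply: (integral_abs_le (N := N)) => //.
- exact: sG.2.
- move=> x [Bx Nx]; rewrite leNgt; apply/negP => M0; apply: Nx.
  by split => //; rewrite /= in_itv.
- by move=> x [_]; rewrite /= in_itv /= => /ltW.
- by apply: (FE n) => // x [/BF].
- by apply: (FE n) => // x /NB/BF.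
Qed.

Lemma is_cond_exp_self Y (F : (set T)^nat) :
  (\bigcup_n F n = setT) -> (forall n, G (F n)) ->
  (forall n, P.-integrable (F n) (EFin \o Y)) -> measurable_wrt G Y ->
  is_cond_exp P G Y Y.
Proof. by move=> UF GF Fi mY; exact: (@is_cond_exp_cover Y Y F). Qed.

End sub_sigma_algebra_closure.

Lemma is_cond_exp_tower G1 G2 Y M1 M2 : G2 `<=` G1 ->
  is_cond_exp P G1 Y M1 -> is_cond_exp P G2 Y M2 -> is_cond_exp P G2 M1 M2.
Proof.
move=> G21 [sG1 _ mM1 M1E] [sG2 [F UF GF] mM2 M2E].
apply: (is_cond_exp_cover sG2 UF) => //.
- by move=> n; have [] := GF n.
- by move=> n; have [GFn /M1E[]//] := GF n; exact: G21.
- move=> n A GA AF; have [GFn Yi] := GF n.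
  have Ai : P.-integrable A (EFin \o Y).
    by apply: integrableS AF Yi; [exact: sG2.2|exact: sG2.2].
  by have [_ ->] := M2E _ GA Ai; have [_ ->] := M1E _ (G21 _ GA) Ai.
Qed.

End conditional_expectation.

(** * Conditional densities on a piece of finite mass *)

Section image_of_restriction.
Context {R : realType} d1 d2 (T : measurableType d1) (S : measurableType d2).
Variables (P : {measure set T -> \bar R}) (Z : T -> S) (B : set S) (Y : T -> R).
Hypothesis mZ : measurable_fun setT Z.
Hypothesis mB : measurable B.
Hypothesis PB : (P (Z @^-1` B) < +oo)%E.
Hypothesis Yi : P.-integrable (Z @^-1` B) (EFin \o Y).

Let mpre (E : set S) : measurable E -> measurable (Z @^-1` E).
Proof. by move=> mE; rewrite -[_ @^-1` _]setTI; exact: mZ. Qed.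

(** The law of [Z] cut down to [B], which makes it finite, as the Radon-Nikodym theorem asks here;
    [image_charge] is cut down likewise to where [Y] is integrable. *)
Let image_measure (E : set S) : \bar R := P (Z @^-1` (E `&` B)).

Let image_measure0 : image_measure set0 = 0%E.
Proof. by rewrite /image_measure set0I preimage_set0 measure0. Qed.

Let image_measure_ge0 E : (0 <= image_measure E)%E.
Proof. exact: measure_ge0. Qed.

Let image_measure_sigma_additive : semi_sigma_additive image_measure.
Proof.
move=> F mF tF mUF; rewrite /image_measure setI_bigcupl preimage_bigcup.
apply: measure_semi_sigma_additive.
- by move=> n; apply: mpre; exact: measurableI.
- apply/trivIsetP => /= i j _ _ ij; rewrite -preimage_setI setIACA.
  by move/trivIsetP : tF => /(_ _ _ I I ij) ->; rewrite set0I preimage_set0.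
- rewrite -preimage_bigcup -setI_bigcupl; apply: mpre; exact: measurableI.
Qed.

Let image_charge (E : set S) : \bar R := (\int[P]_(w in Z @^-1` (E `&` B)) (Y w)%:E)%E.

Let image_charge0 : image_charge set0 = 0%E.
Proof. by rewrite /image_charge set0I preimage_set0 integral_set0. Qed.

Let image_charge_finite E : measurable E -> image_charge E \is a fin_num.
Proof.
move=> mE; have mEB : measurable (Z @^-1` (E `&` B)) by apply: mpre; exact: measurableI.
apply: integrable_fin_num => //; apply: integrableS Yi => //; first exact: mpre.
by move=> w [].
Qed.

Let image_charge_sigma_additive : semi_sigma_additive image_charge.
Proof.
have gi := integrable_patch (mpre mB) Yi.
have chargeE (E : set S) : image_charge E = induced_charge gi (Z @^-1` (E `&` B)).
  rewrite /image_charge /induced_charge; apply: eq_integral => w; rewrite inE => -[_ Bw].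
  by rewrite /= patchE mem_set.
move=> F mF tF mUF; rewrite chargeE; under eq_fun do under eq_bigr do rewrite chargeE.
rewrite setI_bigcupl preimage_bigcup.
apply: charge_semi_sigma_additive.
- by move=> n; apply: mpre; exact: measurableI.
- apply/trivIsetP => /= i j _ _ ij; rewrite -preimage_setI setIACA.
  by move/trivIsetP : tF => /(_ _ _ I I ij) ->; rewrite set0I preimage_set0.
- rewrite -preimage_bigcup -setI_bigcupl; apply: mpre; exact: measurableI.
Qed.

Let image_measure_fin : fin_num_fun image_measure.
Proof.
move=> E mE; rewrite ge0_fin_numE ?image_measure_ge0//; apply: le_lt_trans PB.
apply: le_measure; rewrite ?inE; [by apply: mpre; exact: measurableI|exact: mpre|].
by move=> w [].
Qed.

HB.instance Definition _ := isMeasure.Build _ _ _ image_measure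
  image_measure0 image_measure_ge0 image_measure_sigma_additive.

HB.instance Definition _ := Measure_isFinite.Build _ _ _ image_measure image_measure_fin.

HB.instance Definition _ := isCharge.Build _ _ _ image_charge
  image_charge0 image_charge_finite image_charge_sigma_additive.

Lemma conditional_density : exists2 c : S -> R, measurable_fun setT c &
  forall E : set S, measurable E -> E `<=` B ->
    (\int[P]_(w in Z @^-1` E) (c (Z w))%:E = \int[P]_(w in Z @^-1` E) (Y w)%:E)%E.
Proof.
have dom : image_charge `<< image_measure.
  apply/null_content_dominatesP => E mE E0.
  apply: null_set_integral => //; first by apply: mpre; exact: measurableI.
  apply: measurable_funS (measurable_int P Yi); first exact: mpre.
  by move=> w [].
pose h := Radon_Nikodym image_charge image_measure.
have hfin x : h x \is a fin_num by exact: Radon_Nikodym_fin_num.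
have hi : image_measure.-integrable setT h by exact: Radon_Nikodym_integrable.
have mh : measurable_fun setT h by exact: measurable_int hi.
exists (fine \o h); first exact: measurableT_comp.
move=> E mE EB; have EBE : E `&` B = E by exact: setIidl.
have imE (A : set S) : measurable A -> A `<=` E -> image_measure A = pushforward P Z A.
  by move=> mA AE; rewrite /image_measure setIidl//; exact: subset_trans AE EB.
transitivity (\int[image_measure]_(x in E) h x)%E; last first.
  by rewrite -Radon_Nikodym_integral//= /image_charge EBE.
have transfer (k : S -> \bar R) :
    (\int[image_measure]_(x in E) k x = \int[pushforward P Z]_(x in E) k x)%E.
  by apply: eq_measure_integral => A mA AE; exact: imE.
have hZi : P.-integrable (Z @^-1` E) (h \o Z).
  apply/integrableP; split.
    by apply: measurable_funTS; exact: measurableT_comp.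
  have /integrableP[_] := integrableS measurableT mE (@subsetT _ E) hi.
  rewrite transfer (ge0_integral_pushforward mZ)//.
  by apply: measurableT_comp => //; exact: measurable_funTS.
rewrite transfer (integral_pushforward mZ)//.
by apply: eq_integral => w _; rewrite /= fineK.
Qed.

End image_of_restriction.

Section conditional_expectation_existence.
Context {R : realType} d (T : measurableType d).
Variables (P : {measure set T -> \bar R}) (Z : T -> R).
Hypothesis mZ : measurable_fun setT (Z : T -> measurableTypeR R).
Local Notation G := (preimage_set_system setT Z (@measurable _ (measurableTypeR R))).

Lemma sub_sigma_preimage : Defs.sub_sigma_algebra G.
Proof.
split; first by apply: sigma_algebra_preimage; exact: sigma_algebra_measurable.
by move=> _ [B mB <-]; exact: mZ.
Qed.

Lemma measurable_wrt_comp (c : R -> R) :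
  measurable_fun [set: measurableTypeR R] (c : _ -> measurableTypeR R) ->
  measurable_wrt G (c \o Z).
Proof.
move=> mc _ [B mB <-]; exists (c @^-1` B); last by rewrite !setTI.
by rewrite -[_ @^-1` _]setTI; exact: mc.
Qed.

Lemma cond_exp_exists (Y : T -> R) (B : (set (measurableTypeR R))^nat) :
  \bigcup_n B n = setT -> (forall n, measurable (B n)) ->
  (forall n, (P (Z @^-1` B n) < +oo)%E) ->
  (forall n, P.-integrable (Z @^-1` B n) (EFin \o Y)) ->
  exists M, is_cond_exp P G Y M.
Proof.
move=> UB mB PB Yi; pose D := seqDU B.
have mD n : measurable (D n).
  by apply: measurableD => //; apply: bigsetU_measurable => i _.
have DB n : D n `<=` B n by move=> x [].
have mpre (E : set (measurableTypeR R)) : measurable E -> measurable (Z @^-1` E).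
  by move=> mE; rewrite -[_ @^-1` _]setTI; exact: mZ.
have PD n : (P (Z @^-1` D n) < +oo)%E.
  apply: le_lt_trans (PB n); apply: le_measure; rewrite ?inE; [exact: mpre|exact: mpre|].
  by move=> w /DB.
have YD n : P.-integrable (Z @^-1` D n) (EFin \o Y).
  by apply: integrableS (Yi n); [exact: mpre|exact: mpre|move=> w /DB].
have /choice[c cP] n : exists c : R -> R,
    measurable_fun [set: measurableTypeR R] (c : _ -> measurableTypeR R) /\
    forall E : set (measurableTypeR R), measurable E -> E `<=` D n ->
    (\int[P]_(w in Z @^-1` E) (c (Z w))%:E = \int[P]_(w in Z @^-1` E) (Y w)%:E)%E.
  by have [c mc cE] := conditional_density mZ (mD n) (PD n) (YD n); exists c.
have UD : \bigcup_n D n = setT by rewrite -seqDU_bigcup_eq.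
have tD : trivIset setT D by exact: trivIset_seqDU.
(* The densities of the pieces are glued: the [D n] partition the line, so [xget] finds the only
   index and never returns its default. *)
pose k x := c (xget 0%N [set n | D n x]) x.
have kE n x : D n x -> k x = c n x.
  move=> Dx; rewrite /k; case: xgetP => [m _ Dm|/(_ n)//].
  by congr (c _ _); apply: tD => //; exists x.
have mk : measurable_fun [set: measurableTypeR R] (k : _ -> measurableTypeR R).
  rewrite -UD; apply/measurable_fun_bigcup => // n.
  apply: (eq_measurable_fun (c n)); first by move=> x; rewrite inE => /kE.
  by apply: measurable_funTS; exact: (cP n).1.
exists (k \o Z); apply: (is_cond_exp_cover sub_sigma_preimage (F := fun n => Z @^-1` D n)).
- by rewrite -preimage_bigcup UD preimage_setT.
- by move=> n; exists (D n) => //; rewrite setTI.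
- exact: YD.
- exact: measurable_wrt_comp.
move=> n _ [E mE <-]; rewrite setTI => ED.
have -> : Z @^-1` E = Z @^-1` (E `&` D n).
  by rewrite preimage_setI; apply/esym/setIidl.
rewrite -(cP n).2//; last exact: measurableI.
by apply: eq_integral => w; rewrite inE => -[_ /kE] /= ->.
Qed.

End conditional_expectation_existence.

(** * Tracked processes *)

Definition tracked {R : realType} {T : Type} (phi : R -> R -> R -> R) (g : R -> R)
    (X0 : T -> R) (t : R) (w : T) : R := phi 0 t (g (X0 w)).

(** This makes [gamma <= t] an event of [Z_t]: the particles of a cluster agree on whether they are
    shocked by [t], and its left end, a monotone function of the position, decides. *)
Definition shocked_at {R : realType} (mu0 : {measure set (measurableTypeR R) -> \bar R})
    (u0 : R -> R) (phi : R -> R -> R -> R) (t : R) : set (measurableTypeR R) :=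
  [set x | (shock_time mu0 u0 phi (alpha phi x t) <= t%:E)%E].

(** The second condition bounds the shock time or makes it infinite. In the first case [X_0] lies in
    a cluster of a bounded time; in the second it is its own representative. *)
Definition shock_cover {R : realType} (mu0 : {measure set (measurableTypeR R) -> \bar R})
    (u0 : R -> R) (phi : R -> R -> R -> R) (t : R) (n : nat) : set (measurableTypeR R) :=
  `[-(n%:R), n%:R]%classic `&`
  ([set x | (shock_time mu0 u0 phi (alpha phi x t) <= n%:R%:E)%E] `|`
   ~` [set x | (shock_time mu0 u0 phi (alpha phi x t) < +oo)%E]).

Section tracked_process.
Context {R : realType} {mu0 : {measure set (measurableTypeR R) -> \bar R}}
  {u0 : R -> R} {phi : R -> R -> R -> R} {d} {T : measurableType d}
  {P : {measure set T -> \bar R}} {X0 : T -> R} {g : R -> R}.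
Hypothesis adm : admissible mu0 u0.
Hypothesis fl : sticky_flow mu0 u0 phi.
Hypothesis mX0 : measurable_fun [set: T] (X0 : T -> measurableTypeR R).
Hypothesis imX0 : forall B : set (measurableTypeR R), measurable B ->
  P (X0 @^-1` B) = mu0 B.
Hypothesis rep : shock_representative mu0 u0 phi g.
Local Notation lft := (left_end phi).
Local Notation rgt := (right_end phi).
Local Notation pos := (phi 0).
Local Notation tau := (shock_time mu0 u0 phi).
Local Notation cmean := (cluster_mean mu0 phi).
Local Notation u := (velocity mu0 u0 phi).
Local Notation Z := (tracked phi g X0).
Local Notation G t := (preimage_set_system setT (Z t) (@measurable _ (measurableTypeR R))).
Local Notation mfun f := (measurable_fun [set: measurableTypeR R] (f : R -> measurableTypeR R)).
Implicit Types t s x y a b c p q : R.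

Lemma tau_rep a : tau (g a) = tau a. Proof. by case: rep. Qed.

Lemma pos_rep t a : (tau a <= t%:E)%E -> pos t (g a) = pos t a.
Proof.
move=> at_; have [_ _ gfin _] := rep.
have [e|s s0 e] := @shock_time_fine _ mu0 u0 phi a; first by move: at_; rewrite e.
by apply: (pos_eq_le fl s0 _ (gfin _ _ e)); rewrite -lee_fin -e.
Qed.

Lemma left_end_rep t a : 0 <= t -> (t%:E < tau a)%E -> alpha phi (pos t (g a)) t = g a.
Proof. by move=> t0 at_; have [] := unshocked adm fl t0 (a := g a); rewrite ?tau_rep. Qed.

Lemma unmerged_rep t a : 0 <= t -> (t%:E < tau a)%E -> u (pos t (g a)) t = u0 (g a).
Proof.
move=> t0 at_; rewrite (velocity_pos fl)// /cluster_mean.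
have [|-> ->] := unshocked adm fl t0 (a := g a); first by rewrite tau_rep.
by rewrite ltxx.
Qed.

Lemma shocked_velocity t a : 0 <= t -> (tau a <= t%:E)%E ->
  u (pos t (g a)) t = cmean u0 t a.
Proof. by move=> t0 at_; rewrite pos_rep// (velocity_pos fl). Qed.

Lemma shock_time_merged t a : 0 <= t -> (tau a <= t%:E)%E -> forall b,
  pos t b = pos t a -> (tau b <= t%:E)%E.
Proof.
rewrite le_eqVlt => /predU1P[<- h b|t0 at_ b e].
  by rewrite (flow0 fl b (lexx 0)) (flow0 fl a (lexx 0)) => ->; exact: h.
have t0' := ltW t0; have [m|/(unmerged fl t0')[la ra]] := boolP (lft t a < rgt t a).
  by apply: (shock_time_le adm fl t0); rewrite /left_end /right_end e.
have /(clusterP fl _ _ t0') := e; rewrite la ra => ab.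
by rewrite -(_ : a = b)//; exact/le_anti.
Qed.

Lemma shocked_atP t a : 0 <= t -> shocked_at mu0 u0 phi t (pos t (g a)) <-> (tau a <= t%:E)%E.
Proof.
move=> t0; rewrite /shocked_at /=; split=> [h|at_].
  rewrite leNgt; apply/negP => at_; move: h.
  by rewrite left_end_rep// tau_rep leNgt at_.
rewrite (pos_rep at_); exact: (shock_time_merged t0 at_ (pos_left_end fl a t0)).
Qed.

Lemma measurable_flow s t : 0 <= s -> 0 <= t -> mfun (phi s t).
Proof.
by move=> s0 t0; apply: nondecreasing_measurable => //; exact: (flow_nondecreasing fl).
Qed.

Lemma measurable_alpha t : 0 <= t -> mfun (fun x => alpha phi x t).
Proof. by move=> t0; apply: nondecreasing_measurable => //; exact: (alpha_homo fl). Qed.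

Lemma measurable_velocity t : 0 <= t -> mfun (fun x => u x t).
Proof.
move=> t0; have lu := adm_integrable adm.
have -> : (fun x => u x t) = cmean u0 t \o (fun x => alpha phi x t).
  by apply/funext => x /=; rewrite -(velocity_pos fl)// (pos_alpha fl).
apply: measurableT_comp; last exact: measurable_alpha.
by apply: (measurable_cluster_mean fl t0); case: lu.
Qed.

Lemma measurable_shocked_at t : 0 <= t -> measurable (shocked_at mu0 u0 phi t).
Proof.
move=> t0; rewrite (_ : shocked_at mu0 u0 phi t =
  (fun x => alpha phi x t) @^-1` [set a | (tau a <= t%:E)%E])//.
rewrite -[_ @^-1` _]setTI; apply: (measurable_alpha t0) => //.
exact: (measurable_shock_time_le adm fl).
Qed.

Lemma measurable_tracked t : 0 <= t -> measurable_fun setT (Z t : T -> measurableTypeR R).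
Proof.
move=> t0; have [mg _ _ _] := rep.
apply: (measurableT_comp (measurable_flow (lexx 0) t0)).
exact: (measurableT_comp mg mX0).
Qed.

Lemma tracked_semigroup s t w : 0 <= s -> s <= t -> Z t w = phi s (t - s) (Z s w).
Proof. exact: (pos_semigroup fl). Qed.

Lemma sigma_process_future t (I : set R) : 0 <= t -> I t ->
  (forall r, I r -> t <= r) -> sigma_process Z I = G t.
Proof.
move=> t0 It tI; apply/seteqP; split.
  apply: smallest_sub; first by have [] := sub_sigma_preimage (measurable_tracked t0).
  move=> _ [r /tI tr [B mB <-]]; exists (phi t (r - t) @^-1` B).
    by rewrite -[_ @^-1` _]setTI; apply: (measurable_flow t0); rewrite ?subr_ge0.
  rewrite !setTI; apply/seteqP; split => w /=; by rewrite (tracked_semigroup _ t0 tr).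
move=> A GA; apply: sub_gen_smallest; by exists t.
Qed.

Lemma sub_sigma_tracked t : 0 <= t -> Defs.sub_sigma_algebra (G t).
Proof. by move=> t0; exact: sub_sigma_preimage (measurable_tracked t0). Qed.

Lemma measurable_shock_cover t n : 0 <= t -> measurable (shock_cover mu0 u0 phi t n).
Proof.
move=> t0; apply: measurableI; first exact: measurable_itv.
have pre (A : set (measurableTypeR R)) : measurable A ->
    measurable ((fun x => alpha phi x t) @^-1` A).
  by move=> mA; rewrite -[_ @^-1` _]setTI; exact: (measurable_alpha t0).
apply: measurableU; first exact: pre (measurable_shock_time_le adm fl _).
by apply: measurableC; exact: pre (measurable_shock_time_fin adm fl).
Qed.

Lemma shock_cover_setT t : \bigcup_n shock_cover mu0 u0 phi t n = setT.
Proof.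
apply/seteqP; split => // x _.
have [s sE] : exists s, (tau (alpha phi x t) <= s%:E)%E \/ tau (alpha phi x t) = +oo%E.
  have [e|/shock_time_fine[s _ e]] := pselect (tau (alpha phi x t) = +oo%E).
    by exists 0; right.
  by exists s; left; rewrite e.
pose n := (Num.truncn (Num.max `|x| s)).+1.
have : Num.max `|x| s < n%:R by exact: truncnS_gt.
rewrite gt_max => /andP[/ltW xn /ltW sn]; exists n => //; split.
  by rewrite /= in_itv /= -ler_norml.
case: sE => [h|e]; [left|right]; last by rewrite /= e ltxx.
by apply: (le_trans h); rewrite lee_fin.
Qed.

(* A finite shock time is bounded on [shock_cover], hence so are the sizes of the
   clusters through which the initial positions are tracked. *)
Lemma shock_cover_bounded t n : 0 <= t -> exists p q,
  forall a, shock_cover mu0 u0 phi t n (pos t (g a)) -> p <= a <= q.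
Proof.
(* A particle shocked by [N] is then at the place of its representative, between the images [x1] and
   [x2] of the ends of the window. One not shocked by [N] has, on the cover, an infinite shock
   time. *)
move=> t0; pose N := Num.max n%:R t.
have tN : t <= N by rewrite le_max lexx orbT.
have nN : n%:R <= N by rewrite le_max lexx.
have N0 := le_trans t0 tN.
have Nt : 0 <= N - t by rewrite subr_ge0.
pose x1 := phi t (N - t) (- n%:R); pose x2 := phi t (N - t) n%:R.
exists (Num.min (alpha phi x1 N) (alpha phi (- n%:R) t)).
exists (Num.max (beta phi x2 N) (alpha phi n%:R t)).
move=> a [/=]; rewrite in_itv /= => /andP[na an] fin_or.
have [aN|Na] := leP (tau a) N%:E.
  have e : pos N a = phi t (N - t) (pos t (g a)).
    by rewrite -(pos_semigroup fl)// pos_rep.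
  have x1a : x1 <= pos N a by rewrite e; exact: (flow_nondecreasing fl).
  have ax2 : pos N a <= x2 by rewrite e; exact: (flow_nondecreasing fl).
  apply/andP; split.
    rewrite ge_min (le_trans (alpha_homo fl N0 x1a))//.
    exact: (left_end_le fl).
  rewrite le_max (le_trans _ (beta_homo fl N0 ax2))//.
  exact: (right_end_ge fl).
have ta : (t%:E < tau a)%E by apply: le_lt_trans Na; rewrite lee_fin.
have [_ _ _ goo] := rep.
have ga : g a = a.
  apply: goo; move: fin_or; rewrite left_end_rep// tau_rep.
  case=> [h|/negP]; last by rewrite ltey negbK => /eqP.
  by move: (lt_le_trans Na h); rewrite lte_fin ltNge nN.
have aE : a = alpha phi (pos t (g a)) t by rewrite left_end_rep.
apply/andP; split.
  by rewrite ge_min; apply/orP; right; rewrite aE; exact: (alpha_homo fl).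
by rewrite le_max; apply/orP; right; rewrite {1}aE; exact: (alpha_homo fl).
Qed.

Let integral_image (k : R -> \bar R) (A : set (measurableTypeR R)) :
  (\int[mu0]_(a in A) k a = \int[pushforward P (X0 : T -> measurableTypeR R)]_(a in A) k a)%E.
Proof. by apply: eq_measure_integral => B mB _; exact/esym/imX0. Qed.

Let mpre (A : set (measurableTypeR R)) : measurable A -> measurable (X0 @^-1` A).
Proof. by move=> mA; rewrite -[_ @^-1` _]setTI; exact: mX0. Qed.

Lemma integrable_X0 (f : R -> R) (A : set (measurableTypeR R)) :
  mfun f -> measurable A -> P.-integrable (X0 @^-1` A) (EFin \o (f \o X0)) <->
  mu0.-integrable A (EFin \o f).
Proof.
move=> mf mA; have absE : (\int[mu0]_(a in A) `|(f a)%:E| =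
    \int[P]_(w in X0 @^-1` A) `|(f (X0 w))%:E|)%E.
  rewrite integral_image (ge0_integral_pushforward mX0)//.
  by apply: measurableT_comp => //; apply/measurable_EFinP; exact: measurable_funTS.
split=> /integrableP[_ fin]; apply/integrableP; split.
- by apply/measurable_EFinP; exact: measurable_funTS.
- by rewrite absE.
- by apply/measurable_EFinP; apply: measurable_funTS; exact: measurableT_comp.
- by rewrite -absE.
Qed.

Lemma integral_X0 (f : R -> R) (A : set (measurableTypeR R)) :
  mfun f -> measurable A -> mu0.-integrable A (EFin \o f) ->
  (\int[P]_(w in X0 @^-1` A) (f (X0 w))%:E = \int[mu0]_(a in A) (f a)%:E)%E.
Proof.
move=> mf mA /(integrable_X0 mf mA) fi.
rewrite integral_image (integral_pushforward mX0)//.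
exact/measurable_EFinP.
Qed.

End tracked_process.

(** A single jump, so [f] is monotone with variation at most [|c|]; for positive [c] its opposite is
    the nondecreasing one. *)
Lemma total_variation_step {R : realType} (f : R -> R) (c t : R) (e : \bar R) :
  0 <= t -> (forall s, 0 <= s -> f s = if (s%:E < e)%E then c else 0) ->
  (total_variation 0 t f <= `|c|%:E)%E.
Proof.
move=> t0 fE.
have mono (h : R -> R) k : k <= 0 ->
    (forall s, 0 <= s -> h s = if (s%:E < e)%E then k else 0) ->
    (total_variation 0 t h <= `|k|%:E)%E.
  move=> k0 hE; rewrite nondecreasing_total_variation//.
    rewrite lee_fin !hE// ler0_norm//.
    by case: ifP => _; case: ifP => _; lra.
  move=> x y; rewrite !in_itv /= => /andP[x0 _] /andP[y0 _] xy; rewrite !hE//.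
  case: ifPn => [xe|]; case: ifPn => // ye.
  by rewrite -leNgt => ex; move: ye; rewrite ltNge (le_trans ex)// lee_fin.
have [c0|c0] := leP c 0; first exact: mono.
rewrite -total_variationN -normrN; apply: mono; first by rewrite oppr_le0 ltW.
by move=> s s0; rewrite /= fE//; case: ifP; rewrite ?oppr0.
Qed.

Section measurable_wrt_difference.
Context {R : realType} d {T : measurableType d}.

Lemma measurable_wrtB (G : set (set T)) (X Y : T -> R) :
  Defs.sub_sigma_algebra G -> measurable_wrt G X -> measurable_wrt G Y ->
  measurable_wrt G (fun w => X w - Y w).
Proof.
move=> sG mX mY.
have GE : @measurable _ (g_sigma_algebraType G) = G.
  by rewrite /measurable/=; apply: sigma_algebra_id; case: sG.
have fun_of (W : T -> R) : measurable_wrt G W ->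
    measurable_fun setT (W : g_sigma_algebraType G -> measurableTypeR R).
  by move=> mW _ B mB; rewrite setTI GE; exact: measurable_wrt_preimage.
have := measurable_funB (fun_of _ mX) (fun_of _ mY).
move=> mXY _ [B mB <-]; rewrite -[X in X _]GE; exact: mXY.
Qed.

End measurable_wrt_difference.

(** Intended for [C] a version of E[u0(X_0) | Z_0]; it is then a version of E[u0(X_0) | Z_t]. *)
Definition tracked_mart {R : realType} {T : Type}
    (mu0 : {measure set (measurableTypeR R) -> \bar R}) (u0 : R -> R)
    (phi : R -> R -> R -> R) (g : R -> R) (X0 C : T -> R) (t : R) (w : T) : R :=
  if (shock_time mu0 u0 phi (X0 w) <= t%:E)%E
  then velocity mu0 u0 phi (tracked phi g X0 t w) t else C w.

(** * The conditional expectation of the initial velocity given [Z_t] *)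

Section tracked_martingale.
Context {R : realType} {mu0 : {measure set (measurableTypeR R) -> \bar R}}
  {u0 : R -> R} {phi : R -> R -> R -> R} {d} {T : measurableType d}
  {P : {measure set T -> \bar R}} {X0 : T -> R} {g : R -> R}.
Hypothesis adm : admissible mu0 u0.
Hypothesis fl : sticky_flow mu0 u0 phi.
Hypothesis mX0 : measurable_fun [set: T] (X0 : T -> measurableTypeR R).
Hypothesis imX0 : forall B : set (measurableTypeR R), measurable B ->
  P (X0 @^-1` B) = mu0 B.
Hypothesis rep : shock_representative mu0 u0 phi g.
Local Notation lft := (left_end phi).
Local Notation rgt := (right_end phi).
Local Notation pos := (phi 0).
Local Notation tau := (shock_time mu0 u0 phi).
Local Notation cmean := (cluster_mean mu0 phi).
Local Notation u := (velocity mu0 u0 phi).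
Local Notation Z := (tracked phi g X0).
Local Notation G t := (preimage_set_system setT (Z t) (@measurable _ (measurableTypeR R))).
Local Notation mfun f := (measurable_fun [set: measurableTypeR R] (f : R -> measurableTypeR R)).
Implicit Types t s x y a b c p q : R.

Let mpre (A : set (measurableTypeR R)) : measurable A -> measurable (X0 @^-1` A).
Proof. by move=> mA; rewrite -[_ @^-1` _]setTI; exact: mX0. Qed.

Let mpreZ t (A : set (measurableTypeR R)) : 0 <= t -> measurable A ->
  measurable (Z t @^-1` A).
Proof.
by move=> t0 mA; rewrite -[_ @^-1` _]setTI; exact: (measurable_tracked fl mX0 rep).
Qed.

Lemma cover_finite t n : 0 <= t -> (P (Z t @^-1` shock_cover mu0 u0 phi t n) < +oo)%E.
Proof.
move=> t0; have [p [q pq]] := shock_cover_bounded adm fl rep n t0.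
apply: (@le_lt_trans _ _ (P (X0 @^-1` `[p, q]))).
  apply: le_measure; rewrite ?inE.
  - by apply: mpreZ => //; exact: measurable_shock_cover.
  - by apply: mpre; exact: measurable_itv.
  - by move=> w /pq; rewrite /= in_itv.
rewrite imX0; last exact: measurable_itv.
by apply: (radon_finite (adm_radon adm) _ (@subset_refl _ _)); exact: measurable_itv.
Qed.

Lemma cover_integrable t n : 0 <= t ->
  P.-integrable (Z t @^-1` shock_cover mu0 u0 phi t n) (EFin \o (u0 \o X0)).
Proof.
move=> t0; have [p [q pq]] := shock_cover_bounded adm fl rep n t0.
have lu := adm_integrable adm.
have : P.-integrable (X0 @^-1` `[p, q]) (EFin \o (u0 \o X0)).
  apply/(integrable_X0 mX0 imX0); [by case: lu|exact: measurable_itv|].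
  by apply: (locint_integrable lu _ (@subset_refl _ _)); exact: measurable_itv.
apply: integrableS.
- by apply: mpre; exact: measurable_itv.
- by apply: mpreZ => //; exact: measurable_shock_cover.
- by move=> w /pq; rewrite /= in_itv.
Qed.

Lemma cover_preimage t : \bigcup_n (Z t @^-1` shock_cover mu0 u0 phi t n) = setT.
Proof. by rewrite -preimage_bigcup shock_cover_setT preimage_setT. Qed.

Lemma cover_sigma t n : 0 <= t -> G t (Z t @^-1` shock_cover mu0 u0 phi t n).
Proof. by move=> t0; exists (shock_cover mu0 u0 phi t n); [exact: measurable_shock_cover|rewrite setTI]. Qed.

Lemma initial_cond_exp_exists : exists C, is_cond_exp P (G 0) (fun w => u0 (X0 w)) C.
Proof.
apply: (cond_exp_exists (measurable_tracked fl mX0 rep (lexx 0)) (B := shock_cover mu0 u0 phi 0)).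
- exact: shock_cover_setT.
- by move=> n; exact: measurable_shock_cover.
- by move=> n; exact: cover_finite.
- by move=> n; exact: cover_integrable.
Qed.

Lemma tracked0 w : Z 0 w = g (X0 w).
Proof. exact: (flow0 fl). Qed.

(** Whether the shock has occurred is read off [Z_t]. If not, [alpha] recovers [Z_0] from [Z_t], so
    the event [D] of [Z_0] that describes [C] becomes an event of [Z_t]. *)
Lemma tracked_mart_measurable C t : measurable_wrt (G 0) C -> 0 <= t ->
  measurable_wrt (G t) (tracked_mart mu0 u0 phi g X0 C t).
Proof.
move=> mC t0 _ [B mB <-].
have [D mD DE] : G 0 (C @^-1` B) by exact: measurable_wrt_preimage.
have mS := measurable_shocked_at adm fl t0.
have pre (f : R -> R) (E : set (measurableTypeR R)) : mfun f -> measurable E ->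
    measurable (f @^-1` E : set (measurableTypeR R)).
  by move=> mf mE; rewrite -[_ @^-1` _]setTI; exact: mf.
exists ((shocked_at mu0 u0 phi t `&` (fun x => u x t) @^-1` B) `|`
    ((fun x => alpha phi x t) @^-1` D `\` shocked_at mu0 u0 phi t)).
  apply: measurableU; first by apply: measurableI => //; apply: pre mB; exact: (measurable_velocity adm fl t0).
  by apply: measurableD => //; apply: pre mD; exact: (measurable_alpha fl t0).
rewrite !setTI; apply/seteqP; split => w; rewrite /preimage /= /tracked_mart.
  move=> [[/(shocked_atP adm fl rep _ t0) -> //]|[Dw nS]].
  have ltw : (t%:E < tau (X0 w))%E.
    by rewrite ltNge; apply/negP => h; apply: nS; apply/(shocked_atP adm fl rep).
  rewrite leNgt ltw /=; have : (Z 0 @^-1` D) w.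
    by rewrite /preimage /= tracked0 -[X in D X](left_end_rep adm fl rep t0 ltw).
  by rewrite -[Z 0 @^-1` D]setTI DE.
case: ifPn => [h Bw|]; first by left; split; [apply/(shocked_atP adm fl rep _ t0); exact: h|exact: Bw].
rewrite -ltNge => ltw Cw; right; split; last first.
  by move/(shocked_atP adm fl rep _ t0); rewrite leNgt ltw.
have : (Z 0 @^-1` D) w by rewrite -[Z 0 @^-1` D]setTI DE.
by rewrite /preimage /= tracked0 /tracked (left_end_rep adm fl rep t0 ltw).
Qed.

(** An event of [Z_t] splits in two. Where [gamma <= t] it is an event of [X_0] given by a saturated
    set, on which cluster means preserve integrals; where [t < gamma] it is an event of [Z_0], on
    which [C] has the integral of [u0 (X0 w)]. *)
Lemma tracked_mart_cond_exp C t : is_cond_exp P (G 0) (fun w => u0 (X0 w)) C ->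
  0 <= t -> is_cond_exp P (G t) (fun w => u0 (X0 w)) (tracked_mart mu0 u0 phi g X0 C t).
Proof.
move=> [_ _ mC CE] t0; have sG := sub_sigma_tracked fl mX0 rep t0.
have mM := tracked_mart_measurable mC t0.
apply: (is_cond_exp_cover sG (cover_preimage t)) => //.
- by move=> n; exact: cover_sigma.
- by move=> n; exact: cover_integrable.
move=> n A GA AF; have mA : measurable A by exact: sG.2.
have Ai : P.-integrable A (EFin \o (u0 \o X0)).
  apply: integrableS AF (cover_integrable n t0) => //.
  by apply: mpreZ => //; exact: measurable_shock_cover.
have [E mE AE] := GA; rewrite setTI in AE.
have lu := adm_integrable adm; have [mu_ _] := lu.
have mpos : mfun (pos t) by exact: (measurable_flow fl (lexx 0) t0).
have mposE : measurable (pos t @^-1` E : set (measurableTypeR R)).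
  by rewrite -[_ @^-1` _]setTI; exact: mpos.
pose S : set (measurableTypeR R) := [set a | (tau a <= t%:E)%E] `&` pos t @^-1` E.
have mS : measurable S.
  by apply: measurableI => //; exact: (measurable_shock_time_le adm fl).
pose E2 : set (measurableTypeR R) := [set a | (t%:E < tau a)%E] `&` pos t @^-1` E.
have mE2 : measurable E2.
  by apply: measurableI => //; exact: (measurable_shock_time_gt adm fl).
have A12 : A = X0 @^-1` S `|` Z 0 @^-1` E2.
  rewrite -AE; apply/seteqP; split => w; rewrite /S /E2 /preimage /= tracked0 (tau_rep rep).
    have [h|h] := leP (tau (X0 w)) t%:E; last by right.
    by rewrite /tracked (pos_rep fl rep h); left.
  by move=> [[h]|[]//]; rewrite /tracked (pos_rep fl rep h).
have mA1 : measurable (X0 @^-1` S) by exact: mpre.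
have mA2 : measurable (Z 0 @^-1` E2) by exact: mpreZ.
have dis : [disjoint X0 @^-1` S & Z 0 @^-1` E2].
  apply/disj_setPS => w [[h _] [+ _]]; rewrite /= tracked0 (tau_rep rep).
  by rewrite ltNge; move: h => /= ->.
have mMT := measurable_wrt_measurable sG mM.
have Ai1 : P.-integrable (X0 @^-1` S) (EFin \o (u0 \o X0)).
  by apply: integrableS Ai => //; rewrite A12; exact: subsetUl.
have Ai2 : P.-integrable (Z 0 @^-1` E2) (EFin \o (u0 \o X0)).
  by apply: integrableS Ai => //; rewrite A12; exact: subsetUr.
rewrite A12 !integral_setU//; last 2 first.
- by rewrite -A12; exact: measurable_int Ai.
- by apply/measurable_EFinP; exact: measurable_funTS.
congr (_ + _)%E.
  have sS : saturated phi t S.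
    move=> a b [h Ea] e; split; first exact: (shock_time_merged adm fl t0 h e).
    by rewrite /preimage /= e.
  have Si := (integrable_X0 mX0 imX0 mu_ mS).1 Ai1.
  have [cSi cSE] := integral_cluster_mean adm fl lu t0 mS sS Si.
  rewrite (integral_X0 mX0 imX0 mu_ mS Si) -cSE.
  rewrite -(integral_X0 mX0 imX0 _ mS cSi); last exact: (measurable_cluster_mean fl t0 mu_).
  apply: eq_integral => w; rewrite inE => -[h _]; move: (h) => /= h'.
  by rewrite /tracked_mart h' (shocked_velocity fl rep t0 h').
have [_ <-] := CE _ (ex_intro2 _ _ E2 mE2 (setTI _)) Ai2.
apply: eq_integral => w; rewrite inE => -[+ _]; rewrite /= tracked0 (tau_rep rep) => h.
by rewrite /tracked_mart leNgt h.
Qed.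

Lemma tracked_mart_martingale C : is_cond_exp P (G 0) (fun w => u0 (X0 w)) C ->
  backward_martingale P (backward_filtration Z) (tracked_mart mu0 u0 phi g X0 C).
Proof.
move=> CE; have FE t : 0 <= t -> backward_filtration Z t = G t.
  by move=> t0; apply: (sigma_process_future fl mX0 rep) => //=.
split => [t t0|s t s0 st].
  by rewrite FE//; apply: tracked_mart_measurable => //; case: CE.
have t0 := le_trans s0 st; rewrite FE//.
apply: is_cond_exp_tower (tracked_mart_cond_exp CE s0) (tracked_mart_cond_exp CE t0).
rewrite -!FE//; apply: smallest_sub; first exact: smallest_sigma_algebra.
move=> A [r /= tr rA]; apply: sub_gen_smallest; exists r => //=.
exact: le_trans tr.
Qed.

End tracked_martingale.

Lemma eq_backward_martingale {R : realType} d {T : measurableType d}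
    (P : {measure set T -> \bar R}) (G : R -> set (set T)) (M N : R -> T -> R) :
  (forall t w, 0 <= t -> N t w = M t w) ->
  backward_martingale P G M -> backward_martingale P G N.
Proof.
move=> NM [aM mM]; have {}NM t : 0 <= t -> N t = M t.
  by move=> t0; apply/funext => w; exact: NM.
split => [t t0|s t s0 st]; rewrite !NM ?(le_trans s0)//; [exact: aM|exact: mM].
Qed.

(** * Markov property and regularity of paths *)

Section tracked_paths.
Context {R : realType} {mu0 : {measure set (measurableTypeR R) -> \bar R}}
  {u0 : R -> R} {phi : R -> R -> R -> R} {d} {T : measurableType d}
  {P : {measure set T -> \bar R}} {X0 : T -> R} {g : R -> R}.
Hypothesis adm : admissible mu0 u0.
Hypothesis fl : sticky_flow mu0 u0 phi.
Hypothesis mX0 : measurable_fun [set: T] (X0 : T -> measurableTypeR R).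
Hypothesis imX0 : forall B : set (measurableTypeR R), measurable B ->
  P (X0 @^-1` B) = mu0 B.
Hypothesis rep : shock_representative mu0 u0 phi g.
Local Notation lft := (left_end phi).
Local Notation rgt := (right_end phi).
Local Notation pos := (phi 0).
Local Notation tau := (shock_time mu0 u0 phi).
Local Notation cmean := (cluster_mean mu0 phi).
Local Notation u := (velocity mu0 u0 phi).
Local Notation Z := (tracked phi g X0).
Local Notation G t := (preimage_set_system setT (Z t) (@measurable _ (measurableTypeR R))).
Local Notation mfun f := (measurable_fun [set: measurableTypeR R] (f : R -> measurableTypeR R)).
Implicit Types t s x y a b c p q : R.

(** The future of [Z] is determined by [Z_t], so the indicator of a future event is measurable for
    the present and is its own conditional expectation, given the present as well as given the
    past. *)
Lemma tracked_markovian : markovian P Z.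
Proof.
move=> t B t0; rewrite (sigma_process_future fl mX0 rep t0)//= => GB.
have sG := sub_sigma_tracked fl mX0 rep t0.
have indic_int n : P.-integrable (Z t @^-1` shock_cover mu0 u0 phi t n) (EFin \o (\1_B : T -> R)).
  apply: measurable_bounded_integrable.
  - exact: sG.2 (cover_sigma adm fl n t0).
  - exact: (cover_finite adm fl mX0 imX0 rep).
  - by apply: measurable_funTS; apply: measurable_indic; exact: sG.2.
  - exists 1; split => // M M1 w _; rewrite /= indicE.
    by case: (w \in B); rewrite ?normr1 ?normr0 ltW// (lt_trans ltr01).
have sub : G t `<=` sigma_process Z [set r | 0 <= r <= t].
  by move=> A GA; apply: sub_gen_smallest; exists t => //=; rewrite t0 lexx.
have sP : Defs.sub_sigma_algebra (sigma_process Z [set r | 0 <= r <= t]).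
  split; first exact: smallest_sigma_algebra.
  apply: smallest_sub; first exact: sigma_algebra_measurable.
  move=> _ [r /= /andP[r0 _] [D mD <-]].
  exact: (measurable_tracked fl mX0 rep r0).
have cover n : G t (Z t @^-1` shock_cover mu0 u0 phi t n) by exact: (cover_sigma adm fl).
exists (\1_B).
  rewrite (sigma_process_future fl mX0 rep t0)//=; last by move=> r ->.
  apply: (is_cond_exp_self sG (cover_preimage _)) => //.
  exact: measurable_wrt_indic.
apply: (is_cond_exp_self sP (cover_preimage _)) => //.
  by move=> n; exact: sub.
by apply: measurable_wrt_indic => //; exact: sub.
Qed.

(** The path is constant before [tau a] and a cluster mean afterwards, so the limits in time of
    cluster means suffice at positive times. Right continuity at 0 of a particle shocked at once is
    the only case left to [init]. *)
Lemma cadlag_shocked (f : R -> R) a c :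
  (tau a = 0%:E -> cmean u0 t a @[t --> 0^'+] --> u0 a) ->
  (forall t, 0 <= t -> f t = if (tau a <= t%:E)%E then cmean u0 t a else c) ->
  cadlag f.
Proof.
move=> init fE; split => t t0.
  have [at_|ta] := leP (tau a) t%:E.
    have fr : \forall s \near t^'+, cmean u0 s a = f s.
      near=> s; have ts : t <= s by apply: ltW; near: s; exact: nbhs_right_gt.
      by rewrite fE ?(le_trans t0)// (le_trans at_)// lee_fin.
    rewrite fE// at_; apply: cvg_trans (near_eq_cvg fr) _.
    move: t0; rewrite le_eqVlt => /predU1P[t00|t0]; last exact: cluster_mean_cvg_right.
    have a0 : tau a = 0%:E.
      by apply/le_anti; rewrite shock_time_ge0 andbT [X in (_ <= X%:E)%E]t00.
    have -> : cmean u0 t a = u0 a.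
      by rewrite -t00 /cluster_mean (left_end0 fl) (right_end0 fl) ltxx.
    by rewrite -t00; exact: init.
  have cf : \forall s \near t^'+, f s = f t.
    have lt_near : \forall s \near t^'+, (s%:E < tau a)%E.
      have [e|/shock_time_fine[r _ e]] := pselect (tau a = +oo%E).
        by apply: nearW => s; rewrite e ltry.
      rewrite e lte_fin in ta *; near=> s; rewrite lte_fin; near: s.
      exact: nbhs_right_lt.
    near=> s; have ts : t <= s by apply: ltW; near: s; exact: nbhs_right_gt.
    have ls : (s%:E < tau a)%E by near: s.
    have s0 : 0 <= s := le_trans t0 ts.
    by rewrite (fE s s0) (fE t t0) !leNgt ta ls.
  exact: cvg_near_cst cf.
have [ta|at_] := leP t%:E (tau a).
  have cf : \forall s \near t^'-, f s = c.
    near=> s; have s0 : 0 <= s by apply: ltW; near: s; exact: nbhs_left_gt.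
    have st : (s%:E < tau a)%E.
      by apply: lt_le_trans ta; rewrite lte_fin; near: s; exact: nbhs_left_lt.
    by rewrite fE// leNgt st.
  by apply: (cvgP c); exact: cvg_near_cst cf.
have [r [ar rt]] : exists r, (tau a <= r%:E)%E /\ r < t.
  have [e|r r0 e] := @shock_time_fine _ mu0 u0 phi a; first by move: at_; rewrite e.
  by exists r; rewrite e lexx -lte_fin -e.
have fr : \forall s \near t^'-, cmean u0 s a = f s.
  near=> s; have rs : r <= s by apply: ltW; near: s; exact: nbhs_left_gt.
  have s0 : 0 <= s by apply: ltW; near: s; exact: nbhs_left_gt.
  by rewrite fE// (le_trans ar)// lee_fin.
apply: (cvgP (lim (cmean u0 s a @[s --> t^'-]))).
exact: cvg_trans (near_eq_cvg fr) (cluster_mean_cvg_left adm fl t0).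
Unshelve. all: by end_near.
Qed.

Lemma initial_velocity_image_ae :
  {ae P, forall w, tau (X0 w) = 0%:E -> cmean u0 t (X0 w) @[t --> 0^'+] --> u0 (X0 w)}.
Proof.
have [N [mN N0 bad]] := initial_velocity_ae adm fl.
exists (X0 @^-1` N); split.
- by rewrite -[_ @^-1` _]setTI; exact: mX0.
- by rewrite imX0.
- by move=> w h; exact: bad.
Qed.

Lemma tracked_velocity t w : 0 <= t -> u (Z t w) t =
  if (tau (X0 w) <= t%:E)%E then cmean u0 t (X0 w) else u0 (g (X0 w)).
Proof.
move=> t0; case: ifPn => [h|]; first exact: (shocked_velocity fl rep).
by rewrite -ltNge => h; exact: (unmerged_rep adm fl rep).
Qed.

End tracked_paths.

Theorem corollary3p4 (R : realType)
    (mu0 : {measure set (measurableTypeR R) -> \bar R}) (u0 : R -> R)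
    (phi : R -> R -> R -> R)
    (d : measure_display) (T : measurableType d)
    (P : {measure set T -> \bar R}) (X0 : T -> R)
    (Z : R -> T -> R) :
  admissible mu0 u0 ->
  sticky_flow mu0 u0 phi ->
  measurable_fun [set: T] (X0 : T -> measurableTypeR R) ->
  (forall B : set (measurableTypeR R), measurable B ->
    P (X0 @^-1` B) = mu0 B) ->
  [\/ Z = Z1 mu0 u0 phi X0, Z = Z2 mu0 u0 phi X0,
      Z = Z3 mu0 u0 phi X0 | Z = Z4 mu0 u0 phi X0] ->
  let u := velocity mu0 u0 phi in
  let gamma := fun w => shock_time mu0 u0 phi (X0 w) in
  let FZ := backward_filtration Z in
  let is_E_u0X0_given_Z0 :=
    is_cond_exp P (sigma_process Z [set 0]) (fun w => u0 (X0 w)) in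
  [/\ markovian P Z,
      (exists C, is_E_u0X0_given_Z0 C),
      (let Y t w := u (Z t w) t * \1_[set w | t%:E < gamma w]%E w in
       bounded_variation_process Y /\ adapted FZ Y),
      (let Y t w := u (Z t w) t * \1_[set w | gamma w <= t%:E]%E w in
       backward_cadlag_semimartingale P FZ Y /\
       forall C, is_E_u0X0_given_Z0 C ->
         backward_martingale P FZ
           (fun t w => Y t w + C w * \1_[set w | t%:E < gamma w]%E w))
    & (let Y t w := u (Z t w) t in
       backward_cadlag_semimartingale P FZ Y /\
       forall C, is_E_u0X0_given_Z0 C ->
         backward_martingale P FZ
           (fun t w => Y t w -
              (u0 (Z 0 w) - C w) * \1_[set w | t%:E < gamma w]%E w))].


Proof.
move=> adm fl mX0 imX0 ZE.
have [g rep {ZE}->] : exists2 g, shock_representative mu0 u0 phi g & Z = tracked phi g X0.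
  case: ZE => ->.
  - exists (turb_left mu0 u0 phi); [exact: (turb_left_representative adm fl)|reflexivity].
  - exists (turb_right mu0 u0 phi); [exact: (turb_right_representative adm fl)|reflexivity].
  - exists (shock_left mu0 u0 phi); [exact: (shock_left_representative adm fl)|reflexivity].
  - exists (shock_right mu0 u0 phi); [exact: (shock_right_representative adm fl)|reflexivity].
move=> u gamma FZ; set V := tracked phi g X0.
have past t w : (gamma w <= t%:E)%E = ~~ (t%:E < gamma w)%E by rewrite leNgt.
have FE t : 0 <= t -> FZ t = preimage_set_system setT (V t) (@measurable _ (measurableTypeR R)).
  by move=> t0; apply: (sigma_process_future fl mX0 rep) => //=.
have F0 : sigma_process V [set 0] =
    preimage_set_system setT (V 0) (@measurable _ (measurableTypeR R)).
  by apply: (sigma_process_future fl mX0 rep) => //= r ->.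
have before t w : (\1_[set w | t%:E < gamma w]%E w : R) = (t%:E < gamma w)%E%:R.
  by rewrite indicE mem_setE.
have after t w : (\1_[set w | gamma w <= t%:E]%E w : R) = (gamma w <= t%:E)%E%:R.
  by rewrite indicE mem_setE.
rewrite F0.
(* This version supplies the semimartingale decompositions; the martingale claims are proved for
   every version [D]. *)
have [C CE] := initial_cond_exp_exists adm fl mX0 imX0 rep.
pose M C := tracked_mart mu0 u0 phi g X0 C.
have martE D (CD : is_cond_exp P (preimage_set_system setT (V 0) (@measurable _ (measurableTypeR R)))
    (fun w => u0 (X0 w)) D) : backward_martingale P FZ (M D).
  exact: (tracked_mart_martingale adm fl mX0 imX0 rep).
have uV t w : 0 <= t -> u (V t w) t = if (gamma w <= t%:E)%E
    then cluster_mean mu0 phi u0 t (X0 w) else u0 (g (X0 w)).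
  exact: (tracked_velocity adm fl rep).
(* The combination in the second item is [M D] pointwise, with no exceptional set. *)
have MB D t w : u (V t w) t * \1_[set w | gamma w <= t%:E]%E w +
    D w * \1_[set w | t%:E < gamma w]%E w = M D t w.
  rewrite before after past /M /tracked_mart -/(gamma w) past.
  by case: (t%:E < gamma w)%E; rewrite /= ?mulr1 ?mulr0 ?addr0 ?add0r.
have mS t : 0 <= t -> measurable (shocked_at mu0 u0 phi t).
  by move=> t0; exact: (measurable_shocked_at adm fl t0).
have adapted_eq (X Y : R -> T -> R) : (forall t w, 0 <= t -> Y t w = X t w) ->
    adapted FZ X -> adapted FZ Y.
  move=> YX aX t t0; have -> : Y t = X t by apply/funext => w; exact: YX.
  exact: aX.
have shockedE t w : 0 <= t -> (gamma w <= t%:E)%E = (V t w \in shocked_at mu0 u0 phi t).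
  move=> t0; have SP := shocked_atP adm fl rep (X0 w) t0.
  by apply/idP/idP => [h|/set_mem h]; [exact: mem_set (SP.2 h)|exact: SP.1 h].
have adapted_indic (A : R -> set (measurableTypeR R)) :
    (forall t, 0 <= t -> measurable (A t)) ->
    adapted FZ (fun t w => u (V t w) t * \1_(A t) (V t w)).
  move=> mA t t0; rewrite FE//.
  apply: (@measurable_wrt_comp _ _ _ _ (fun x => u x t * \1_(A t) x)).
  by apply: measurable_funM; [exact: (measurable_velocity adm fl t0)|exact: measurable_indic (mA _ t0)].
have adapted_shocked : adapted FZ (fun t w => u (V t w) t * \1_[set w | gamma w <= t%:E]%E w).
  apply: (adapted_eq _ _ _ (adapted_indic _ mS)) => t w t0.
  by rewrite after shockedE// indicE.
have adapted_unshocked : adapted FZ (fun t w => u (V t w) t * \1_[set w | t%:E < gamma w]%E w).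
  have mC t : 0 <= t -> measurable (~` shocked_at mu0 u0 phi t).
    by move=> t0; exact: measurableC (mS t t0).
  apply: (adapted_eq _ _ _ (adapted_indic _ mC)) => t w t0.
  by rewrite before indicE in_setC -shockedE// past negbK.
have adapted_u : adapted FZ (fun t w => u (V t w) t).
  move=> t t0; rewrite FE//.
  exact: (@measurable_wrt_comp _ _ _ _ (fun x => u x t)) (measurable_velocity adm fl t0).
have adaptedB (X : R -> T -> R) : adapted FZ X -> adapted FZ (fun t w => X t w - M C t w).
  move=> aX t t0; apply: measurable_wrtB; last 2 first.
  - exact: aX.
  - by have [aM _] := martE _ CE; exact: aM.
  - by rewrite FE//; exact: (sub_sigma_tracked fl mX0 rep).
split.
- exact: (tracked_markovian adm fl mX0 imX0 rep).
- by exists C.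
(* Before its shock the tracked particle keeps its initial speed, so the path has a single step. *)
- split=> // w; exists `|u0 (g (X0 w))| => t t0.
  apply: (total_variation_step (e := gamma w)) => // s s0.
  rewrite before uV// past.
  by case: (s%:E < gamma w)%E; rewrite /= ?mulr1 ?mulr0.
- split; last first.
    move=> D CD; apply: eq_backward_martingale (martE _ CD) => t w _; exact: MB.
  split.
    have := initial_velocity_image_ae adm fl mX0 imX0.
    apply: filterS => w init; apply: (cadlag_shocked adm fl (c := 0) init) => t t0.
    rewrite after uV// -/(gamma w).
    by case: (gamma w <= t%:E)%E; rewrite /= ?mulr1 ?mulr0.
  (* The remainder is [- C w] before [gamma] and 0 afterwards, which is of bounded variation. *)
  exists (M C), (fun t w => u (V t w) t * \1_[set w | gamma w <= t%:E]%E w - M C t w).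
  split=> [|||t w t0]; [exact: martE|exact: adaptedB| |by rewrite addrC subrK].
  move=> w; exists `|- C w| => t t0.
  apply: (total_variation_step (e := gamma w)) => // s s0.
  rewrite -MB opprD addrA subrr add0r before.
  by case: (s%:E < gamma w)%E; rewrite /= ?mulr1 ?mulr0 ?oppr0.
split; last first.
  move=> D CD; apply: eq_backward_martingale (martE _ CD) => t w t0.
  have V0 : V 0 w = g (X0 w) by exact: (tracked0 fl).
  rewrite -MB uV// before after past V0.
  by case: (t%:E < gamma w)%E; rewrite /= ?mulr1 ?mulr0 ?subr0 ?addr0 ?add0r// opprB addrC subrK.
split.
  have := initial_velocity_image_ae adm fl mX0 imX0.
  apply: filterS => w init; apply: (cadlag_shocked adm fl (c := u0 (g (X0 w))) init) => t t0.
  exact: uV.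
(* Here the remainder is [u0 (g (X0 w)) - C w] before [gamma], where [g (X0 w)] is [Z_0], and 0
   afterwards. *)
exists (M C), (fun t w => u (V t w) t - M C t w).
split=> [|||t w t0]; [exact: martE|exact: adaptedB| |by rewrite addrC subrK].
move=> w; exists `|u0 (g (X0 w)) - C w| => t t0.
apply: (total_variation_step (e := gamma w)) => // s s0.
rewrite -MB before after uV// past.
by case: (s%:E < gamma w)%E; rewrite /= ?mulr1 ?mulr0 ?addr0 ?add0r ?subrr.
Qed.
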